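(* Let $\nu \in (0,1)$ and let $\kappa,\lambda>0$ be such that $5\kappa+\lambda <\nu$. Let $A$ and $B=\{B(p)\}_p$ be tensors associated with injective excitation ansatz states $|\Phi_p(B;A)\rangle$ (satisfying the gauge condition below), where $p$ is the momentum of the state. Then there is a subspace $\mathcal{C}\subset (\mathbb{C}^\mathsf{p})^{\otimes n}$ spanned by excitation ansatz states $\{|\Phi_p(B;A)\rangle\}_p$ with different momenta $p$ such that $\mathcal{C}$ is an $(\epsilon,\delta)[[n,k,d]]$-AQEDC with parameters \[ k=\kappa \log_\mathsf{p} n,\qquad d=n^{1-\nu},\qquad \epsilon =\Theta(n^{-(\nu-(5\kappa+\lambda))}),\qquad \delta=n^{-\lambda}. \]
   Context: Excitation ansatz: for $D\times D$ matrices $A=\{A_i\}_{i=1}^\mathsf{p}$ and $B(p)=\{B_i(p)\}_{i=1}^\mathsf{p}$ and $p\in\{2\pi k/n:k=0,\dots,n\}$, $|\Phi_p(B;A)\rangle=e^{-ip}\sum_{j=1}^ne^{ipj}\sum_{i_1,\dots,i_n}\mathrm{tr}(A_{i_1}\cdots A_{i_{j-1}}B_{i_j}(p)A_{i_{j+1}}\cdots A_{i_n})|i_1\cdots i_n\rangle$. It is injective if $Y\mapsto\sum_iA_iYA_i^\dagger$ is primitive (normalized to spectral radius $1$). With vectorization $|X\rangle\rangle=\sum X_{\alpha\beta}|\beta\rangle\otimes|\alpha\rangle$ and $E=\sum_i\overline{A_i}\otimes A_i$, let $\langle\langle\ell|$ be its left fixed point; standing gauge condition (for $p\ne0$): $\langle\langle\ell|\sum_i\overline{A_i}\otimes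 B_i(p)=0$ and $\langle\langle\ell|\sum_i\overline{B_i(p)}\otimes A_i=0$. A $d$-local operator acts as $F_S\otimes I$ on some set $S$ of $d$ (not necessarily contiguous) sites. A subspace $\mathcal{C}$ with projection $P$ is an $(\epsilon,\delta)$-approximate error-detection code for a CPTP map $\mathcal{N}$ if for every unit $|\Psi\rangle\in\mathcal{C}$ with $\mathrm{tr}(P\mathcal{N}(|\Psi\rangle\langle\Psi|))\ge\delta$ one has $\langle\Psi|\rho_{\mathcal{N},P}|\Psi\rangle\ge1-\epsilon$, $\rho_{\mathcal{N},P}=\mathrm{tr}(P\mathcal{N}(|\Psi\rangle\langle\Psi|))^{-1}P\mathcal{N}(|\Psi\rangle\langle\Psi|)P$. An $(\epsilon,\delta)[[n,k,d]]$-AQEDC is a $\mathsf{p}^k$-dimensional subspace that is an $(\epsilon,\delta)$-approximate error-detection code for every $\mathcal{N}(\rho)=\sum_jp_jF_j\rho F_j^\dagger$ with $F_j$ $d$-local, $\|F_j\|\le1$, $\{p_j\}$ a probability distribution. *)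

(* Defs.v *)
From HB Require Import structures.
From mathcomp Require Import all_boot all_order all_algebra.
From mathcomp Require Import all_classical all_reals all_analysis.
From mathcomp Require Import complex.
Set Implicit Arguments. Unset Strict Implicit. Unset Printing Implicit Defensive.
Import Order.TTheory GRing.Theory Num.Theory.
Local Open Scope ring_scope.

Section QDefs.
Variable R : realType.
Local Notation C := (R[i]).

Definition rC (x : R) : C := Complex x 0.
Definition expi (t : R) : C := Complex (cos t) (sin t).

(* The Hilbert space (C^P)^{\otimes n}: functions on words i_1 ... i_n  *)
(* (computational basis |i_1 ... i_n>).                                *)
Variables n P : nat.
Definition word := {ffun 'I_n -> 'I_P}.
Definition state := {ffun word -> C^o}.
Definition op := word -> word -> C.

Definition inner (u v : state) : C := \sum_w (u w)^* * v w.
Definition apply (F : op) (v : state) : state :=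
  [ffun w => \sum_w' F w w' * v w'].
Definition mulop (F G : op) : op := fun w w' => \sum_u F w u * G u w'.
Definition adjop (F : op) : op := fun w w' => (F w' w)^*.
Definition trop (F : op) : C := \sum_w F w w.
Definition outer (u : state) : op := fun w w' => u w * (u w')^*.

Definition is_projection (Pr : op) (V : {vspace state}) : Prop :=
  [/\ forall w w', mulop Pr Pr w w' = Pr w w',
      forall w w', adjop Pr w w' = Pr w w',
      forall v, apply Pr v \in V &
      forall v, v \in V -> apply Pr v = v].

Definition opnorm_le1 (F : op) : Prop :=
  forall v, inner (apply F v) (apply F v) <= inner v v.

(* F = F_S \otimes I for some set S of d sites *)
Definition restr (S : {set 'I_n}) (w : word) : {ffun {x : 'I_n | x \in S} -> 'I_P} :=
  [ffun x => w (val x)].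
Definition dlocal (d : nat) (F : op) : Prop :=
  exists S : {set 'I_n}, #|S| = d /\
  exists FS : {ffun {x : 'I_n | x \in S} -> 'I_P} ->
              {ffun {x : 'I_n | x \in S} -> 'I_P} -> C,
    forall w w', F w w' =
      if [forall i, (i \notin S) ==> (w i == w' i)]
      then FS (restr S w) (restr S w') else 0.

Definition channel (m : nat) (pr : 'I_m -> R) (Fs : 'I_m -> op) (rho : op) : op :=
  fun w w' => \sum_(j < m) rC (pr j) * mulop (mulop (Fs j) rho) (adjop (Fs j)) w w'.

Definition approx_detection_code (eps delta : R) (V : {vspace state})
    (N : op -> op) : Prop :=
  forall Pr, is_projection Pr V ->
  forall psi, psi \in V -> inner psi psi = 1 ->
  let t := trop (mulop Pr (N (outer psi))) in
  rC delta <= t ->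
  let rhoNP : op := fun w w' => t^-1 * mulop (mulop Pr (N (outer psi))) Pr w w' in
  rC (1 - eps) <= inner psi (apply rhoNP psi).

Definition AQEDC (k d : nat) (eps delta : R) (V : {vspace state}) : Prop :=
  \dim V = (P ^ k)%N /\
  forall (m : nat) (pr : 'I_m -> R) (Fs : 'I_m -> op),
    (forall j, 0 <= pr j) -> \sum_(j < m) pr j = 1 ->
    (forall j, dlocal d (Fs j) /\ opnorm_le1 (Fs j)) ->
    approx_detection_code eps delta V (channel pr Fs).

End QDefs.

Section MPS.
Variable R : realType.
Local Notation C := (R[i]).
Variables P D : nat.
Local Notation Mx := 'M[C]_D.+1.

Definition hermc (M : Mx) : Mx := map_mx Num.conj (M^T).

Definition transfer (A : 'I_P -> Mx) (Y : Mx) : Mx :=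
  \sum_(i < P) A i *m Y *m hermc (A i).

Definition vadj (v : 'cV[C]_D.+1) : 'rV[C]_D.+1 := map_mx Num.conj (v^T).

Definition psdmx (Y : Mx) : Prop :=
  hermc Y = Y /\ forall v : 'cV[C]_D.+1, 0 <= (vadj v *m Y *m v) 0 0.
Definition pdmx (Y : Mx) : Prop :=
  hermc Y = Y /\ forall v : 'cV[C]_D.+1, v != 0 -> 0 < (vadj v *m Y *m v) 0 0.

Definition primitive_map (T : Mx -> Mx) : Prop :=
  exists m : nat, (0 < m)%N /\
    forall Y, psdmx Y -> Y != 0 -> pdmx (iter m T Y).

Definition spectral_radius1 (T : Mx -> Mx) : Prop :=
  (forall (lam : C) (Y : Mx), Y != 0 -> T Y = lam *: Y -> `|lam| <= 1) /\
  (exists (lam : C) (Y : Mx), [/\ Y != 0, T Y = lam *: Y & `|lam| = 1]).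

(* A row vector <<l| of C^D (x) C^D, in the vectorization
   |X>> = sum X_{ab} |b> (x) |a>, is written <<l| = sum_{ab} L_{ab} <b|(x)<a|,
   so that <<l|X>> = sum_{ab} L_{ab} X_{ab}. *)
Definition pairing (L X : Mx) : C := \sum_(a < D.+1) \sum_(b < D.+1) L a b * X a b.
(* With this vectorization, (conj(M) (x) N) |X>> = |N X M^dagger>>. *)

(* <<l| is a (nonzero) left fixed point of E = sum_i conj(A_i) (x) A_i *)
Definition left_fixed_point (A : 'I_P -> Mx) (L : Mx) : Prop :=
  L != 0 /\ forall X, pairing L (transfer A X) = pairing L X.

(* gauge condition: <<l| sum_i conj(A_i) (x) B_i = 0 and
   <<l| sum_i conj(B_i) (x) A_i = 0 *)
Definition gauge_condition (A Bp : 'I_P -> Mx) (L : Mx) : Prop :=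
  forall X, pairing L (\sum_(i < P) Bp i *m X *m hermc (A i)) = 0 /\
            pairing L (\sum_(i < P) A i *m X *m hermc (Bp i)) = 0.

(* |Phi_p(B;A)> on n sites; site j+1 (1-based) is site j (0-based), so
   e^{-ip} e^{ip(j+1)} = e^{ip j}. *)
Definition excitation (n : nat) (A Bp : 'I_P -> Mx) (p : R) : state R n P :=
  [ffun w : word n P => \sum_(j < n) expi (p * j%:R) *
      \tr (\prod_(l < n) (if l == j then Bp (w l) else A (w l)))].

End MPS.

(* Main.v *)
(** The transfer map of [A] is a primitive positive map of spectral radius one.
    A Doeblin-type lower bound for its power [m] makes it contract the
    oscillation between multiples of the fixed point [r], so its iterates
    converge geometrically to [Y |-> l Y *: r], where [l] is proportional to
    the left fixed point and hence annihilates the gauge terms.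

    Let [F] act on [d] sites and let [|j>] be the product state with the
    excitation at site [j]. A window of [Delta] sites untouched by [F] can be
    replaced, up to an exponentially small error, by [r] and [l]. For distinct
    [j], [j'] at distance at least [Delta] from the support of [F], the gauge
    condition makes [<j'|F|j>] negligible, while [<j|F|j>] is close to a
    constant independent of [j]. The remaining sites number about [d Delta],
    and by Cauchy-Schwarz they contribute at most a multiple of
    [sqrt (n d Delta)]. With [Delta] of order [n `^ kappa], the plane waves with
    distinct momenta satisfy
    [<Phi_p'|F|Phi_p> = n f (delta_pp' + O(n `^ ((3 kappa - nu) / 2)))] with [f]
    depending only on [F].

    For a unit vector [psi] of a code of dimension [M <= n `^ kappa], the
    component of [P F psi] orthogonal to [psi] therefore has squared norm
    [O(n `^ (5 kappa - nu))], a multiple of [eps * delta]. *)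

Require Import Defs.
From HB Require Import structures.
From mathcomp Require Import all_boot all_order all_algebra.
From mathcomp Require Import all_classical all_reals all_analysis.
From mathcomp Require Import complex.
From mathcomp Require Import ring lra zify.
Import Order.TTheory GRing.Theory Num.Theory.
Local Open Scope ring_scope.

Set Implicit Arguments.
Unset Strict Implicit.
Unset Printing Implicit Defensive.

(** * Complex moduli and entrywise matrix norms *)

Section ComplexModulus.
Context {R : realType}.
Implicit Types z w : R[i].

(** The sites near the support of [F] alone cost a relative error [sqrt (d Delta / n)], which is
    compatible with the smaller exponent [(kappa - nu) / 2]. The value [(3 kappa - nu) / 2] is what
    the target can afford, since the squared product of the code dimension and the relative error is
    then n^(5 kappa - nu), and the slack pays for the two ends of the chain. The off-diagonal
    estimate needs a whole window to the left of both excitations, which sites at the left end do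
    not have, so waves on the ends are bounded by the triangle inequality, at the price [Delta]
    instead of [sqrt Delta]. As [nu < 1], this is absorbed by the larger exponent, while the smaller
    one would require [kappa + nu <= 1].

    Any positive power of [n] would serve for [Delta]: the exponentially small window error then
    beats the [n^2] pairs of sites.

    The right fixed point and the positivity of the left one are not given. Both are extracted from
    compactness and from the order on Hermitian matrices, so no spectral decomposition of the
    transfer map enters. *)

Definition cabs z : R := complex.Re `|z|.

Lemma rCE (x : R) : rC x = (x%:C)%C. Proof. by []. Qed.

Lemma conjCE z : z^* = (z^*)%C.
Proof. by []. Qed.

Lemma cabsE z : `|z| = rC (cabs z).
Proof. by rewrite /cabs normc_def. Qed.

Lemma cabs_ge0 z : 0 <= cabs z.
Proof. by rewrite -ler0c -rCE -cabsE. Qed.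

Lemma cabs0 : cabs 0 = 0. Proof. by rewrite /cabs normr0. Qed.
Lemma cabs1 : cabs 1 = 1. Proof. by rewrite /cabs normr1. Qed.

Lemma rC_inj (x y : R) : rC x = rC y -> x = y. Proof. by case. Qed.
Lemma rCM (x y : R) : rC (x * y) = rC x * rC y. Proof. by rewrite !rCE rmorphM. Qed.
Lemma rCD (x y : R) : rC (x + y) = rC x + rC y. Proof. by rewrite !rCE rmorphD. Qed.
Lemma rCB (x y : R) : rC (x - y) = rC x - rC y. Proof. by rewrite !rCE rmorphB. Qed.
Lemma rC0 : rC 0 = 0 :> R[i]. Proof. by []. Qed.
Lemma rC1 : rC 1 = 1 :> R[i]. Proof. by []. Qed.
Lemma rCV (x : R) : rC x^-1 = (rC x)^-1. Proof. by rewrite !rCE fmorphV. Qed.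
Lemma rC_sum (I : Type) (s : seq I) (Q : pred I) (f : I -> R) :
  rC (\sum_(i <- s | Q i) f i) = \sum_(i <- s | Q i) rC (f i).
Proof. exact: (rmorph_sum (real_complex R)). Qed.
Lemma rCnat n : rC n%:R = n%:R :> R[i]. Proof. by rewrite rCE rmorph_nat. Qed.
Lemma rC_conj (x : R) : (rC x)^* = rC x.
Proof. by rewrite conjCE conjc_real. Qed.

Lemma cabsM z w : cabs (z * w) = cabs z * cabs w.
Proof. by apply: rC_inj; rewrite rCM -!cabsE normrM. Qed.

Lemma cabsD z w : cabs (z + w) <= cabs z + cabs w.
Proof. by rewrite -lecR -!rCE rCD -!cabsE ler_normD. Qed.

Lemma cabsN z : cabs (- z) = cabs z. Proof. by rewrite /cabs normrN. Qed.

Lemma cabsC z w : cabs (z - w) = cabs (w - z).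
Proof. by rewrite -cabsN opprB. Qed.

Lemma cabs_conj z : cabs z^* = cabs z. Proof. by rewrite /cabs conjCE normcJ. Qed.

Lemma cabs_rC (x : R) : 0 <= x -> cabs (rC x) = x.
Proof. by move=> x0; apply: rC_inj; rewrite -cabsE ger0_norm // rCE ler0c. Qed.

Lemma cabsV z : cabs z^-1 = (cabs z)^-1.
Proof. by apply: rC_inj; rewrite -cabsE normfV cabsE rCV. Qed.

Lemma cabs_eq0 z : (cabs z == 0) = (z == 0).
Proof.
apply/eqP/eqP => [z0|->]; last exact: cabs0.
by apply/eqP; rewrite -normr_eq0 cabsE z0.
Qed.

Lemma cabs_sum (I : Type) (s : seq I) (Q : pred I) (f : I -> R[i]) :
  cabs (\sum_(i <- s | Q i) f i) <= \sum_(i <- s | Q i) cabs (f i).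
Proof.
rewrite -lecR -!rCE rC_sum -cabsE.
apply: le_trans (ler_norm_sum _ _ _) _.
by apply: ler_sum => i _; rewrite cabsE.
Qed.

Lemma cabs_sqr z : rC (cabs z ^+ 2) = z^* * z.
Proof. by rewrite expr2 rCM -cabsE -expr2 sqr_normc mulrC. Qed.

Lemma cabs_sqrE z : cabs z ^+ 2 = complex.Re z ^+ 2 + complex.Im z ^+ 2.
Proof.
by apply: rC_inj; rewrite expr2 rCM -cabsE -expr2 -add_Re2_Im2.
Qed.

Lemma Re_le_cabs z : `|complex.Re z| <= cabs z.
Proof. by rewrite -lecR -!rCE -cabsE normc_ge_Re. Qed.

Lemma Im_le_cabs z : `|complex.Im z| <= cabs z.
Proof.
rewrite -(@ler_pXn2r _ 2) ?nnegrE ?cabs_ge0 ?normr_ge0 // cabs_sqrE.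
by rewrite real_normK ?num_real // lerDr sqr_ge0.
Qed.

Lemma complex_geP (x : R) z :
  reflect (complex.Im z = 0 /\ x <= complex.Re z) (rC x <= z).
Proof.
rewrite lecE /=; apply: (iffP andP); first by case=> /eqP.
by case=> -> ?; rewrite eqxx.
Qed.

Lemma Re_rCM (x : R) z : complex.Re (rC x * z) = x * complex.Re z.
Proof. by case: z => a b /=; rewrite mul0r subr0. Qed.

Lemma Re_csum (I : Type) (s : seq I) (Q : pred I) (f : I -> R[i]) :
  complex.Re (\sum_(i <- s | Q i) f i) = \sum_(i <- s | Q i) complex.Re (f i).
Proof. by apply: (big_morph (@complex.Re R)) => // -[a b] [c d]. Qed.

Lemma ReE_ge0 z : 0 <= z -> z = rC (complex.Re z).
Proof. by move=> z0; rewrite rCE RRe_real // ger0_real. Qed.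

End ComplexModulus.

Section RealBounds.
Context {R : realType}.

Lemma geometric_eventually (c q e : R) : 0 <= q < 1 -> 0 < e ->
  exists k, c * q ^+ k <= e.
Proof.
move=> /andP[q0 q1] e0.
have [c0|c0] := leP c 0.
  by exists 0%N; rewrite expr0 mulr1 (le_trans c0) // ltW.
have [->|qn0] := eqVneq q 0; first by exists 1%N; rewrite expr1 mulr0 ltW.
have := @cvg_expr R q; rewrite ger0_norm // => /(_ q1).
move=> /cvgrPdist_le /(_ (e / c) (divr_gt0 e0 c0)) [N _ /(_ N)] /=.
rewrite sub0r normrN ger0_norm ?exprn_ge0 // => /(_ (leqnn N)) h.
by exists N; rewrite mulrC -ler_pdivlMr.
Qed.

(** Takes the place of limits: a quantity independent of [k] is shown to vanish by bounding its
    modulus by [c * q ^+ k] for every [k]. *)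
Lemma le0_of_geometric (x c q : R) : 0 <= q < 1 ->
  (forall k, x <= c * q ^+ k) -> x <= 0.
Proof.
move=> q01 h; rewrite leNgt; apply/negP => x0.
have [k hk] := geometric_eventually c q01 (divr_gt0 x0 (ltr0n R 2)).
have := h k; move: x0 hk; lra.
Qed.

End RealBounds.

Section MatrixNorm.
Context {R : realType} {p q : nat}.
Implicit Types Y : 'M[R[i]]_(p, q).

(** The entrywise sum norm: submultiplicative, invariant under the adjoint and directly comparable
    with entries. Its comparison with other norms costs factors depending on the bond dimension
    only. *)
Definition mnorm Y : R := \sum_a \sum_b cabs (Y a b).

Lemma mnorm_ge0 Y : 0 <= mnorm Y.
Proof. by apply: sumr_ge0 => a _; apply: sumr_ge0 => b _; apply: cabs_ge0. Qed.

Lemma mnorm_entry Y a b : cabs (Y a b) <= mnorm Y.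
Proof.
rewrite /mnorm (bigD1 a) //= (bigD1 b) //= -addrA lerDl addr_ge0 ?sumr_ge0 //.
  by move=> *; apply: cabs_ge0.
by move=> i _; apply: sumr_ge0 => j _; apply: cabs_ge0.
Qed.

Lemma mnormD Y Z : mnorm (Y + Z) <= mnorm Y + mnorm Z.
Proof.
rewrite -big_split /=; apply: ler_sum => a _; rewrite -big_split /=.
by apply: ler_sum => b _; rewrite mxE cabsD.
Qed.

Lemma mnormZ (z : R[i]) Y : mnorm (z *: Y) = cabs z * mnorm Y.
Proof.
rewrite /mnorm mulr_sumr; apply: eq_bigr => a _; rewrite mulr_sumr.
by apply: eq_bigr => b _; rewrite mxE cabsM.
Qed.

Lemma mnormN Y : mnorm (- Y) = mnorm Y.
Proof. by rewrite -scaleN1r mnormZ cabsN cabs1 mul1r. Qed.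

Lemma mnormB Y Z : mnorm (Y - Z) <= mnorm Y + mnorm Z.
Proof. by rewrite -[mnorm Z]mnormN mnormD. Qed.

Lemma mnorm0 : mnorm 0 = 0.
Proof. by rewrite -[0](scale0r 0) mnormZ cabs0 mul0r. Qed.

Lemma mnorm_eq0 Y : (mnorm Y == 0) = (Y == 0).
Proof.
apply/eqP/eqP => [Y0|->]; last exact: mnorm0.
apply/matrixP => a b; rewrite mxE; apply/eqP; rewrite -cabs_eq0.
by rewrite eq_le cabs_ge0 andbT -Y0 mnorm_entry.
Qed.

Lemma mnorm_gt0 Y : (0 < mnorm Y) = (Y != 0).
Proof. by rewrite lt_neqAle mnorm_ge0 andbT eq_sym mnorm_eq0. Qed.

Lemma mnorm_sum (I : Type) (s : seq I) (Q : pred I) (f : I -> 'M[R[i]]_(p, q)) :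
  mnorm (\sum_(i <- s | Q i) f i) <= \sum_(i <- s | Q i) mnorm (f i).
Proof.
elim/big_ind2: _ => [|x1 x2 y1 y2 h1 h2|//]; first by rewrite mnorm0.
by apply: le_trans (mnormD _ _) _; apply: lerD.
Qed.

End MatrixNorm.

Lemma mnormM {R : realType} p q r (Y : 'M[R[i]]_(p, q)) (Z : 'M[R[i]]_(q, r)) :
  mnorm (Y *m Z) <= mnorm Y * mnorm Z.
Proof.
rewrite {1 2}/mnorm mulr_suml; apply: ler_sum => a _.
apply: (@le_trans _ _ (\sum_b \sum_j cabs (Y a j) * cabs (Z j b))).
  apply: ler_sum => b _; rewrite mxE; apply: le_trans (cabs_sum _ _ _) _.
  by apply: ler_sum => j _; rewrite cabsM.
rewrite exchange_big /= mulr_suml; apply: ler_sum => j _.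
rewrite -mulr_sumr ler_wpM2l ?cabs_ge0 //.
rewrite /mnorm (bigD1 j) //= lerDl; apply: sumr_ge0 => i _.
by apply: sumr_ge0 => k _; apply: cabs_ge0.
Qed.

Lemma mnorm_conjT {R : realType} p q (Y : 'M[R[i]]_(p, q)) :
  mnorm (map_mx Num.conj (Y^T)) = mnorm Y.
Proof.
rewrite /mnorm exchange_big /=; apply: eq_bigr => a _.
by apply: eq_bigr => b _; rewrite !mxE cabs_conj.
Qed.

(** * Extreme values on compact sets of complex configurations *)

Import numFieldNormedType.Exports.

Section ComplexCoordinates.
Context {R : realType} {S : finType}.
Local Notation point := (S -> R[i]).

(** Real and imaginary parts are stored as separate real coordinates, so that compactness of boxes
    and the extreme value theorem for real row vectors apply to complex configurations. Continuity
    below always refers to these coordinates. *)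
Definition decode (x : 'rV[R]_#|{: S * bool}|) : point :=
  fun s => Complex (x 0 (enum_rank (s, true))) (x 0 (enum_rank (s, false))).

Definition encode (z : point) : 'rV[R]_#|{: S * bool}| :=
  \row_k let sb := enum_val k in
         if sb.2 then complex.Re (z sb.1) else complex.Im (z sb.1).

Lemma encodeK : cancel encode decode.
Proof.
move=> z; apply/funext => s; rewrite /decode !mxE !enum_rankK /=.
by case: (z s).
Qed.

Definition rcont (f : point -> R) := continuous (f \o decode).
Definition ccont (f : point -> R[i]) :=
  rcont (fun z => complex.Re (f z)) /\ rcont (fun z => complex.Im (f z)).

Lemma rcont_cst (c : R) : rcont (fun=> c).
Proof. by move=> x; apply: cst_continuous. Qed.

Lemma rcontD f g : rcont f -> rcont g -> rcont (fun z => f z + g z).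
Proof. by move=> hf hg x; exact: (continuousD (hf x) (hg x)). Qed.

Lemma rcontM f g : rcont f -> rcont g -> rcont (fun z => f z * g z).
Proof. by move=> hf hg x; exact: (continuousM (hf x) (hg x)). Qed.

Lemma rcontN f : rcont f -> rcont (fun z => - f z).
Proof. by move=> hf x; exact: (continuousN (hf x)). Qed.

Lemma rcontB f g : rcont f -> rcont g -> rcont (fun z => f z - g z).
Proof. by move=> hf hg; apply: rcontD => //; apply: rcontN. Qed.

Lemma rcont_sum (I : Type) (s : seq I) (f : I -> point -> R) :
  (forall i, rcont (f i)) -> rcont (fun z => \sum_(i <- s) f i z).
Proof.
move=> hf; elim: s => [|i s IH].
  by under [X in rcont X]funext do rewrite big_nil; apply: rcont_cst.
by under [X in rcont X]funext do rewrite big_cons; apply: rcontD.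
Qed.

Lemma ccont_coord s : ccont (fun z => z s).
Proof. by split=> x /=; apply: coord_continuous. Qed.

Lemma ccont_cst (c : R[i]) : ccont (fun=> c).
Proof. by split; apply: rcont_cst. Qed.

Lemma ccontD f g : ccont f -> ccont g -> ccont (fun z => f z + g z).
Proof.
move=> [f1 f2] [g1 g2]; split.
  rewrite (_ : (fun z => _) = fun z => complex.Re (f z) + complex.Re (g z)).
    exact: rcontD.
  by apply/funext => z; case: (f z); case: (g z).
rewrite (_ : (fun z => _) = fun z => complex.Im (f z) + complex.Im (g z)).
  exact: rcontD.
by apply/funext => z; case: (f z); case: (g z).
Qed.

Lemma ccontM f g : ccont f -> ccont g -> ccont (fun z => f z * g z).
Proof.
move=> [f1 f2] [g1 g2]; split.
  rewrite (_ : (fun z => _) = fun z => complex.Re (f z) * complex.Re (g z)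
      - complex.Im (f z) * complex.Im (g z)).
    by apply: rcontB; apply: rcontM.
  by apply/funext => z; case: (f z); case: (g z).
rewrite (_ : (fun z => _) = fun z => complex.Re (f z) * complex.Im (g z)
    + complex.Im (f z) * complex.Re (g z)).
  by apply: rcontD; apply: rcontM.
by apply/funext => z; case: (f z); case: (g z).
Qed.

Lemma ccont_conj f : ccont f -> ccont (fun z => (f z)^*).
Proof.
move=> [f1 f2]; split.
  rewrite (_ : (fun z => _) = fun z => complex.Re (f z)) //.
  by apply/funext => z; case: (f z).
rewrite (_ : (fun z => _) = fun z => - complex.Im (f z)); first exact: rcontN.
by apply/funext => z; case: (f z).
Qed.

Lemma ccont_sum (I : Type) (s : seq I) (f : I -> point -> R[i]) :
  (forall i, ccont (f i)) -> ccont (fun z => \sum_(i <- s) f i z).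
Proof.
move=> hf; elim: s => [|i s IH].
  by under [X in ccont X]funext do rewrite big_nil; apply: ccont_cst.
by under [X in ccont X]funext do rewrite big_cons; apply: ccontD.
Qed.

Lemma rcont_cabs f : ccont f -> rcont (fun z => cabs (f z)).
Proof.
move=> [f1 f2].
rewrite (_ : (fun z => _) = fun z => Num.sqrt
   (complex.Re (f z) * complex.Re (f z) + complex.Im (f z) * complex.Im (f z))).
  have h : rcont (fun z => complex.Re (f z) * complex.Re (f z)
                         + complex.Im (f z) * complex.Im (f z)).
    by apply: rcontD; apply: rcontM.
  by move=> x; exact: (continuous_comp (h x) (@sqrt_continuous R _)).
by apply/funext => z; rewrite -!expr2 -cabs_sqrE sqrtr_sqr ger0_norm ?cabs_ge0.
Qed.

Definition mcont p q (F : point -> 'M[R[i]]_(p, q)) :=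
  forall a b, ccont (fun z => F z a b).

Lemma mcont_cst p q (Y : 'M[R[i]]_(p, q)) : mcont (fun=> Y).
Proof. by move=> a b; apply: ccont_cst. Qed.

Lemma mcontM p q r (F : point -> 'M[R[i]]_(p, q)) (G : point -> 'M[R[i]]_(q, r)) :
  mcont F -> mcont G -> mcont (fun z => F z *m G z).
Proof.
move=> hF hG a b; under [X in ccont X]funext do rewrite mxE.
by apply: ccont_sum => j; apply: ccontM.
Qed.

Lemma mcontD p q (F G : point -> 'M[R[i]]_(p, q)) :
  mcont F -> mcont G -> mcont (fun z => F z + G z).
Proof.
move=> hF hG a b; under [X in ccont X]funext do rewrite mxE.
exact: ccontD.
Qed.

Lemma mcontZ p q (f : point -> R[i]) (G : point -> 'M[R[i]]_(p, q)) :
  ccont f -> mcont G -> mcont (fun z => f z *: G z).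
Proof.
move=> hF hG a b; under [X in ccont X]funext do rewrite mxE.
exact: ccontM.
Qed.

Lemma mcont_conjT p q (F : point -> 'M[R[i]]_(p, q)) :
  mcont F -> mcont (fun z => map_mx Num.conj (F z)^T).
Proof.
move=> hF a b; under [X in ccont X]funext do rewrite !mxE.
exact: ccont_conj.
Qed.

Lemma mcont_sum p q (I : Type) (s : seq I) (F : I -> point -> 'M[R[i]]_(p, q)) :
  (forall i, mcont (F i)) -> mcont (fun z => \sum_(i <- s) F i z).
Proof.
move=> hF a b; under [X in ccont X]funext do rewrite summxE.
by apply: ccont_sum => i; apply: hF.
Qed.

Lemma rcont_mnorm p q (F : point -> 'M[R[i]]_(p, q)) :
  mcont F -> rcont (fun z => mnorm (F z)).
Proof.
by move=> hF; do 2 (apply: rcont_sum => ?); apply: rcont_cabs; apply: hF.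
Qed.

(** The box makes the feasible set bounded and the inequalities make it closed. An equation [h = 0]
    is encoded as [0 <= - h ^+ 2], or as [0 <= - h] for nonnegative [h]. The index type [J] may be
    infinite, since semidefiniteness is one inequality per test vector. *)
Definition constrained (M : R) (J : Type) (g : J -> point -> R) (z : point) :=
  (forall s, cabs (z s) <= M) /\ forall j, 0 <= g j z.

Lemma extreme_value (M : R) (J : Type) (g : J -> point -> R) (f : point -> R) :
  (forall j, rcont (g j)) -> rcont f -> (exists z, constrained M g z) ->
  exists c, constrained M g c /\ forall z, constrained M g z -> f z <= f c.
Proof.
move=> cg cf [z0 hz0].
pose K : set 'rV[R]_#|{: S * bool}| := [set x | constrained M g (decode x)]%classic.
have K0 : (K !=set0)%classic by exists (encode z0); rewrite /K /= encodeK.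
have closed_ge0 h : rcont h -> closed [set x | 0 <= h (decode x)]%classic.
  move=> ch; rewrite (_ : [set x | _]%classic
     = ((h \o decode) @^-1` [set y : R | 0 <= y])%classic) //.
  by apply: closed_comp; [move=> x _; apply: ch|apply: closed_ge].
have Kcl : closed K.
  rewrite (_ : K = ((\bigcap_(s in setT) [set x | (0 : R) <= M - cabs (decode x s)])
      `&` (\bigcap_(j in setT) [set x | (0 : R) <= g j (decode x)]))%classic).
    apply: closedI; apply: closed_bigI => i _; last exact: closed_ge0 (cg i).
    apply: (closed_ge0 (fun z => M - cabs (z i))).
    by apply: rcontB; [apply: rcont_cst|apply: rcont_cabs; apply: ccont_coord].
  apply/seteqP; split=> x [h1 h2]; split.
  - by move=> s _ /=; rewrite subr_ge0.
  - by move=> j _ /=; apply: h2.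
  - by move=> s; have /= := h1 s I; rewrite subr_ge0.
  - by move=> j; exact: (h2 j I).
have box := @rV_compact R #|{: S * bool}| (fun=> `[- M, M]%classic)
   (fun=> @segment_compact R _ _).
have Kco : compact K.
  apply: subclosed_compact Kcl box _ => x [h1 _] k /=.
  rewrite in_itv /= -ler_norml; case E: (enum_val k) => [s b].
  have -> : k = enum_rank (s, b) by rewrite -E enum_valK.
  apply: le_trans (h1 s); case: b {E} => //.
    exact: (Re_le_cabs (decode x s)).
  exact: (Im_le_cabs (decode x s)).
have [|c cK cmax] := @compact_EVT_max _ _ (f \o decode) K K0 Kco.
  exact/continuous_subspaceT/cf.
exists (decode c); split; first by move: cK; rewrite inE.
move=> z hz; have := cmax (encode z); rewrite /= encodeK; apply.
by rewrite inE /K /= encodeK.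
Qed.

End ComplexCoordinates.

(** * Perron-Frobenius theory of the transfer map *)

Section Positivity.
Context {R : realType} {D : nat}.
Local Notation Mx := 'M[R[i]]_D.+1.
Local Notation Vx := 'cV[R[i]]_D.+1.
Implicit Types (Y Z : Mx) (v : Vx).

Definition qform Y v : R[i] := (vadj v *m Y *m v) 0 0.
(** Taking the real part makes the form additive and real-homogeneous without any Hermiticity
    assumption; for Hermitian matrices nothing is lost, by [qform_rq]. *)
Definition rq Y v : R := complex.Re (qform Y v).

Lemma qformE Y v : qform Y v = \sum_a \sum_b (v a 0)^* * Y a b * v b 0.
Proof.
rewrite /qform mxE exchange_big; apply: eq_bigr => b _.
by rewrite mxE mulr_suml; apply: eq_bigr => a _; rewrite !mxE.
Qed.

Lemma qformD Y Z v : qform (Y + Z) v = qform Y v + qform Z v.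
Proof. by rewrite /qform mulmxDr mulmxDl mxE. Qed.

Lemma qformZ (z : R[i]) Y v : qform (z *: Y) v = z * qform Y v.
Proof. by rewrite /qform -scalemxAr -scalemxAl mxE. Qed.

Lemma rqD Y Z v : rq (Y + Z) v = rq Y v + rq Z v.
Proof. by rewrite /rq qformD; case: (qform Y v); case: (qform Z v). Qed.

Lemma rqZ (t : R) Y v : rq (rC t *: Y) v = t * rq Y v.
Proof. by rewrite /rq qformZ Re_rCM. Qed.

Lemma scalerCN1 Y : - Y = rC (-1) *: Y.
Proof. by rewrite -scaleN1r; congr (_ *: _); rewrite rCE rmorphN1. Qed.

Lemma rqB Y Z v : rq (Y - Z) v = rq Y v - rq Z v.
Proof. by rewrite scalerCN1 rqD rqZ mulN1r. Qed.

Lemma rq_le Y v : `|rq Y v| <= mnorm Y * mnorm v ^+ 2.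
Proof.
apply: le_trans (Re_le_cabs _) _; apply: le_trans (mnorm_entry _ 0 0) _.
apply: le_trans (mnormM _ _) _; rewrite expr2 mulrA ler_wpM2r ?mnorm_ge0 //.
by apply: le_trans (mnormM _ _) _; rewrite mnorm_conjT mulrC.
Qed.

Lemma rq_scale (z : R[i]) Y v : rq Y (z *: v) = cabs z ^+ 2 * rq Y v.
Proof.
rewrite -Re_rCM cabs_sqr /rq; congr complex.Re; rewrite !qformE mulr_sumr.
apply: eq_bigr => a _; rewrite mulr_sumr; apply: eq_bigr => b _.
by rewrite !mxE rmorphM; ring.
Qed.

Lemma hermcK : involutive (@hermc R D).
Proof. by move=> Y; apply/matrixP => a b; rewrite !mxE conjCK. Qed.

Lemma hermcD Y Z : hermc (Y + Z) = hermc Y + hermc Z.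
Proof. by apply/matrixP => a b; rewrite !mxE rmorphD. Qed.

Lemma hermcZ (z : R[i]) Y : hermc (z *: Y) = z^* *: hermc Y.
Proof. by apply/matrixP => a b; rewrite !mxE rmorphM. Qed.

Lemma hermcZr (t : R) Y : hermc (rC t *: Y) = rC t *: hermc Y.
Proof. by rewrite hermcZ rC_conj. Qed.

Lemma hermcB Y Z : hermc (Y - Z) = hermc Y - hermc Z.
Proof. by rewrite scalerCN1 hermcD hermcZr -scalerCN1. Qed.

Lemma hermcM Y Z : hermc (Y *m Z) = hermc Z *m hermc Y.
Proof. by rewrite /hermc trmx_mul map_mxM. Qed.

Lemma qform_conj Y v : (qform Y v)^* = qform (hermc Y) v.
Proof.
rewrite !qformE rmorph_sum exchange_big; apply: eq_bigr => a _ /=.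
rewrite rmorph_sum; apply: eq_bigr => b _ /=.
by rewrite !rmorphM /= conjCK !mxE; ring.
Qed.

Lemma qform_rq Y v : hermc Y = Y -> qform Y v = rC (rq Y v).
Proof.
move=> hY; have := qform_conj Y v; rewrite hY /rq /rC.
by case: (qform Y v) => a b /= [] /eqP; rewrite eqNr => /eqP ->.
Qed.

Lemma psdP Y : psdmx Y <-> hermc Y = Y /\ forall v, 0 <= rq Y v.
Proof.
split=> -[hY h]; split=> // v.
  by have := h v; rewrite -/(qform Y v) qform_rq // rCE ler0c.
by rewrite -/(qform Y v) qform_rq // rCE ler0c.
Qed.

Lemma pd_gt0 Y v : pdmx Y -> v != 0 -> 0 < rq Y v.
Proof.
move=> [hY h] v0; have := h v v0.
by rewrite -/(qform Y v) qform_rq // rCE -[0]/(0%:C)%C ltcR.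
Qed.

Lemma psdD Y Z : psdmx Y -> psdmx Z -> psdmx (Y + Z).
Proof.
move=> /psdP[h1 h2] /psdP[h3 h4]; apply/psdP; split; first by rewrite hermcD h1 h3.
by move=> v; rewrite rqD addr_ge0.
Qed.

Lemma psdZ (t : R) Y : 0 <= t -> psdmx Y -> psdmx (rC t *: Y).
Proof.
move=> t0 /psdP[h1 h2]; apply/psdP; split; first by rewrite hermcZr h1.
by move=> v; rewrite rqZ mulr_ge0.
Qed.

Lemma psd0 : psdmx (0 : Mx).
Proof.
apply/psdP; split; first by apply/matrixP => a b; rewrite !mxE rmorph0.
by move=> v; rewrite /rq /qform mulmx0 mul0mx mxE.
Qed.

Lemma psd1 : psdmx (1%:M : Mx).
Proof.
apply/psdP; split; first by rewrite /hermc trmx1 map_mx1.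
move=> v; rewrite /rq /qform mulmx1 mxE Re_csum; apply: sumr_ge0 => a _.
by rewrite !mxE -cabs_sqr /= sqr_ge0.
Qed.

Lemma psd_sum (I : Type) (s : seq I) (f : I -> Mx) :
  (forall i, psdmx (f i)) -> psdmx (\sum_(i <- s) f i).
Proof.
move=> h; apply: (big_ind (@psdmx R D)) => [|x y|i _].
- exact: psd0.
- exact: psdD.
- exact: h.
Qed.

Lemma mnorm_hermc Y : mnorm (hermc Y) = mnorm Y.
Proof. exact: mnorm_conjT. Qed.

End Positivity.

Section SesquilinearTransfer.
Context {R : realType} {D P : nat}.
Local Notation Mx := 'M[R[i]]_D.+1.
Implicit Types (X : 'I_P -> Mx) (Y Z : Mx).

(** The mixed transfer map, with [X] on the ket and [X'] on the bra; [tr2 A A] unfolds to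
    [transfer A], and the gauge conditions concern [tr2 B A] and [tr2 A B]. *)
Definition tr2 X X' Y : Mx := \sum_i X i *m Y *m hermc (X' i).

Lemma tr2D X X' Y Z : tr2 X X' (Y + Z) = tr2 X X' Y + tr2 X X' Z.
Proof.
rewrite /tr2 -big_split /=; apply: eq_bigr => i _.
by rewrite mulmxDr mulmxDl.
Qed.

Lemma tr2Z X X' (z : R[i]) Y : tr2 X X' (z *: Y) = z *: tr2 X X' Y.
Proof.
rewrite /tr2 scaler_sumr; apply: eq_bigr => i _.
by rewrite -scalemxAr -scalemxAl.
Qed.

Lemma tr2_hermc X X' Y : hermc (tr2 X X' Y) = tr2 X' X (hermc Y).
Proof.
rewrite /tr2; elim/big_ind2: _ => [|x1 x2 y1 y2 <- <-|i _].
- by apply/matrixP => a b; rewrite !mxE rmorph0.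
- by rewrite hermcD.
- by rewrite !hermcM hermcK mulmxA.
Qed.

Definition tnorm X : R := \sum_i mnorm (X i).

Lemma tnorm_ge0 X : 0 <= tnorm X.
Proof. by apply: sumr_ge0 => i _; apply: mnorm_ge0. Qed.

Lemma mnorm_tr2 X X' Y : mnorm (tr2 X X' Y) <= tnorm X * tnorm X' * mnorm Y.
Proof.
apply: le_trans (mnorm_sum _ _ _) _.
rewrite -mulrA mulr_suml; apply: ler_sum => i _.
apply: le_trans (mnormM _ _) _; apply: (le_trans (ler_wpM2r (mnorm_ge0 _) (mnormM _ _))).
rewrite mnorm_hermc -mulrA ler_wpM2l ?mnorm_ge0 // mulrC ler_wpM2r ?mnorm_ge0 //.
by rewrite /tnorm (bigD1 i) //= lerDl sumr_ge0 // => j _; apply: mnorm_ge0.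
Qed.

Lemma tr2_psd X Y : psdmx Y -> psdmx (tr2 X X Y).
Proof.
move=> /psdP[h1 h2]; apply: psd_sum => i; apply/psdP; split.
  by rewrite !hermcM hermcK h1 mulmxA.
move=> v; have -> : rq (X i *m Y *m hermc (X i)) v = rq Y (hermc (X i) *m v).
  have e : vadj (hermc (X i) *m v) = vadj v *m X i.
    by rewrite /vadj trmx_mul map_mxM -[in RHS](hermcK (X i)).
  by rewrite /rq /qform e !mulmxA.
exact: h2.
Qed.

End SesquilinearTransfer.

Section PositiveMaps.
Context {R : realType} {D : nat}.
Local Notation Mx := 'M[R[i]]_D.+1.
Local Notation Vx := 'cV[R[i]]_D.+1.
Implicit Types (Y Z : Mx) (v : Vx) (T S : Mx -> Mx).

Record positive_map T : Prop := PositiveMap {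
  pmapD : forall Y Z, T (Y + Z) = T Y + T Z;
  pmapZ : forall (z : R[i]) Y, T (z *: Y) = z *: T Y;
  pmap_hermc : forall Y, hermc (T Y) = T (hermc Y);
  pmap_psd : forall Y, psdmx Y -> psdmx (T Y) }.

Lemma pmapB T Y Z : positive_map T -> T (Y - Z) = T Y - T Z.
Proof. by move=> hT; rewrite -scaleN1r pmapD // pmapZ // scaleN1r. Qed.

Lemma pmap0 T : positive_map T -> T 0 = 0.
Proof. by move=> hT; rewrite -(scale0r 0) pmapZ // !scale0r. Qed.

Lemma pmap_sum T (I : Type) (s : seq I) (f : I -> Mx) : positive_map T ->
  T (\sum_(i <- s) f i) = \sum_(i <- s) T (f i).
Proof.
move=> hT; elim: s => [|i s IH]; first by rewrite !big_nil pmap0.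
by rewrite !big_cons pmapD // IH.
Qed.

Lemma pmap_iter T n : positive_map T -> positive_map (iter n T).
Proof.
move=> hT; elim: n => [|n IH]; first by split.
split=> [Y Z|z Y|Y|Y hY] /=.
- by rewrite !pmapD.
- by rewrite !pmapZ.
- by rewrite pmap_hermc // pmap_hermc.
- by do 2 apply: pmap_psd => //.
Qed.

Lemma pmap_expand T Y : positive_map T ->
  T Y = \sum_a \sum_b Y a b *: T (delta_mx a b).
Proof.
move=> hT; rewrite {1}(matrix_sum_delta Y) pmap_sum //.
apply: eq_bigr => a _; rewrite pmap_sum //.
by apply: eq_bigr => b _; rewrite pmapZ.
Qed.

Lemma pmap_bounded T : positive_map T ->
  exists2 c, 0 <= c & forall Y, mnorm (T Y) <= c * mnorm Y.
Proof.
move=> hT; exists (\sum_a \sum_b mnorm (T (delta_mx a b))).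
  by apply: sumr_ge0 => a _; apply: sumr_ge0 => b _; apply: mnorm_ge0.
move=> Y; rewrite pmap_expand // mulr_suml; apply: le_trans (mnorm_sum _ _ _) _.
apply: ler_sum => a _; rewrite mulr_suml; apply: le_trans (mnorm_sum _ _ _) _.
apply: ler_sum => b _; rewrite mnormZ mulrC ler_wpM2l ?mnorm_ge0 //.
exact: mnorm_entry.
Qed.

Lemma mcont_pmap (I : finType) T (F : (I -> R[i]) -> Mx) :
  positive_map T -> mcont F -> mcont (fun z => T (F z)).
Proof.
move=> hT hF; rewrite (_ : (fun z => _) =
  fun z => \sum_a \sum_b F z a b *: T (delta_mx a b)).
  do 2 (apply: mcont_sum => ?); apply: mcontZ; first exact: hF.
  exact: mcont_cst.
by apply/funext => z; rewrite pmap_expand.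
Qed.

Lemma rcont_rq (I : finType) (F : (I -> R[i]) -> Mx) (G : (I -> R[i]) -> Vx) :
  mcont F -> mcont G -> rcont (fun z => rq (F z) (G z)).
Proof.
move=> hF hG; apply: (proj1 (_ : ccont _)).
have h : mcont (fun z => vadj (G z) *m F z *m G z).
  by apply: mcontM => //; apply: mcontM => //; apply: mcont_conjT.
exact: h.
Qed.

Lemma mnorm_const1 : 0 < mnorm (const_mx 1 : Vx).
Proof.
by rewrite mnorm_gt0; apply/eqP => /matrixP /(_ 0 0); rewrite !mxE => /eqP;
  rewrite oner_eq0.
Qed.

Lemma mnorm_id : 0 < mnorm (1%:M : Mx).
Proof.
by rewrite mnorm_gt0; apply/eqP => /matrixP /(_ 0 0); rewrite !mxE => /eqP;
  rewrite oner_eq0.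
Qed.

Lemma mnorm_normalize p q (Y : 'M[R[i]]_(p, q)) : 0 < mnorm Y ->
  mnorm (rC (mnorm Y)^-1 *: Y) = 1.
Proof.
move=> Y0; rewrite mnormZ cabs_rC ?invr_ge0 ?mnorm_ge0 // mulVf //.
by rewrite gt_eqF.
Qed.

Definition doeblin S (e : R) := 0 < e /\
  forall Y v, psdmx Y -> e * mnorm Y * mnorm v ^+ 2 <= rq (S Y) v.

(** The constant is the minimum of [rq (S Y) v] over semidefinite [Y] and vectors [v] of norm one.
    It is attained by compactness, hence positive, and homogeneity removes the normalization. *)
Lemma doeblin_exists S : positive_map S ->
  (forall Y, psdmx Y -> Y != 0 -> pdmx (S Y)) -> exists e, doeblin S e.
Proof.
move=> hS Spd.
pose I : finType := ('I_D.+1 * 'I_D.+1 + 'I_D.+1)%type.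
pose Ym (z : I -> R[i]) : Mx := \matrix_(a, b) z (inl (a, b)).
pose vm (z : I -> R[i]) : Vx := \col_a z (inr a).
have cY : mcont Ym by move=> a b; under [X in ccont X]funext do rewrite mxE;
  apply: ccont_coord.
have cv : mcont vm by move=> a b; under [X in ccont X]funext do rewrite mxE;
  apply: ccont_coord.
pose mk Y v : I -> R[i] := fun i =>
  match i with inl (a, b) => Y a b | inr a => v a 0 end.
have Ymk Y v : Ym (mk Y v) = Y by apply/matrixP => a b; rewrite mxE.
have vmk Y v : vm (mk Y v) = v.
  by apply/matrixP => a b; rewrite mxE /= ord1.
pose g (j : Vx + option bool) (z : I -> R[i]) : R := match j with
  | inl v => rq (Ym z) v
  | inr None => - mnorm (Ym z - hermc (Ym z))
  | inr (Some true) => - (mnorm (Ym z) - 1) ^+ 2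
  | inr (Some false) => - (mnorm (vm z) - 1) ^+ 2 end.
have cabsr (h : (I -> R[i]) -> R) : rcont h -> rcont (fun z => - (h z - 1) ^+ 2).
  move=> ch; apply: rcontN; under [X in rcont X]funext do rewrite expr2.
  by apply: rcontM; apply: rcontB => //; apply: rcont_cst.
have cg j : rcont (g j).
  case: j => [v|[[]|]] /=.
  - by apply: rcont_rq => //; apply: mcont_cst.
  - by apply: cabsr; apply: rcont_mnorm.
  - by apply: cabsr; apply: rcont_mnorm.
  - apply: rcontN; apply: rcont_mnorm.
    rewrite (_ : (fun z => _) = fun z => Ym z + (-1) *: hermc (Ym z)).
      apply: mcontD => //; apply: mcontZ; first exact: ccont_cst.
      exact: mcont_conjT.
    by apply/funext => z; rewrite scaleN1r.
have cf : rcont (fun z => - rq (S (Ym z)) (vm z)).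
  by apply: rcontN; apply: rcont_rq => //; apply: mcont_pmap.
have gP z : constrained 1 g z <-> [/\ psdmx (Ym z), mnorm (Ym z) = 1 & mnorm (vm z) = 1].
  split=> [[_ h]|[h1 h2 h3]].
    have e1 : mnorm (Ym z) = 1.
      by apply/eqP; have := h (inr (Some true)); rewrite oppr_ge0 exprn_even_le0 //= subr_eq0.
    have e2 : mnorm (vm z) = 1.
      by apply/eqP; have := h (inr (Some false)); rewrite oppr_ge0 exprn_even_le0 //= subr_eq0.
    split=> //; apply/psdP; split; last by move=> v; exact: (h (inl v)).
    have := h (inr None); rewrite oppr_ge0 /= => h0.
    apply/eqP; rewrite eq_sym -subr_eq0 -mnorm_eq0 eq_le h0.
    by rewrite mnorm_ge0.
  split.
    case=> [[a b]|a].
      by rewrite -h2; have := mnorm_entry (Ym z) a b; rewrite mxE.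
    by rewrite -h3; have := mnorm_entry (vm z) a 0; rewrite mxE.
  move/psdP: h1 => [h1 h1'].
  case=> [v|[[]|]] //=.
  - by rewrite h2 subrr expr0n oppr0.
  - by rewrite h3 subrr expr0n oppr0.
  - by rewrite h1 subrr mnorm0 oppr0.
have feas Y v : psdmx Y -> 0 < mnorm Y -> 0 < mnorm v ->
  constrained 1 g (mk (rC (mnorm Y)^-1 *: Y) (rC (mnorm v)^-1 *: v)).
  move=> h1 h2 h3; apply/gP; rewrite Ymk vmk !mnorm_normalize //; split=> //.
  by apply: psdZ; rewrite ?invr_ge0 ?mnorm_ge0.
have ex : exists z, constrained 1 g z.
  eexists; apply: feas; [exact: psd1|exact: mnorm_id|exact: mnorm_const1].
have [c [/gP [c1 c2 c3] cmax]] := extreme_value cg cf ex.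
exists (rq (S (Ym c)) (vm c)); split.
  apply: pd_gt0; first by apply: Spd; rewrite // -mnorm_gt0 c2.
  by rewrite -mnorm_gt0 c3.
move=> Y v hY.
have [->|Y0] := eqVneq Y 0.
  by rewrite mnorm0 mulr0 mul0r pmap0 // /rq /qform mulmx0 mul0mx mxE.
have [->|v0] := eqVneq v 0.
  by rewrite mnorm0 expr0n mulr0 /rq /qform mulmx0 mxE.
rewrite -mnorm_gt0 in Y0; rewrite -mnorm_gt0 in v0.
have := cmax _ (feas _ _ hY Y0 v0).
rewrite Ymk vmk lerN2 pmapZ // rqZ rq_scale cabs_rC ?invr_ge0 ?mnorm_ge0 // => h.
have -> : rq (S Y) v = (mnorm Y)^-1 * ((mnorm v)^-1 ^+ 2 * rq (S Y) v)
    * mnorm Y * mnorm v ^+ 2.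
  by field; rewrite !gt_eqF.
by rewrite !ler_wpM2r ?exprn_ge0 ?mnorm_ge0.
Qed.

End PositiveMaps.

(** * Existence of a positive semidefinite eigenvector *)

Section PerronVector.
Context {R : realType} {D : nat}.
Local Notation Mx := 'M[R[i]]_D.+1.
Local Notation Vx := 'cV[R[i]]_D.+1.
Implicit Types (Y Z : Mx) (v : Vx).
Context (T : Mx -> Mx) (m : nat) (e : R).
Hypothesis pT : positive_map T.
Local Notation S := (iter m T).
Hypothesis dS : doeblin S e.

Let pS : positive_map S. Proof. exact: pmap_iter. Qed.
Let e0 : 0 < e. Proof. by case: dS. Qed.
Let dSP := proj2 dS.

Lemma iter_commute Y : S (T Y) = T (S Y).
Proof. by rewrite -iterSr -iterS. Qed.

Lemma doeblin_gt0 Y : psdmx Y -> Y != 0 -> 0 < mnorm (S Y).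
Proof.
move=> hY Y0; rewrite mnorm_gt0; apply/eqP => SY0.
have := dSP (const_mx 1) hY; rewrite SY0 /rq /qform mulmx0 mul0mx mxE /= leNgt.
by rewrite !mulr_gt0 ?exprn_gt0 ?mnorm_const1 ?mnorm_gt0.
Qed.

(** Applying [S] to [T Y - t Y] and testing with one fixed vector compares [t * e] with the bound of
    the linear map [T^(m+1)]. This confines [t] to a bounded set, as the extreme value argument
    requires. *)
Lemma collatz_bound : exists C : R, forall (t : R) Y, psdmx Y -> mnorm Y = 1 -> 0 <= t ->
  psdmx (T Y - rC t *: Y) -> t <= C.
Proof.
have [c c0 hc] := pmap_bounded (pmap_iter m.+1 pT).
exists (c / e) => t Y hY Y1 t0 hTY.
have := pmap_psd pS hTY.
rewrite (pmapB _ _ pS) (pmapZ pS) iter_commute => /psdP [_ /(_ (const_mx 1))].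
rewrite rqB rqZ subr_ge0 => h1.
have h2 := dSP (const_mx 1) hY.
have h3 : rq (T (S Y)) (const_mx 1) <= c * mnorm (const_mx 1 : Vx) ^+ 2.
  apply: le_trans (ler_norm _) _; apply: le_trans (rq_le _ _) _.
  rewrite ler_wpM2r ?exprn_ge0 ?mnorm_ge0 //.
  by have := hc Y; rewrite Y1 mulr1.
have v0 : 0 < mnorm (const_mx 1 : Vx) ^+ 2 by rewrite exprn_gt0 ?mnorm_const1.
rewrite Y1 mulr1 in h2.
rewrite ler_pdivlMr // -(ler_pM2r v0) -mulrA.
by apply: le_trans h3; apply: le_trans h1; rewrite ler_wpM2l.
Qed.

(* Collatz-Wielandt: maximize [t] subject to [T Y >= t Y], [Y] psd. If the
   maximizer were not an eigenvector, [S] would turn the psd defect into a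
   strictly positive one and [t] could be increased at [S Y]. *)
Lemma perron_vector : exists (t : R) (r : Mx),
  [/\ 0 <= t, psdmx r, r != 0 & T r = rC t *: r].
Proof.
have [C hC] := collatz_bound.
pose I : finType := ('I_D.+1 * 'I_D.+1 + unit)%type.
pose Ym (z : I -> R[i]) : Mx := \matrix_(a, b) z (inl (a, b)).
pose tm (z : I -> R[i]) : R := complex.Re (z (inr tt)).
have cY : mcont Ym by move=> a b; under [X in ccont X]funext do rewrite mxE;
  apply: ccont_coord.
have ct : rcont tm := (proj1 (ccont_coord (inr tt))).
have ctC : ccont (fun z => rC (tm z)) by split=> //; apply: rcont_cst.
pose mk Y (t : R) : I -> R[i] := fun i =>
  match i with inl (a, b) => Y a b | inr _ => rC t end.
have Ymk Y t : Ym (mk Y t) = Y by apply/matrixP => a b; rewrite mxE.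
have tmk Y t : tm (mk Y t) = t by [].
pose g (j : (Vx + Vx) + option bool) (z : I -> R[i]) : R := match j with
  | inl (inl v) => rq (Ym z) v
  | inl (inr v) => rq (T (Ym z) - rC (tm z) *: Ym z) v
  | inr None => - mnorm (Ym z - hermc (Ym z))
  | inr (Some true) => - (mnorm (Ym z) - 1) ^+ 2
  | inr (Some false) => tm z end.
have mcontB (F G : (I -> R[i]) -> Mx) : mcont F -> mcont G -> mcont (fun z => F z - G z).
  move=> hF hG; rewrite (_ : (fun z => _) = fun z => F z + (-1) *: G z).
    by apply: mcontD => //; apply: mcontZ => //; exact: ccont_cst.
  by apply/funext => z; rewrite scaleN1r.
have cg j : rcont (g j).
  case: j => [[v|v]|[[]|]] /=.
  - by apply: rcont_rq => //; apply: mcont_cst.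
  - apply: rcont_rq; last exact: mcont_cst.
    by apply: mcontB; [apply: mcont_pmap|apply: mcontZ].
  - apply: rcontN; under [X in rcont X]funext do rewrite expr2.
    by apply: rcontM; apply: rcontB; (apply: rcont_mnorm || apply: rcont_cst).
  - exact: ct.
  - by apply: rcontN; apply: rcont_mnorm; apply: mcontB => //; exact: mcont_conjT.
(* The box must contain the entries of [Y], which are at most 1, and the value [t], which is at most
   [C]. *)
have gP z : constrained (1 + `|C|) g z -> [/\ psdmx (Ym z), mnorm (Ym z) = 1,
    0 <= tm z & psdmx (T (Ym z) - rC (tm z) *: Ym z)].
  move=> [_ h].
  have e1 : mnorm (Ym z) = 1.
    by apply/eqP; have := h (inr (Some true));
       rewrite oppr_ge0 exprn_even_le0 //= subr_eq0.
  have hh : hermc (Ym z) = Ym z.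
    have := h (inr None); rewrite oppr_ge0 /= => h0.
    apply/eqP; rewrite eq_sym -subr_eq0 -mnorm_eq0 eq_le h0.
    by rewrite mnorm_ge0.
  split=> //; first by apply/psdP; split=> // v; exact: (h (inl (inl v))).
    exact: (h (inr (Some false))).
  apply/psdP; split; last by move=> v; exact: (h (inl (inr v))).
  by rewrite hermcB hermcZr (pmap_hermc pT) hh.
have feas Y t : psdmx Y -> mnorm Y = 1 -> 0 <= t -> psdmx (T Y - rC t *: Y) ->
    constrained (1 + `|C|) g (mk Y t).
  move=> h1 h2 h3 h4; split.
    case=> [[a b]|[]] /=.
      by apply: le_trans (mnorm_entry Y a b) _; rewrite h2 lerDl.
    rewrite cabs_rC //; apply: le_trans (hC _ _ h1 h2 h3 h4) _.
    by apply: le_trans (ler_norm _) _; rewrite lerDr.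
  move/psdP: h1 => [h1 h1']; move/psdP: h4 => [h4 h4'].
  case=> [[v|v]|[[]|]] /=; rewrite ?Ymk ?tmk //.
  - by rewrite h2 subrr expr0n oppr0.
  - by rewrite h1 subrr mnorm0 oppr0.
have normalized Y t : psdmx Y -> 0 < mnorm Y -> 0 <= t -> psdmx (T Y - rC t *: Y) ->
    constrained (1 + `|C|) g (mk (rC (mnorm Y)^-1 *: Y) t).
  move=> h1 h2 h3 h4; have h5 : 0 <= (mnorm Y)^-1 by rewrite invr_ge0 mnorm_ge0.
  apply: feas; [exact: psdZ h5 h1|exact: mnorm_normalize h2|exact: h3|].
  rewrite (pmapZ pT) scalerA mulrC -scalerA -scalerBr; exact: psdZ h5 h4.
have ex : exists z, constrained (1 + `|C|) g z.
  exists (mk (rC (mnorm (1%:M : Mx))^-1 *: 1%:M) 0); apply: normalized => //.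
  - exact: psd1.
  - exact: mnorm_id.
  - by rewrite scale0r subr0; apply: pmap_psd => //; exact: psd1.
have [c [/gP [c1 c2 c3 c4] cmax]] := extreme_value cg ct ex.
exists (tm c), (Ym c); split=> //; first by rewrite -mnorm_gt0 c2.
apply/eqP; rewrite -subr_eq0; apply: contraT => Z0.
set Z := T _ - _ in c4 Z0; set t := tm c in c3 Z cmax c4 Z0 *.
have Y0 : Ym c != 0 by rewrite -mnorm_gt0 c2.
have W0 := doeblin_gt0 c1 Y0.
set W := S (Ym c) in W0.
(* The gain is chosen with [eta * mnorm W = e * mnorm Z], so that the Doeblin bound for [S Z]
   dominates [eta * rq W v] for every [v]. *)
have eta0 : 0 < e * mnorm Z / mnorm W by apply: divr_gt0 W0; apply: mulr_gt0 e0 _; rewrite mnorm_gt0.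
set eta := e * _ / _ in eta0.
have SZ : S Z = T W - rC t *: W by rewrite /Z (pmapB _ _ pS) (pmapZ pS) iter_commute.
have hW : psdmx W by apply: pmap_psd.
have h : psdmx (T W - rC (t + eta) *: W).
  have -> : T W - rC (t + eta) *: W = S Z - rC eta *: W.
    rewrite SZ rCD scalerDl opprD addrA; reflexivity.
  move/psdP: (hW) => [hW1 _]; move/psdP: (pmap_psd pS c4) => [hZ1 _].
  apply/psdP; split; first by rewrite hermcB hermcZr hW1 hZ1.
  move=> v; rewrite rqB rqZ subr_ge0; apply: le_trans (dSP v c4).
  have := le_trans (ler_norm _) (rq_le W v) => hq.
  apply: le_trans (ler_wpM2l (ltW eta0) hq) _.
  by rewrite /eta mulrA divfK // gt_eqF.
have := cmax _ (normalized _ _ hW W0 (addr_ge0 c3 (ltW eta0)) h).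
by rewrite tmk -/t gerDl leNgt eta0.
Qed.

End PerronVector.

Section HermitianParts.
Context {R : realType} {D : nat}.
Local Notation Mx := 'M[R[i]]_D.+1.
Implicit Types Y : Mx.

Definition imag : R[i] := 'i.

Lemma imag_sqr : imag * imag = -1. Proof. by rewrite -expr2 sqrCi. Qed.

Definition hpart Y : Mx := 2^-1 *: (Y + hermc Y).
Definition apart Y : Mx := (- imag / 2) *: (Y - hermc Y).

Lemma hermitian_parts Y : Y = hpart Y + imag *: apart Y.
Proof.
rewrite /hpart /apart scalerA mulrA mulrN imag_sqr opprK mul1r -scalerDr.
rewrite addrACA subrr addr0 -{2 3}[Y]scale1r -scalerDl scalerA.
by rewrite -(natrD _ 1 1) mulVf ?scale1r // pnatr_eq0.
Qed.

Lemma hpart_hermc Y : hermc (hpart Y) = hpart Y.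
Proof. by rewrite /hpart hermcZ hermcD hermcK addrC fmorphV rmorph_nat. Qed.

Lemma apart_hermc Y : hermc (apart Y) = apart Y.
Proof.
rewrite /apart hermcZ hermcB hermcK rmorphM fmorphV rmorph_nat rmorphN /=.
by rewrite -/imag (conjCi R[i]) opprK mulNr scaleNr -scalerN opprB.
Qed.

Lemma cabs_half : cabs (2^-1 : R[i]) = 2^-1.
Proof. by rewrite cabsV -rCnat cabs_rC. Qed.

Lemma cabs_i : cabs imag = 1.
Proof. by rewrite /cabs normCi. Qed.

Lemma mnorm_hpart Y : mnorm (hpart Y) <= mnorm Y.
Proof.
rewrite /hpart mnormZ cabs_half; have := mnormD Y (hermc Y).
rewrite mnorm_hermc; lra.
Qed.

Lemma mnorm_apart Y : mnorm (apart Y) <= mnorm Y.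
Proof.
rewrite /apart mnormZ cabsM cabsN cabs_half cabs_i mul1r.
have := mnormB Y (hermc Y); rewrite mnorm_hermc; lra.
Qed.

(** Order arguments reach Hermitian matrices only; the Hermitian and anti-Hermitian parts of a
    general matrix contribute once each, whence the factor 2. *)
Lemma bound_from_hermitian (f : Mx -> Mx) (c : R) : 0 <= c ->
  (forall Y Z, f (Y + Z) = f Y + f Z) -> (forall (z : R[i]) Y, f (z *: Y) = z *: f Y) ->
  (forall Y, hermc Y = Y -> mnorm (f Y) <= c * mnorm Y) ->
  forall Y, mnorm (f Y) <= (c * 2) * mnorm Y.
Proof.
move=> c0 fD fZ hf Y; rewrite {1}(hermitian_parts Y) fD fZ.
apply: le_trans (mnormD _ _) _; rewrite mnormZ cabs_i mul1r.
have h1 := le_trans (hf _ (hpart_hermc Y)) (ler_wpM2l c0 (mnorm_hpart Y)).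
have h2 := le_trans (hf _ (apart_hermc Y)) (ler_wpM2l c0 (mnorm_apart Y)).
rewrite (_ : c * 2 * mnorm Y = c * mnorm Y + c * mnorm Y); last by ring.
exact: lerD h1 h2.
Qed.

End HermitianParts.

(** * Order bounds relative to the eigenvector, and its eigenvalue *)

Section Contraction.
Context {R : realType} {D : nat}.
Local Notation Mx := 'M[R[i]]_D.+1.
Local Notation Vx := 'cV[R[i]]_D.+1.
Implicit Types (Y Z : Mx) (v : Vx).
Context (T : Mx -> Mx) (m : nat) (e : R).
Hypothesis pT : positive_map T.
Local Notation S := (iter m T).
Hypothesis dS : doeblin S e.
Context (r : Mx) (t : R).
Hypothesis hr : psdmx r.
Hypothesis r0 : r != 0.
Hypothesis t01 : 0 <= t <= 1.
Hypothesis Tr : T r = rC t *: r.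

Let pS : positive_map S. Proof. exact: pmap_iter. Qed.
Let e0 : 0 < e. Proof. by case: dS. Qed.
Let dSP := proj2 dS.
Let rho := e * mnorm r.
Let rho0 : 0 < rho. Proof. by rewrite mulr_gt0 // mnorm_gt0. Qed.

Lemma iter_eigen n : iter n T r = rC (t ^+ n) *: r.
Proof.
elim: n => [|n IH]; first by rewrite expr0 rC1 scale1r.
by rewrite iterS IH (pmapZ pT) Tr scalerA -rCM exprSr.
Qed.

(** Since [S r = t^m r] and [t <= 1], the Doeblin bound at [r] passes to [r] itself. Thus [r] is
    positive definite and serves as an order unit for the Hermitian matrices. *)
Lemma eigen_lower v : rho * mnorm v ^+ 2 <= rq r v.
Proof.
apply: le_trans (dSP v hr) _; rewrite iter_eigen rqZ ler_piMl //.
  by case/psdP: hr.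
by case/andP: t01 => ? ?; rewrite exprn_ile1.
Qed.

Lemma hermitian_between Y : hermc Y = Y ->
  psdmx (Y + rC (mnorm Y / rho) *: r) /\ psdmx (rC (mnorm Y / rho) *: r - Y).
Proof.
move=> hY; case/psdP: hr => hr1 _.
have h v : `|rq Y v| <= mnorm Y / rho * rq r v.
  apply: le_trans (rq_le _ _) _; rewrite -mulrA ler_wpM2l ?mnorm_ge0 //.
  by rewrite ler_pdivlMl //; apply: eigen_lower.
split; apply/psdP; split.
- by rewrite hermcD hermcZr hr1 hY.
- by move=> v; rewrite rqD rqZ; have := h v; rewrite ler_norml; lra.
- by rewrite hermcB hermcZr hr1 hY.
- by move=> v; rewrite rqB rqZ; have := h v; rewrite ler_norml; lra.
Qed.

Let K := mnorm r / e.
Let K0 : 0 <= K. Proof. by rewrite divr_ge0 ?mnorm_ge0 ?ltW. Qed.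

(** An order bound controls the norm: applying [S] to [0 <= Z <= c r], the Doeblin inequality bounds
    [mnorm Z] from one side and [t^m c r] from the other. *)
Lemma mnorm_between Z (c : R) : 0 <= c -> psdmx Z -> psdmx (rC c *: r - Z) ->
  mnorm Z <= c * K.
Proof.
move=> c0 hZ hcZ; pose v : Vx := const_mx 1.
have v0 : 0 < mnorm v ^+ 2 by rewrite exprn_gt0 ?mnorm_const1.
have h1 := dSP v hZ.
have := pmap_psd pS hcZ.
rewrite (pmapB _ _ pS) (pmapZ pS) iter_eigen => /psdP [_ /(_ v)].
rewrite rqB !rqZ subr_ge0 => h2.
have h3 := le_trans (ler_norm _) (rq_le r v).
have h4 : t ^+ m <= 1 by case/andP: t01 => ? ?; rewrite exprn_ile1.
have h5 : 0 <= rq r v by case/psdP: hr.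
have h6 : c * (t ^+ m * rq r v) <= c * (mnorm r * mnorm v ^+ 2).
  by rewrite ler_wpM2l //; apply: le_trans h3; rewrite ler_piMl.
have := le_trans h1 (le_trans h2 h6); rewrite mulrA ler_pM2r // => h7.
by rewrite /K mulrA ler_pdivlMr // mulrC.
Qed.

Lemma iter_between n Z (c : R) : 0 <= c -> psdmx Z -> psdmx (rC c *: r - Z) ->
  mnorm (iter n T Z) <= c * t ^+ n * K.
Proof.
move=> c0 hZ hcZ; have pn := pmap_iter n pT; case/andP: t01 => t0 t1.
apply: mnorm_between; first by rewrite mulr_ge0 ?exprn_ge0.
  exact: pmap_psd.
by have := pmap_psd pn hcZ; rewrite (pmapB _ _ pn) (pmapZ pn) iter_eigen scalerA -rCM.
Qed.

Context (l : Mx -> R[i]) (cl : R).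
Hypothesis lD : forall Y Z, l (Y + Z) = l Y + l Z.
Hypothesis lZ : forall (z : R[i]) Y, l (z *: Y) = z * l Y.
Hypothesis l_bound : forall Y, cabs (l Y) <= cl * mnorm Y.
Hypothesis cl0 : 0 <= cl.
Hypothesis lT : forall Y, l (T Y) = l Y.
Hypothesis l_neq0 : exists Y, l Y != 0.

Lemma functional_iter n Y : l (iter n T Y) = l Y.
Proof. by elim: n => //= n IH; rewrite lT. Qed.

Lemma functional_hermitian : exists2 Y, hermc Y = Y & l Y != 0.
Proof.
have [Y lY] := l_neq0.
have [h|h] := eqVneq (l (hpart Y)) 0; last by exists (hpart Y); rewrite ?hpart_hermc.
exists (apart Y); first exact: apart_hermc.
by apply: contraNneq lY => h'; rewrite (hermitian_parts Y) lD lZ h h' mulr0 addr0.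
Qed.

Lemma functional_psd : exists2 Z, psdmx Z & l Z != 0.
Proof.
have [Y hY lY] := functional_hermitian.
have [lr|lr] := eqVneq (l r) 0; last by exists r.
have [h1 _] := hermitian_between hY.
by exists (Y + rC (mnorm Y / rho) *: r); rewrite // lD lZ lr mulr0 addr0.
Qed.

(** If [t < 1], every semidefinite [Z] lies below a multiple of [r] and so has iterates tending to
    0. The invariance of [l] then forces [l Z = 0], although a nonzero functional does not vanish on
    the whole semidefinite cone. *)
Lemma eigenvalue_ge1 : t = 1.
Proof.
case/andP: t01 => t0 t1; apply/eqP; apply: contraT => tn1.
have t1' : t < 1 by rewrite lt_neqAle tn1.
have [Z hZ /negP[]] := functional_psd.
have hZh : hermc Z = Z by case/psdP: hZ.
have [_ hcZ] := hermitian_between hZh.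
set c := mnorm Z / rho in hcZ.
have c0 : 0 <= c by rewrite divr_ge0 ?mnorm_ge0 ?ltW.
rewrite -cabs_eq0 eq_le cabs_ge0 andbT.
apply: (@le0_of_geometric _ _ (cl * c * K) t); first by rewrite t0.
move=> n; rewrite -(functional_iter n Z); apply: le_trans (l_bound _) _.
apply: le_trans (ler_wpM2l cl0 (iter_between n c0 hZ hcZ)) _.
by rewrite (_ : cl * (c * t ^+ n * K) = cl * c * K * t ^+ n) //; ring.
Qed.

End Contraction.

(** * Geometric convergence of the iterates *)

Section Mixing.
Context {R : realType} {D : nat}.
Local Notation Mx := 'M[R[i]]_D.+1.
Local Notation Vx := 'cV[R[i]]_D.+1.
Implicit Types (Y Z : Mx) (v : Vx).
Context (T : Mx -> Mx) (m : nat) (e : R).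
Hypothesis pT : positive_map T.
Local Notation S := (iter m T).
Hypothesis dS : doeblin S e.
Context (r : Mx).
Hypothesis hr : psdmx r.
Hypothesis r0 : r != 0.
Hypothesis Tr : T r = r.

Let pS : positive_map S. Proof. exact: pmap_iter. Qed.
Let e0 : 0 < e. Proof. by case: dS. Qed.
Let dSP := proj2 dS.
Let Nr0 : 0 < mnorm r. Proof. by rewrite mnorm_gt0. Qed.
Let rho := e * mnorm r.
Let rho0 : 0 < rho. Proof. by rewrite mulr_gt0. Qed.
Let K := mnorm r / e.
Let K0 : 0 <= K. Proof. by rewrite divr_ge0 ?ltW. Qed.
Let one01 : 0 <= (1 : R) <= 1. Proof. by rewrite ler01 lexx. Qed.
Let Tr1 : T r = rC 1 *: r. Proof. by rewrite rC1 scale1r. Qed.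
Let v1 : Vx := const_mx 1.
Let Nv0 : 0 < mnorm v1 ^+ 2. Proof. by rewrite exprn_gt0 ?mnorm_const1. Qed.

Lemma iter_fixed n : iter n T r = r.
Proof. by elim: n => //= n ->. Qed.

Lemma fixed_rq_gt0 : 0 < rq r v1.
Proof.
apply: lt_le_trans (eigen_lower pT dS hr one01 Tr1 v1).
by rewrite mulr_gt0.
Qed.

Lemma doeblin_le1 : e <= 1.
Proof.
have h := dSP v1 hr; rewrite iter_fixed in h.
have := le_trans h (le_trans (ler_norm _) (rq_le r v1)).
by rewrite -mulrA ger_pMl // mulr_gt0.
Qed.

Let q := 1 - e.
Let q01 : 0 <= q < 1.
Proof. by rewrite /q subr_ge0 doeblin_le1 ltrBlDr ltrDl. Qed.

Definition cbound := (K * 2 + mnorm r) / rho.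

Lemma cbound_ge0 : 0 <= cbound.
Proof.
apply: divr_ge0; last exact: ltW.
by apply: addr_ge0; [apply: mulr_ge0|apply: mnorm_ge0].
Qed.

(** [Y + c r] lies between 0 and [2 c r], and this persists under iteration because [r] is fixed;
    subtracting [c r] again accounts for the second term of [cbound]. *)
Lemma iter_bounded n Y : mnorm (iter n T Y) <= cbound * 2 * mnorm Y.
Proof.
have pn := pmap_iter n pT.
apply: (bound_from_hermitian cbound_ge0 (pmapD pn) (pmapZ pn)) => {}Y hY.
have [h1 h2] := hermitian_between pT dS hr r0 one01 Tr1 hY.
rewrite -/rho in h1 h2; set c := mnorm Y / rho in h1 h2.
have c0 : 0 <= c by apply: divr_ge0; [apply: mnorm_ge0|apply: ltW].
have h3 : psdmx (rC (c + c) *: r - (Y + rC c *: r)).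
  rewrite rCD scalerDl opprD addrACA subrr addr0; exact: h2.
have := iter_between pT dS hr one01 Tr1 n (addr_ge0 c0 c0) h1 h3.
rewrite expr1n mulr1 -/K (pmapD pn) (pmapZ pn) iter_fixed => h4.
rewrite -[iter n T Y](addrK (rC c *: r)).
apply: le_trans (mnormB _ _) _; apply: le_trans (lerD h4 (lexx _)) _.
rewrite mnormZ (cabs_rC c0) (_ : cbound * mnorm Y = (c + c) * K + c * mnorm r) //.
by rewrite /cbound /c; ring.
Qed.

(* The two defects [S^k Y - lo r] and [hi r - S^k Y] sum to [(hi - lo) r], so
   their images under [S] jointly dominate [e (hi - lo) r]. *)
Lemma oscillation Y : hermc Y = Y -> forall k, exists lo hi : R,
  [/\ psdmx (iter k S Y - rC lo *: r), psdmx (rC hi *: r - iter k S Y) &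
      hi - lo <= q ^+ k * (mnorm Y / rho * 2)].
Proof.
move=> hY; elim=> [|k [lo [hi [h1 h2 h3]]]].
  have [h1 h2] := hermitian_between pT dS hr r0 one01 Tr1 hY.
  exists (- (mnorm Y / rho)), (mnorm Y / rho); split; [|exact: h2|].
    have -> : rC (- (mnorm Y / rho)) = - rC (mnorm Y / rho) by rewrite rCE rmorphN.
    rewrite scaleNr opprK; exact: h1.
  by rewrite expr0 mul1r opprK mulr_natr mulr2n.
set Z1 := _ - _ in h1; set Z2 := _ - _ in h2.
have step Z : psdmx Z -> psdmx (S Z - rC (e / mnorm r * mnorm Z) *: r).
  move=> hZ; case/psdP: hr => hr1 _; case/psdP: (pmap_psd pS hZ) => hZ1 _.
  apply/psdP; split; first by rewrite hermcB hermcZr hr1 hZ1.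
  move=> v; rewrite rqB rqZ subr_ge0; apply: le_trans (dSP v hZ).
  have h := le_trans (ler_norm _) (rq_le r v).
  have c0 : 0 <= e / mnorm r * mnorm Z.
    by apply: mulr_ge0; [apply: divr_ge0; apply: ltW|apply: mnorm_ge0].
  apply: le_trans (ler_wpM2l c0 h) _.
  rewrite (_ : e / mnorm r * mnorm Z * (mnorm r * mnorm v ^+ 2) =
     e * mnorm Z * mnorm v ^+ 2) //.
  by field; rewrite gt_eqF.
have S1 := step _ h1; have S2 := step _ h2.
rewrite /Z1 (pmapB _ _ pS) (pmapZ pS) iter_fixed -iterS -/Z1 -addrA -opprD -scalerDl -rCD in S1.
rewrite /Z2 (pmapB _ _ pS) (pmapZ pS) iter_fixed -iterS -/Z2 addrAC -scalerBl -rCB in S2.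
exists (lo + e / mnorm r * mnorm Z1), (hi - e / mnorm r * mnorm Z2); split; [exact: S1|exact: S2|].
have hN : (hi - lo) * mnorm r <= mnorm Z1 + mnorm Z2.
  have e1 : rC (hi - lo) *: r = Z1 + Z2.
    by rewrite /Z1 /Z2 [RHS]addrC rCB scalerBl addrA subrK.
  apply: (le_trans _ (mnormD _ _)); rewrite -e1 mnormZ; apply: (ler_wpM2r (ltW Nr0)).
  exact: (le_trans (ler_norm (hi - lo)) (Re_le_cabs (rC (hi - lo)))).
have h4 : e * (hi - lo) <= e / mnorm r * (mnorm Z1 + mnorm Z2).
  by rewrite -mulrA ler_pM2l // mulrC ler_pdivlMr.
have h5 : (1 - e) * (hi - lo) <= q ^+ k.+1 * (mnorm Y / rho * 2).
  rewrite exprS -mulrA ler_wpM2l //; by case/andP: q01.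
move: h4 h5; lra.
Qed.

Context (l : Mx -> R[i]) (cl : R).
Hypothesis lD : forall Y Z, l (Y + Z) = l Y + l Z.
Hypothesis lZ : forall (z : R[i]) Y, l (z *: Y) = z * l Y.
Hypothesis l_bound : forall Y, cabs (l Y) <= cl * mnorm Y.
Hypothesis cl0 : 0 <= cl.
Hypothesis lT : forall Y, l (T Y) = l Y.
Hypothesis l_neq0 : exists Y, l Y != 0.

Let lB Y Z : l (Y - Z) = l Y - l Z.
Proof. by rewrite -scaleN1r lD lZ mulN1r. Qed.

Let lS k Y : l (iter k S Y) = l Y.
Proof. by rewrite -iterM functional_iter. Qed.

(** The witness is the lower multiple [lo]. As [l] is invariant under [S], applying it to the small
    matrix [S^k Y - lo r] compares [l Y] with [lo * l r]. For semidefinite [Y] the upper multiple is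
    nonnegative, so [lo] is negative by at most the oscillation. *)
Lemma oscillation_limit Y : hermc Y = Y -> forall k, exists x : R,
  [/\ mnorm (iter k S Y - rC x *: r) <= q ^+ k * (mnorm Y / rho * 2) * K,
      cabs (l Y - rC x * l r) <= cl * (q ^+ k * (mnorm Y / rho * 2) * K) &
      psdmx Y -> - (q ^+ k * (mnorm Y / rho * 2)) <= x].
Proof.
move=> hY k; have [lo [hi [h1 h2 h3]]] := oscillation hY k.
have e1 : rC (hi - lo) *: r - (iter k S Y - rC lo *: r) = rC hi *: r - iter k S Y.
  by rewrite rCB scalerBl opprB addrA subrK.
have hl0 : 0 <= hi - lo.
  have := psdD h1 h2; rewrite addrC addrA subrK => /psdP [_ /(_ v1)].
  by rewrite rqB !rqZ -mulrBl pmulr_lge0 // fixed_rq_gt0.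
have h4 : mnorm (iter k S Y - rC lo *: r) <= q ^+ k * (mnorm Y / rho * 2) * K.
  apply: le_trans (ler_wpM2r K0 h3).
  by apply: (mnorm_between pT dS hr one01 Tr1 hl0 h1); rewrite e1; exact: h2.
exists lo; split=> //.
  rewrite -(lS k Y) -lZ -lB; apply: le_trans (l_bound _) _.
  by rewrite ler_wpM2l.
move=> pY; have hi0 : 0 <= hi.
  have := psdD (pmap_psd (pmap_iter k pS) pY) h2.
  rewrite addrC subrK => /psdP [_ /(_ v1)].
  by rewrite rqZ pmulr_lge0 // fixed_rq_gt0.
by move: h3 hi0; lra.
Qed.

(** Makes the normalization [l r = 1] possible: if [l r] were 0, the limit would give [l Y = 0] for
    every Hermitian [Y]. *)
Lemma functional_fixed_neq0 : l r != 0.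
Proof.
have [Y hY] := functional_hermitian lD lZ l_neq0.
apply: contra => /eqP lr; rewrite -cabs_eq0 eq_le cabs_ge0 andbT.
apply: (@le0_of_geometric _ _ (cl * (mnorm Y / rho * 2 * K)) q) => // k.
have [x [_ h _]] := oscillation_limit hY k.
rewrite lr mulr0 subr0 in h; apply: le_trans h _.
by rewrite (_ : cl * (q ^+ k * (mnorm Y / rho * 2) * K) =
  cl * (mnorm Y / rho * 2 * K) * q ^+ k) //; ring.
Qed.

Hypothesis lr1 : l r = 1.

(** Positivity of the left fixed point, obtained from convergence: [l Y] is approximated by real
    numbers whose negative part tends to 0. *)
Lemma functional_psd_ge0 Y : psdmx Y -> 0 <= l Y.
Proof.
move=> pY; have hY : hermc Y = Y by case/psdP: pY.
pose c := mnorm Y / rho * 2.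
rewrite -rC0; apply/complex_geP; split.
  apply/eqP; rewrite -normr_eq0 eq_le normr_ge0 andbT.
  apply: (@le0_of_geometric _ _ (cl * (c * K)) q) => // k.
  have [x [_ h _]] := oscillation_limit hY k; rewrite lr1 mulr1 -/c in h.
  have := le_trans (Im_le_cabs _) h.
  rewrite (_ : complex.Im (l Y - rC x) = complex.Im (l Y)); last first.
    by case: (l Y) => a b /=; rewrite oppr0 addr0.
  by move/le_trans; apply; rewrite (_ : cl * (q ^+ k * c * K) = cl * (c * K) * q ^+ k) //; ring.
rewrite -oppr_le0.
apply: (@le0_of_geometric _ _ (cl * (c * K) + c) q) => // k.
have [x [_ h /(_ pY) h']] := oscillation_limit hY k; rewrite lr1 mulr1 -/c in h h'.
have := le_trans (Re_le_cabs _) h.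
rewrite (_ : complex.Re (l Y - rC x) = complex.Re (l Y) - x); last by case: (l Y).
rewrite ler_norml => /andP[h2 _].
rewrite (_ : (cl * (c * K) + c) * q ^+ k = cl * (q ^+ k * c * K) + q ^+ k * c); last by ring.
by move: h2 h'; lra.
Qed.

(** By the Doeblin bound [S Y] dominates [e / mnorm r * mnorm Y] times [r]; apply the positive
    functional [l], which is invariant and equals 1 at [r]. *)
Lemma functional_psd_lower Y : psdmx Y -> rC (e / mnorm r * mnorm Y) <= l Y.
Proof.
move=> hZ; rewrite -subr_ge0.
have -> : l Y - rC (e / mnorm r * mnorm Y) = l (S Y - rC (e / mnorm r * mnorm Y) *: r).
  by rewrite lB lZ lr1 mulr1 -(lS 1 Y).
apply: functional_psd_ge0; case/psdP: hr => hr1 _; case/psdP: (pmap_psd pS hZ) => hZ1 _.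
apply/psdP; split; first by rewrite hermcB hermcZr hr1 hZ1.
move=> v; rewrite rqB rqZ subr_ge0; apply: le_trans (dSP v hZ).
have h := le_trans (ler_norm _) (rq_le r v).
have c0 : 0 <= e / mnorm r * mnorm Y.
  by apply: mulr_ge0; [apply: divr_ge0; apply: ltW|apply: mnorm_ge0].
apply: le_trans (ler_wpM2l c0 h) _.
rewrite (_ : e / mnorm r * mnorm Y * (mnorm r * mnorm v ^+ 2) =
   e * mnorm Y * mnorm v ^+ 2) //.
by field; rewrite gt_eqF.
Qed.

Definition cmix := K * (1 + cl * mnorm r) / rho * 2.

Lemma cmix_ge0 : 0 <= cmix.
Proof.
apply: mulr_ge0 => //; apply: divr_ge0; last exact: ltW.
by apply: mulr_ge0 => //; apply: addr_ge0 => //; apply: mulr_ge0 => //; apply: ltW.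
Qed.

(** The multiple [x] of [oscillation_limit] is replaced by [l Y]; this costs [cl * mnorm r] times
    the same error and explains the factor [1 + cl * mnorm r] in [cmix]. *)
Lemma iter_mixing k Y :
  mnorm (iter (k * m) T Y - l Y *: r) <= cmix * q ^+ k * 2 * mnorm Y.
Proof.
rewrite iterM; have pk := pmap_iter k pS.
have c0 : 0 <= cmix * q ^+ k.
  by rewrite mulr_ge0 ?cmix_ge0 ?exprn_ge0 //; case/andP: q01.
apply: (bound_from_hermitian (f := fun Y => iter k S Y - l Y *: r) c0) => [{}Y Z|z {}Y|{}Y hY].
- by rewrite (pmapD pk) lD scalerDl opprD addrACA.
- by rewrite (pmapZ pk) lZ -scalerA -scalerBr.
have [x [h1 h2 _]] := oscillation_limit hY k; rewrite lr1 mulr1 in h2.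
have -> : iter k S Y - l Y *: r = (iter k S Y - rC x *: r) - (l Y - rC x) *: r.
  by rewrite scalerBl opprB addrA subrK.
apply: le_trans (mnormB _ _) _; rewrite mnormZ.
apply: le_trans (lerD h1 (ler_wpM2r (ltW Nr0) h2)) _.
by rewrite /cmix le_eqVlt; apply/orP; left; apply/eqP; ring.
Qed.

End Mixing.

Section TransferMixing.
Context {R : realType} {D P : nat}.
Local Notation Mx := 'M[R[i]]_D.+1.
Implicit Types (A : 'I_P -> Mx) (L X Y Z : Mx).

Lemma transfer_pmap A : positive_map (transfer A).
Proof.
split=> [Y Z|z Y|Y|Y]; [exact: tr2D|exact: tr2Z|exact: tr2_hermc|exact: tr2_psd].
Qed.

Lemma pairingD L X Y : pairing L (X + Y) = pairing L X + pairing L Y.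
Proof.
rewrite /pairing -big_split; apply: eq_bigr => a _; rewrite -big_split.
by apply: eq_bigr => b _; rewrite mxE mulrDr.
Qed.

Lemma pairingZ L (z : R[i]) X : pairing L (z *: X) = z * pairing L X.
Proof.
rewrite /pairing mulr_sumr; apply: eq_bigr => a _; rewrite mulr_sumr.
by apply: eq_bigr => b _; rewrite mxE mulrCA.
Qed.

Lemma cabs_pairing L X : cabs (pairing L X) <= mnorm L * mnorm X.
Proof.
apply: le_trans (cabs_sum _ _ _) _; rewrite /mnorm mulr_suml; apply: ler_sum => a _.
apply: le_trans (cabs_sum _ _ _) _; rewrite mulr_suml; apply: ler_sum => b _.
by rewrite cabsM ler_wpM2l ?cabs_ge0 // mnorm_entry.
Qed.

Lemma pairing_delta L a b : pairing L (delta_mx a b) = L a b.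
Proof.
rewrite /pairing (bigD1 a) //= (bigD1 b) //= mxE !eqxx mulr1.
rewrite big1 => [|j jb]; last by rewrite mxE (negPf jb) andbF mulr0.
rewrite addr0 big1 ?addr0 // => i ia; rewrite big1 // => j _.
by rewrite mxE (negPf ia) mulr0.
Qed.

(** Everything that the later estimates know about [A]. A single [c] serves in all upper bounds and
    a single [e] in all lower bounds; [l] is the normalized left fixed point and [m] the primitivity
    exponent, so that windows consist of [k * m] sites. *)
Record mixing A (m : nat) (q c e : R) (r : Mx) (l : Mx -> R[i]) : Prop := Mixing {
  mix_m : (0 < m)%N;
  mix_q : 0 <= q < 1;
  mix_c : 1 <= c;
  mix_e : 0 < e;
  mixD : forall X Y, l (X + Y) = l X + l Y;
  mixZ : forall (z : R[i]) X, l (z *: X) = z * l X;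
  mix_bound : forall X, cabs (l X) <= c * mnorm X;
  mix_inv : forall X, l (transfer A X) = l X;
  mix_psd : psdmx r;
  mix_lower : forall v : 'cV[R[i]]_D.+1, e * mnorm v ^+ 2 <= rq r v;
  mix_one : l r = 1;
  mix_iter : forall n X, mnorm (iter n (transfer A) X) <= c * mnorm X;
  mix_cvg : forall k X,
    mnorm (iter (k * m) (transfer A) X - l X *: r) <= c * q ^+ k * mnorm X;
  mix_pos : forall X, psdmx X -> rC (e * mnorm X) <= l X }.

Lemma transfer_mixing A L :
  primitive_map (transfer A) -> spectral_radius1 (transfer A) ->
  left_fixed_point A L ->
  exists m q c e r s, mixing A m q c e r (fun X => s * pairing L X).
Proof.
move=> [m [m0 prim]] [spec _] [L0 Lfix].
set T := transfer A in prim spec Lfix *.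
have pT : positive_map T by apply: transfer_pmap.
have [e dS] := doeblin_exists (pmap_iter m pT) prim.
have [t [r [t0 hr r0 Tr]]] := perron_vector pT dS.
have t1 : t <= 1.
  have := spec _ _ r0 Tr; rewrite cabsE cabs_rC //.
  by rewrite -[1]/(1%:C)%C lecR.
have t01 : 0 <= t <= 1 by rewrite t0.
have lneq0 : exists Y, pairing L Y != 0.
  case: (pickP (fun ab : 'I_D.+1 * 'I_D.+1 => L ab.1 ab.2 != 0)) => [[a b] /= h|h].
    by exists (delta_mx a b); rewrite pairing_delta.
  case/negP: L0; apply/eqP/matrixP => a b; rewrite mxE.
  by have /= := h (a, b) => /negbFE /eqP.
have tE : t = 1.
  by apply: (eigenvalue_ge1 pT dS hr r0 t01 Tr (pairingD L) (pairingZ L)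
    (cabs_pairing L) (mnorm_ge0 L) Lfix lneq0).
have {}Tr : T r = r by rewrite Tr tE rC1 scale1r.
have lr0 := functional_fixed_neq0 pT dS hr r0 Tr (pairingD L) (pairingZ L)
    (cabs_pairing L) (mnorm_ge0 L) Lfix lneq0.
pose s := (pairing L r)^-1; pose l X := s * pairing L X.
have lD X Y : l (X + Y) = l X + l Y by rewrite /l pairingD mulrDr.
have lZ (z : R[i]) X : l (z *: X) = z * l X by rewrite /l pairingZ mulrCA.
have lb X : cabs (l X) <= (cabs s * mnorm L) * mnorm X.
  by rewrite /l cabsM -mulrA ler_wpM2l ?cabs_ge0 // cabs_pairing.
have cl0 : 0 <= cabs s * mnorm L by apply: mulr_ge0; [apply: cabs_ge0|apply: mnorm_ge0].
have lT X : l (T X) = l X by rewrite /l Lfix.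
have lr : l r = 1 by rewrite /l /s mulVf.
have l0 : exists Y, l Y != 0 by exists r; rewrite lr oner_eq0.
have e0 : 0 < e by case: dS.
have e1 := doeblin_le1 dS hr r0 Tr.
have cb0 := cbound_ge0 dS r0.
have cm0 := cmix_ge0 dS r0 cl0.
have N0 : 0 < mnorm r by rewrite mnorm_gt0.
set cb := cbound e r in cb0; set cm := cmix e r _ in cm0; set cl := _ * _ in cl0 lb cm cm0.
pose c := 1 + cl + cb * 2 + cm * 2.
(* The first argument is the lower bound for [r], the second the one for [l] on semidefinite
   matrices. *)
have ee : 0 < Num.min (e * mnorm r) (e / mnorm r).
  by rewrite lt_min mulr_gt0 //= divr_gt0.
exists m, (1 - e), c, (Num.min (e * mnorm r) (e / mnorm r)), r, s; split=> //.
- by rewrite subr_ge0 e1 ltrBlDr ltrDl.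
- by rewrite /c; move: cl0 cb0 cm0; lra.
- move=> X; apply: le_trans (lb X) _; rewrite ler_wpM2r ?mnorm_ge0 //.
  by rewrite /c; move: cl0 cb0 cm0; lra.
- move=> v; have := eigen_lower pT dS hr (t := 1); rewrite ler01 lexx rC1 scale1r.
  move=> /(_ isT Tr v); apply: le_trans; rewrite ler_wpM2r ?exprn_ge0 ?mnorm_ge0 //.
  by rewrite ge_min lexx.
- move=> n X; apply: le_trans (iter_bounded pT dS hr r0 Tr n X) _.
  rewrite ler_wpM2r ?mnorm_ge0 // -/cb.
  by rewrite /c; move: cl0 cb0 cm0; lra.
- move=> k X.
  apply: le_trans (iter_mixing pT dS hr r0 Tr lD lZ lb cl0 lT lr k X) _.
  rewrite ler_wpM2r ?mnorm_ge0 // -/cm mulrAC ler_wpM2r //.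
    by rewrite exprn_ge0 // subr_ge0.
  by rewrite /c; move: cl0 cb0 cm0; lra.
- move=> X hX; apply: le_trans (functional_psd_lower pT dS hr r0 Tr lD lZ lb cl0 lT lr hX).
  by rewrite lecR ler_wpM2r ?mnorm_ge0 // ge_min lexx orbT.
Qed.

End TransferMixing.

(** * Matrix product states and window expansion *)

Section MatrixProductStates.
Context {R : realType} {P D : nat}.
Local Notation Mx := 'M[R[i]]_D.+1.
Local Notation family := (nat -> 'I_P -> Mx).
Implicit Types (X : nat -> 'I_P -> 'M[R[i]]_D.+1) (Y Z : 'M[R[i]]_D.+1).

(** Tensors may vary from site to site, so the vacuum, an excited chain and a chain with a frozen
    window are all of this form. Indexing by [nat] lets the chain be cut with [iota] and
    natural-number intervals. *)
Definition mps (n : nat) X : state R n P :=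
  [ffun w : word n P => \tr (\prod_(l < n) X l (w l))].

Definition tcomp X X' (s : seq nat) Y : Mx :=
  foldr (fun l Z => tr2 (X l) (X' l) Z) Y s.

Lemma tcomp_cat X X' s1 s2 Y : tcomp X X' (s1 ++ s2) Y = tcomp X X' s1 (tcomp X X' s2 Y).
Proof. by rewrite /tcomp foldr_cat. Qed.

Lemma eq_tcomp X1 X1' X2 X2' s Y :
  (forall l, l \in s -> X1 l = X2 l) -> (forall l, l \in s -> X1' l = X2' l) ->
  tcomp X1 X1' s Y = tcomp X2 X2' s Y.
Proof.
elim: s => //= l s IH h h'; rewrite IH => [|k hk|k hk].
- by rewrite h ?h' ?mem_head.
- by apply: h; rewrite inE hk orbT.
- by apply: h'; rewrite inE hk orbT.
Qed.

Lemma tcomp_const (A : 'I_P -> Mx) X X' s Y :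
  (forall l, l \in s -> X l = A) -> (forall l, l \in s -> X' l = A) ->
  tcomp X X' s Y = iter (size s) (transfer A) Y.
Proof.
elim: s => //= l s IH h h'; rewrite IH => [|k hk|k hk].
- by rewrite h ?h' ?mem_head.
- by apply: h; rewrite inE hk orbT.
- by apply: h'; rewrite inE hk orbT.
Qed.

Lemma tcomp_id X X' s Y :
  (forall l Z, l \in s -> tr2 (X l) (X' l) Z = Z) -> tcomp X X' s Y = Y.
Proof.
elim: s => //= l s IH h; rewrite h ?mem_head // IH // => k Z hk.
by apply: h; rewrite inE hk orbT.
Qed.

Definition wcons n (iw : 'I_P * word n P) : word n.+1 P :=
  [ffun l => if unlift ord0 l is Some k then iw.2 k else iw.1].

Lemma wcons0 n iw : @wcons n iw ord0 = iw.1.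
Proof. by rewrite ffunE unlift_none. Qed.

Lemma wconsS n iw k : @wcons n iw (lift ord0 k) = iw.2 k.
Proof. by rewrite ffunE liftK. Qed.

Lemma wcons_bij n : bijective (@wcons n).
Proof.
exists (fun w : word n.+1 P => (w ord0, [ffun k => w (lift ord0 k)] : word n P)) => [[i w]|w].
  by rewrite wcons0; congr pair; apply/ffunP => k; rewrite ffunE wconsS.
apply/ffunP => l; case: (unliftP ord0 l) => [k|] ->.
  by rewrite wconsS ffunE.
by rewrite wcons0.
Qed.

Lemma prod_wcons n X i (w : word n P) :
  \prod_(l < n.+1) X l (wcons (i, w) l) = X 0%N i *m \prod_(l < n) X l.+1 (w l).
Proof.
rewrite big_ord_recl wcons0; congr (X 0%N i *m _).
by apply: eq_bigr => k _; rewrite wconsS.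
Qed.

Lemma word_sum n X X' Y :
  \sum_(w : word n P) (\prod_(l < n) X l (w l)) *m Y *m
     hermc (\prod_(l < n) X' l (w l)) = tcomp X X' (iota 0 n) Y.
Proof.
elim: n X X' => [|n IH] X X' /=.
  transitivity (\sum_(w : word 0 P) Y).
    apply: eq_bigr => w _; rewrite !big_ord0 [1]/(1%:M) mul1mx.
    by rewrite /hermc trmx1 map_mx1 mulmx1.
  by rewrite sumr_const card_ffun !card_ord expn0 mulr1n.
rewrite -[iota 1 n](map_id) -[1%N]addn0 iotaDl -map_comp.
have -> : tcomp X X' [seq ((id \o addn 1) k) | k <- iota 0 n] Y =
  tcomp (fun l => X l.+1) (fun l => X' l.+1) (iota 0 n) Y.
  by rewrite /tcomp foldr_map.
rewrite -IH (reindex _ (onW_bij _ (wcons_bij n))) /=.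
rewrite -(pair_bigA _ (fun i w => (\prod_(l < n.+1) X l (wcons (i, w) l)) *m Y *m
   hermc (\prod_(l < n.+1) X' l (wcons (i, w) l)))) /=.
rewrite /tr2; apply: eq_bigr => i _.
rewrite mulmx_sumr mulmx_suml; apply: eq_bigr => w _.
rewrite !prod_wcons hermcM !mulmxA; reflexivity.
Qed.

Lemma sandwich_delta Y Z a a' b b' :
  (Y *m delta_mx b b' *m hermc Z) a a' = Y a b * (Z a' b')^*.
Proof.
rewrite mxE (bigD1 b') //= mxE (bigD1 b) //= !mxE !eqxx mulr1.
rewrite big1 => [|j jb]; last by rewrite mxE (negPf jb) mulr0.
rewrite addr0 big1 ?addr0 // => i ib; rewrite mxE big1 ?mul0r // => j _.
by rewrite mxE (negPf ib) andbF mulr0.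
Qed.

(** The product of the two periodic traces is the trace of the composed transfer map on matrices,
    computed in the basis of matrix units. *)
Lemma inner_mps n X X' :
  inner (mps n X') (mps n X) = \sum_a \sum_b tcomp X X' (iota 0 n) (delta_mx a b) a b.
Proof.
transitivity (\sum_(w : word n P) \sum_a \sum_b
  ((\prod_(l < n) X l (w l)) *m delta_mx a b *m hermc (\prod_(l < n) X' l (w l))) a b).
  apply: eq_bigr => w _; rewrite !ffunE /mxtrace mulr_sumr; apply: eq_bigr => a _.
  by rewrite rmorph_sum mulr_suml; apply: eq_bigr => b _; rewrite sandwich_delta mulrC.
rewrite exchange_big; apply: eq_bigr => a _; rewrite exchange_big; apply: eq_bigr => b _.
by rewrite -word_sum summxE.
Qed.

End MatrixProductStates.

Lemma cauchy_schwarz_sum {R : realType} (I : finType) (a b : I -> R) :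
  (forall i, 0 <= a i) -> (forall i, 0 <= b i) ->
  \sum_i a i * b i <= Num.sqrt (\sum_i a i ^+ 2) * Num.sqrt (\sum_i b i ^+ 2).
Proof.
move=> a0 b0; set x := Num.sqrt _; set y := Num.sqrt _.
have xE : x ^+ 2 = \sum_i a i ^+ 2 by rewrite sqr_sqrtr // sumr_ge0 // => i _; apply: sqr_ge0.
have yE : y ^+ 2 = \sum_i b i ^+ 2 by rewrite sqr_sqrtr // sumr_ge0 // => i _; apply: sqr_ge0.
have vanish (c : I -> R) : \sum_i c i ^+ 2 = 0 -> forall i, c i = 0.
  move=> /eqP; rewrite psumr_eq0 => [/allP h i|i _]; last exact: sqr_ge0.
  by have := h i (mem_index_enum i); rewrite sqrf_eq0 => /eqP.
have [x0|xn0] := eqVneq x 0.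
  have h := vanish a; rewrite -xE x0 expr0n in h.
  by rewrite big1 ?mulr_ge0 ?sqrtr_ge0 // => i _; rewrite h ?mul0r.
have [y0|yn0] := eqVneq y 0.
  have h := vanish b; rewrite -yE y0 expr0n in h.
  by rewrite big1 ?mulr_ge0 ?sqrtr_ge0 // => i _; rewrite h ?mulr0.
have x0 : 0 < x by rewrite lt_neqAle eq_sym xn0 sqrtr_ge0.
have y0 : 0 < y by rewrite lt_neqAle eq_sym yn0 sqrtr_ge0.
(* Weighted arithmetic-geometric inequality, with weights for which each of the two sums contributes
   [x * y / 2]. *)
have h i : a i * b i <= (y / x / 2) * a i ^+ 2 + (x / y / 2) * b i ^+ 2.
  rewrite -subr_ge0 (_ : _ - _ = (y * a i - x * b i) ^+ 2 / (2 * x * y)).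
    by rewrite divr_ge0 ?sqr_ge0 // !mulr_ge0 ?ltW.
  by field; rewrite xn0 yn0.
apply: le_trans (ler_sum _ (fun i _ => h i)) _.
rewrite big_split /= -!mulr_sumr -xE -yE.
rewrite (_ : _ + _ = x * y) //; by field; rewrite xn0 yn0.
Qed.

Section StateSpace.
Context {R : realType} {n P : nat}.
Local Notation state := (state R n P).
Implicit Types (u v : state) (F G : op R n P).

Lemma applyE F v w : apply F v w = \sum_w' F w w' * (v w' : R[i]) :> R[i].
Proof. by rewrite ffunE. Qed.

Lemma stateD u v w : (u + v) w = (u w : R[i]) + v w :> R[i].
Proof. by rewrite ffunE. Qed.

Lemma stateZ (z : R[i]) u w : (z *: u) w = z * (u w : R[i]) :> R[i].
Proof. by rewrite ffunE. Qed.

Lemma state_sum (I : Type) (s : seq I) (Q : pred I) (f : I -> state) w :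
  (\sum_(i <- s | Q i) f i) w = \sum_(i <- s | Q i) (f i w : R[i]) :> R[i].
Proof. by rewrite sum_ffunE. Qed.

Lemma innerDr u v1 v2 : inner u (v1 + v2) = inner u v1 + inner u v2.
Proof. by rewrite /inner -big_split; apply: eq_bigr => w _; rewrite stateD mulrDr. Qed.

Lemma innerZr u (z : R[i]) v : inner u (z *: v) = z * inner u v.
Proof. by rewrite /inner mulr_sumr; apply: eq_bigr => w _; rewrite stateZ mulrCA. Qed.

Lemma inner_conj u v : (inner u v)^* = inner v u.
Proof.
rewrite /inner rmorph_sum; apply: eq_bigr => w _ /=.
by rewrite rmorphM /= conjCK mulrC.
Qed.

Lemma innerDl u1 u2 v : inner (u1 + u2) v = inner u1 v + inner u2 v.
Proof. by rewrite -inner_conj innerDr rmorphD /= !inner_conj. Qed.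

Lemma innerZl (z : R[i]) u v : inner (z *: u) v = z^* * inner u v.
Proof. by rewrite -inner_conj innerZr rmorphM /= inner_conj. Qed.

Lemma innerBr u v1 v2 : inner u (v1 - v2) = inner u v1 - inner u v2.
Proof. by rewrite -scaleN1r innerDr innerZr mulN1r. Qed.

Lemma inner_sumr (I : Type) (s : seq I) (Q : pred I) (f : I -> state) u :
  inner u (\sum_(i <- s | Q i) f i) = \sum_(i <- s | Q i) inner u (f i).
Proof.
elim/big_rec2: _ => [|i x y _ <-]; last by rewrite innerDr.
by rewrite -(scale0r 0) innerZr mul0r.
Qed.

Lemma inner_suml (I : Type) (s : seq I) (Q : pred I) (f : I -> state) v :
  inner (\sum_(i <- s | Q i) f i) v = \sum_(i <- s | Q i) inner (f i) v.
Proof.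
rewrite -inner_conj inner_sumr rmorph_sum; apply: eq_bigr => i _ /=.
by rewrite inner_conj.
Qed.

Lemma applyD F u v : apply F (u + v) = apply F u + apply F v.
Proof.
apply/ffunP => w; rewrite stateD !applyE -big_split; apply: eq_bigr => w' _ /=.
by rewrite stateD mulrDr.
Qed.

Lemma applyZ F (z : R[i]) v : apply F (z *: v) = z *: apply F v.
Proof.
apply/ffunP => w; rewrite stateZ !applyE mulr_sumr; apply: eq_bigr => w' _ /=.
by rewrite stateZ mulrCA.
Qed.

Lemma apply_sum (I : Type) (s : seq I) (Q : pred I) (f : I -> state) F :
  apply F (\sum_(i <- s | Q i) f i) = \sum_(i <- s | Q i) apply F (f i).
Proof.
elim/big_rec2: _ => [|i x y _ <-]; last by rewrite applyD.
by have := applyZ F 0 0; rewrite !scale0r.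
Qed.

Definition idop : op R n P := fun w w' => (w == w')%:R.

Lemma apply_id v : apply idop v = v.
Proof.
apply/ffunP => w; rewrite applyE (bigD1 w) //= /idop eqxx mul1r big1 ?addr0 //.
by move=> w'; rewrite eq_sym => /negPf ->; rewrite mul0r.
Qed.

Definition snorm v : R := Num.sqrt (\sum_w cabs (v w) ^+ 2).

Lemma snorm_ge0 v : 0 <= snorm v. Proof. exact: sqrtr_ge0. Qed.

Lemma snorm_sqr v : snorm v ^+ 2 = \sum_w cabs (v w) ^+ 2.
Proof. by rewrite sqr_sqrtr // sumr_ge0 // => w _; apply: sqr_ge0. Qed.

Lemma inner_self v : inner v v = rC (snorm v ^+ 2).
Proof. by rewrite snorm_sqr rC_sum; apply: eq_bigr => w _; rewrite cabs_sqr. Qed.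

Lemma cabs_inner u v : cabs (inner u v) <= snorm u * snorm v.
Proof.
apply: le_trans (cabs_sum _ _ _) _; under eq_bigr => w _ do rewrite cabsM cabs_conj.
by apply: cauchy_schwarz_sum => w; apply: cabs_ge0.
Qed.

Lemma snorm_le_inner v (c : R) : 0 <= c -> cabs (inner v v) <= c ^+ 2 -> snorm v <= c.
Proof.
move=> c0; by rewrite inner_self cabs_rC ?sqr_ge0 // ler_pXn2r ?nnegrE ?snorm_ge0.
Qed.

Lemma snormD u v : snorm (u + v) <= snorm u + snorm v.
Proof.
apply: snorm_le_inner; first by rewrite addr_ge0 ?snorm_ge0.
rewrite innerDl !innerDr sqrrD.
have := cabs_inner u v; have := cabs_inner v u; have := cabs_inner u u; have := cabs_inner v v.
move=> h1 h2 h3 h4; apply: le_trans (cabsD _ _) _.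
apply: le_trans (lerD (cabsD _ _) (cabsD _ _)) _.
move: h1 h2 h3 h4; rewrite -!expr2 [snorm v * _]mulrC mulr2n; lra.
Qed.

Lemma snormZ (z : R[i]) v : snorm (z *: v) = cabs z * snorm v.
Proof.
rewrite /snorm -[cabs z in RHS]ger0_norm ?cabs_ge0 // -sqrtr_sqr -sqrtrM ?sqr_ge0 //.
by congr Num.sqrt; rewrite mulr_sumr; apply: eq_bigr => w _; rewrite stateZ cabsM exprMn.
Qed.

Lemma snorm0 : snorm 0 = 0.
Proof. by rewrite -(scale0r 0) snormZ cabs0 mul0r. Qed.

Lemma snorm_sum (I : Type) (s : seq I) (Q : pred I) (f : I -> state) :
  snorm (\sum_(i <- s | Q i) f i) <= \sum_(i <- s | Q i) snorm (f i).
Proof.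
elim/big_rec2: _ => [|i x y _ h]; first by rewrite snorm0.
by apply: le_trans (snormD _ _) _; apply: lerD.
Qed.

Lemma snorm_apply F v : opnorm_le1 F -> snorm (apply F v) <= snorm v.
Proof.
move=> /(_ v); rewrite !inner_self lecR ler_pXn2r ?nnegrE ?snorm_ge0 //.
Qed.

Lemma cabs_inner_apply F u v : opnorm_le1 F ->
  cabs (inner u (apply F v)) <= snorm u * snorm v.
Proof.
move=> hF; apply: le_trans (cabs_inner _ _) _.
by rewrite ler_wpM2l ?snorm_ge0 ?snorm_apply.
Qed.

Lemma opnorm_id : opnorm_le1 idop.
Proof. by move=> v; rewrite apply_id. Qed.

End StateSpace.

(** * Expansion over a window on which the operator is trivial *)

Section Window.
Context {R : realType} {P D n : nat}.
Local Notation Mx := 'M[R[i]]_D.+1.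
Implicit Types (X : nat -> 'I_P -> 'M[R[i]]_D.+1) (Y Z : 'M[R[i]]_D.+1).
Implicit Types (w u : word n P).
Context (i0 : 'I_P).

(** A configuration of the sites outside [W] is represented by the full word carrying the letter
    [i0] on [W]. Both tensor factors thus remain inside the type [word n P]. *)
Definition reset (W : pred nat) (w : word n P) : word n P :=
  [ffun l : 'I_n => if W l then i0 else w l].

(* [F] is the identity on the sites of [W], tensored with an operator on the rest. *)
Definition trivial_on (W : pred nat) (F : op R n P) :=
  forall w w', F w w' = if [forall l : 'I_n, W l ==> (w l == w' l)]
                        then F (reset W w) (reset W w') else 0.

Definition merge (W : pred nat) (xu : word n P * word n P) : word n P :=
  [ffun l : 'I_n => if W l then xu.2 l else xu.1 l].


(** The sum over a tensor product as a double sum: [x] runs over the configurations outside [W] and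
    [u] over those on [W], each padded with [i0]. *)
Lemma merge_sum W (G : word n P -> R[i]) :
  \sum_w G w = \sum_(x | reset W x == x)
               \sum_(u | reset (predC W) u == u) G (merge W (x, u)).
Proof.
pose h' w := (reset W w, reset (predC W) w).
rewrite (reindex_onto (merge W) h') /=; last first.
  by move=> w _; apply/ffunP => l; rewrite !ffunE /=; case: (W l).
rewrite pair_big_dep /=; apply: eq_big => [[x u]|[x u] _] //=.
rewrite -pair_eqE /=; congr andb; congr (_ == _); apply/ffunP => l; rewrite !ffunE /=.
  by case: (W l).
by case: (W l).
Qed.

Definition wn (w : word n P) (l : nat) : 'I_P :=
  if insub l is Some k then w k else i0.

Lemma wnE w (l : 'I_n) : wn w l = w l.
Proof. by rewrite /wn valK. Qed.

Lemma wn_prod X w : \prod_(l < n) X l (w l) = \prod_(0 <= l < n) X l (wn w l).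
Proof. by rewrite big_mkord; apply: eq_bigr => l _; rewrite wnE. Qed.

Lemma wn_reset W w l : (l < n)%N -> wn (reset W w) l = if W l then i0 else wn w l.
Proof. by move=> ln; rewrite -[l]/(val (Ordinal ln)) !wnE ffunE. Qed.

Context (a b : nat).
Hypothesis ab : (a < b)%N.
Hypothesis bn : (b <= n)%N.

Definition win : pred nat := fun l => (a <= l < b)%N.

(* Freezing the letters of the window and inserting one matrix unit yields
   another matrix product state, so the open-boundary vectors of the expansion
   are covered by the same norm estimates. *)
Definition frozen X (p : 'I_D.+1 * 'I_D.+1) l i : Mx :=
  if win l then (i == i0)%:R *: (if l == a then delta_mx p.1 p.2 else 1%:M)
  else X l i.

Definition wprod X w : Mx := \prod_(a <= l < b) X l (wn w l).

Lemma split_window X w : \prod_(l < n) X l (w l) =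
  (\prod_(0 <= l < a) X l (wn w l)) *m wprod X w *m (\prod_(b <= l < n) X l (wn w l)).
Proof.
have an : (a <= n)%N by apply: leq_trans bn; apply: ltnW.
by rewrite wn_prod (@big_cat_nat _ _ _ a) //= (@big_cat_nat _ _ _ b a n) ?(ltnW ab) //= mulrA.
Qed.

Lemma frozen_outside X p l i : ~~ win l -> frozen X p l i = X l i.
Proof. by rewrite /frozen => /negPf ->. Qed.

Lemma frozen_window X p w : wprod (frozen X p) (reset win w) = delta_mx p.1 p.2.
Proof.
have lt_n l : (l < b)%N -> (l < n)%N by move/leq_trans; apply.
rewrite /wprod big_ltn // wn_reset ?lt_n // /frozen /win leqnn ab !eqxx scale1r.
rewrite big_nat_cond big1 ?mulr1 // => l /andP[/andP[al lb] _].
rewrite wn_reset ?lt_n // /win (ltnW al) lb eqxx scale1r.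
by rewrite gtn_eqF.
Qed.

Lemma outside_eq X p w :
  (\prod_(0 <= l < a) frozen X p l (wn (reset win w) l) = \prod_(0 <= l < a) X l (wn w l)) *
  (\prod_(b <= l < n) frozen X p l (wn (reset win w) l) = \prod_(b <= l < n) X l (wn w l)).
Proof.
split; apply: eq_big_nat => l /andP[l1 l2].
  have nw : ~~ win l by rewrite /win leqNgt l2.
  rewrite frozen_outside // wn_reset ?(negPf nw) //.
  by apply: leq_trans bn; apply: leq_trans (ltnW ab).
have nw : ~~ win l by rewrite /win andbC ltnNge l1.
by rewrite frozen_outside // wn_reset ?(negPf nw).
Qed.

Lemma mps_window X w :
  mps n X w = \sum_p wprod X w p.1 p.2 * mps n (frozen X p) (reset win w).
Proof.
rewrite ffunE split_window; set Lf := \prod_(0 <= l < a) _; set Rt := \prod_(b <= l < n) _.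
rewrite [wprod X w in LHS]matrix_sum_delta pair_bigA /= mulmx_sumr mulmx_suml.
rewrite linear_sum /=; apply: eq_bigr => p _.
rewrite -scalemxAr -scalemxAl mxtraceZ; congr (_ * _).
by rewrite ffunE split_window frozen_window !outside_eq.
Qed.

Lemma frozen_vanish X p w : reset win w != w -> mps n (frozen X p) w = 0.
Proof.
move=> hw; have [l wl nl] : exists2 l : 'I_n, win l & w l != i0.
  case: (pickP (fun l : 'I_n => win l && (w l != i0))) => [l /andP[]|h].
    by exists l.
  case/negP: hw; apply/eqP/ffunP => l; rewrite ffunE; case wl: (win l) => //.
  by have := h l; rewrite wl /= => /negbFE /eqP.
rewrite ffunE wn_prod (@big_cat_nat _ _ _ l) //=; last exact: ltnW.
rewrite [\prod_(l <= i < n) _]big_ltn // wnE {2}/frozen wl (negPf nl) scale0r mul0r mulr0.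
by rewrite mxtrace0.
Qed.

(** Complementary to [frozen]: the indicator of [i0] outside the window turns a sum over window
    configurations into a sum over all words, to which [word_sum] applies. *)
Definition unfrozen X l i : Mx := if win l then X l i else (i == i0)%:R *: 1%:M.

Lemma unfrozen_prod X u : \prod_(l < n) unfrozen X l (u l) =
  if reset (predC win) u == u then wprod X u else 0.
Proof.
case: eqP => [hu|/eqP hu].
  rewrite split_window.
  have out l : (l < n)%N -> ~~ win l -> unfrozen X l (wn u l) = 1.
    move=> ln nw; rewrite /unfrozen (negPf nw) -hu wn_reset //= nw eqxx.
    by rewrite scale1r.
  rewrite [\prod_(0 <= l < a) _]big_nat_cond [\prod_(b <= l < n) _]big_nat_cond.
  rewrite [\prod_(0 <= l < a | _) _]big1; last first.
    move=> l /andP[/andP[_ la] _]; apply: out; last by rewrite /win leqNgt la.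
    by apply: leq_trans bn; apply: leq_trans (ltnW ab).
  rewrite [\prod_(b <= l < n | _) _]big1; last first.
    move=> l /andP[/andP[bl ln] _]; apply: out => //.
    by rewrite /win andbC ltnNge bl.
  rewrite [1]/(1%:M) mul1mx mulmx1; apply: eq_big_nat => l lab.
  by rewrite /unfrozen /win lab.
have [l nw nl] : exists2 l : 'I_n, ~~ win l & u l != i0.
  case: (pickP (fun l : 'I_n => ~~ win l && (u l != i0))) => [l /andP[]|h].
    by exists l.
  case/negP: hu; apply/eqP/ffunP => l; rewrite ffunE /=; case wl: (win l) => //=.
  by have := h l; rewrite wl /= => /negbFE /eqP.
rewrite wn_prod (@big_cat_nat _ _ _ l) //=; last exact: ltnW.
by rewrite [\prod_(l <= i < n) _]big_ltn // wnE {2}/unfrozen (negPf nw) (negPf nl) scale0r mul0r mulr0.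
Qed.

Lemma tr2_indicator Z :
  tr2 (fun i : 'I_P => (i == i0)%:R *: (1%:M : Mx)) (fun i => (i == i0)%:R *: 1%:M) Z = Z.
Proof.
rewrite /tr2 (bigD1 i0) //= eqxx !scale1r mul1mx big1 => [|i /negPf ->].
  by rewrite addr0 /hermc trmx1 map_mx1 mulmx1.
by rewrite !scale0r !mul0mx.
Qed.

Lemma unfrozen_tcomp X X' Z :
  tcomp (unfrozen X) (unfrozen X') (iota 0 n) Z = tcomp X X' (iota a (b - a)) Z.
Proof.
have -> : iota 0 n = iota 0 a ++ iota a (b - a) ++ iota b (n - b).
  have e : n = (a + ((b - a) + (n - b)))%N by move: ab bn; lia.
  by rewrite {1}e !iotaD !add0n subnKC // ltnW.
have un X1 l : ~~ win l -> unfrozen X1 l = fun i => (i == i0)%:R *: 1%:M.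
  by move=> nw; apply/funext => i; rewrite /unfrozen (negPf nw).
rewrite !tcomp_cat [tcomp _ _ (iota b _) Z]tcomp_id; last first.
  move=> l Y; rewrite mem_iota => /andP[bl _].
  by rewrite !un ?tr2_indicator // /win andbC ltnNge bl.
rewrite tcomp_id; last first.
  move=> l Y; rewrite mem_iota => /andP[_ la].
  by rewrite !un ?tr2_indicator // /win leqNgt la.
have inw X1 l : l \in iota a (b - a) -> unfrozen X1 l = X1 l.
  rewrite mem_iota subnKC ?(ltnW ab) // => lab.
  by apply/funext => i; rewrite /unfrozen /win lab.
by apply: eq_tcomp => l /inw.
Qed.

(** The matrix entries of the transfer map across the window; all dependence of a matrix element on
    the window sites passes through them. *)
Definition window_kernel X X' (p p' : 'I_D.+1 * 'I_D.+1) : R[i] :=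
  tcomp X X' (iota a (b - a)) (delta_mx p.2 p'.2) p.1 p'.1.

Lemma window_kernelE X X' p p' :
  \sum_(u | reset (predC win) u == u) wprod X u p.1 p.2 * (wprod X' u p'.1 p'.2)^* =
  window_kernel X X' p p'.
Proof.
rewrite /window_kernel -unfrozen_tcomp -word_sum summxE big_mkcond; apply: eq_bigr => u _.
rewrite sandwich_delta !unfrozen_prod; case: ifP => // _.
by rewrite mxE mul0r.
Qed.

Lemma sesquilinear_exchange (I J : finType) (p0 : pred I) (p1 : pred J) (T : finType)
   (k k' : T -> J -> R[i]) (o o' : T -> I -> R[i]) (f : I -> I -> R[i]) :
  \sum_(x | p0 x) \sum_(u | p1 u) \sum_(x' | p0 x')
     (\sum_p' k' p' u * o' p' x)^* * (f x x' * (\sum_p k p u * o p x')) =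
  \sum_p \sum_p' (\sum_(u | p1 u) k p u * (k' p' u)^*) *
     (\sum_(x | p0 x) \sum_(x' | p0 x') (o' p' x)^* * (f x x' * o p x')).
Proof.
transitivity (\sum_(x | p0 x) \sum_(u | p1 u) \sum_(x' | p0 x') \sum_p \sum_p'
    (k p u * (k' p' u)^*) * ((o' p' x)^* * (f x x' * o p x'))).
  apply: eq_bigr => x _; apply: eq_bigr => u _; apply: eq_bigr => x' _.
  rewrite mulr_sumr mulr_sumr; apply: eq_bigr => p _.
  rewrite rmorph_sum mulr_suml; apply: eq_bigr => p' _.
  by rewrite rmorphM /=; ring.
under eq_bigr => x _ do (under eq_bigr => u _ do
  (rewrite exchange_big; under eq_bigr => p _ do rewrite exchange_big)).
under eq_bigr => x _ do
  (rewrite exchange_big; under eq_bigr => p _ do rewrite exchange_big).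
rewrite exchange_big; apply: eq_bigr => p _; rewrite exchange_big.
apply: eq_bigr => p' _ /=.
rewrite mulr_suml exchange_big; apply: eq_bigr => u _.
rewrite mulr_sumr; apply: eq_bigr => x _; rewrite mulr_sumr.
by apply: eq_bigr => x' _.
Qed.

(** [F] leaves the window letters alone, so they coincide in bra and ket. Summing over them yields
    the kernel, and what remains is a matrix element between states whose window has been replaced
    by matrix units. *)
Lemma window_expansion X X' F : trivial_on win F ->
  inner (mps n X') (apply F (mps n X)) =
  \sum_p \sum_p' window_kernel X X' p p' *
     inner (mps n (frozen X' p')) (apply F (mps n (frozen X p))).
Proof.
move=> hF.
have innerE (o' o : state R n P) :
    (forall w, reset win w != w -> o' w = 0) -> (forall w, reset win w != w -> o w = 0) ->
    inner o' (apply F o) = \sum_(x | reset win x == x) \sum_(x' | reset win x' == x')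
      (o' x)^* * (F x x' * o x').
  move=> h' h; rewrite /inner (bigID (fun x => reset win x == x)) /=.
  rewrite [X in _ + X]big1 ?addr0 => [|x hx]; last by rewrite h' // rmorph0 mul0r.
  apply: eq_bigr => x _; rewrite applyE (bigID (fun x => reset win x == x)) /=.
  rewrite [X in _ + X]big1 ?addr0 => [|x' hx]; last by rewrite h // mulr0.
  by rewrite mulr_sumr.
under eq_bigr => p _ do under eq_bigr => p' _ do
  (rewrite -window_kernelE innerE; [|exact: frozen_vanish|exact: frozen_vanish]).
rewrite -[RHS](sesquilinear_exchange (fun x => reset win x == x)
  (fun u => reset (predC win) u == u)
  (fun p u => wprod X u p.1 p.2) (fun p u => wprod X' u p.1 p.2)
  (fun p x => mps n (frozen X p) x) (fun p x => mps n (frozen X' p) x) F).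
transitivity (\sum_w (mps n X' w)^* * apply F (mps n X) w); first by [].
rewrite (merge_sum win (fun w => (mps n X' w)^* * apply F (mps n X) w)); apply: eq_bigr => x /eqP hx; apply: eq_bigr => u /eqP hu.
rewrite applyE; have -> := merge_sum win (fun w => F (merge win (x, u)) w * mps n X w).
rewrite mulr_sumr; apply: eq_bigr => x' /eqP hx'.
have rm y : reset win y = y -> forall u, reset win (merge win (y, u)) = y.
  move=> hy u1; rewrite -[RHS]hy; apply/ffunP => l; rewrite !ffunE /=; by case: (win l).
have wm X1 y u1 : wprod X1 (merge win (y, u1)) = wprod X1 u1.
  apply: eq_big_nat => l /andP[al lb]; congr (X1 l _).
  have ln : (l < n)%N by apply: leq_trans bn.
  by rewrite -[l]/(val (Ordinal ln)) !wnE ffunE /win /= al lb.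
(* Triviality of [F] on the window removes every ket configuration other than [u]. *)
rewrite (bigD1 u) ?hu //= [X in _ + X]big1 ?addr0; last first.
  move=> u' /andP[/eqP hu' u'u]; rewrite hF ifF ?mul0r //.
  apply: contraNF u'u => /forallP h; apply/eqP/ffunP => l.
  rewrite -hu -hu' !ffunE /=; case wl: (win l) => //=.
  by have := h l; rewrite wl !ffunE wl /= => /eqP.
rewrite !mps_window !rm // hF ifT; last first.
  by apply/forallP => l; apply/implyP => wl; rewrite !ffunE wl.
rewrite !rm //; congr (_^* * (_ * _)).
  by apply: eq_bigr => p _; rewrite wm.
by apply: eq_bigr => p _; rewrite wm.
Qed.

End Window.

(** * Matrix elements between excitations *)

Section SingleExcitation.
Context {R : realType} {P D : nat}.
Local Notation Mx := 'M[R[i]]_D.+1.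
Implicit Types (B : 'I_P -> 'M[R[i]]_D.+1) (X : nat -> 'I_P -> 'M[R[i]]_D.+1).
Implicit Types (Y Z : 'M[R[i]]_D.+1).
Context (i0 : 'I_P) (A : 'I_P -> Mx) (m : nat) (q c e : R) (r : Mx) (l : Mx -> R[i]).
Hypothesis hA : mixing A m q c e r l.
Context (beta : R).
Hypothesis beta1 : 1 <= beta.
Hypothesis Abeta : tnorm A <= beta.
Local Notation T := (transfer A).
Local Notation d2 := (D.+1%:R : R).

Definition gauge B := (forall Y, l (tr2 B A Y) = 0) /\ (forall Y, l (tr2 A B Y) = 0).

Let c1 : 1 <= c. Proof. by case: hA. Qed.
Let c0 : 0 <= c. Proof. exact: le_trans c1. Qed.
Let q0 : 0 <= q. Proof. by case: hA => _ /andP[]. Qed.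
Let b0 : 0 <= beta. Proof. exact: le_trans beta1. Qed.

Definition single (j : nat) B : nat -> 'I_P -> Mx := fun k => if k == j then B else A.

Lemma tr2_beta B B' Y : tnorm B <= beta -> tnorm B' <= beta ->
  mnorm (tr2 B B' Y) <= beta ^+ 2 * mnorm Y.
Proof.
move=> h h'; apply: le_trans (mnorm_tr2 _ _ _) _; rewrite ler_wpM2r ?mnorm_ge0 //.
by rewrite expr2 ler_pM ?tnorm_ge0.
Qed.

(** At most one excited site, costing [beta ^+ 2], separates two runs of plain sites costing [c]
    each. *)
Definition cs0 := c ^+ 2 * beta ^+ 2.

Lemma cs0_ge1 : 1 <= cs0.
Proof. by rewrite /cs0 -exprMn exprn_ege1 // mulr_ege1. Qed.

Let cs00 : 0 <= cs0. Proof. exact: le_trans cs0_ge1. Qed.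

Lemma iota_split x k j : (x <= j < x + k)%N ->
  iota x k = iota x (j - x) ++ j :: iota j.+1 (x + k - j.+1).
Proof.
move=> /andP[xj jk]; have e1 : k = ((j - x) + (x + k - j.+1).+1)%N by lia.
by rewrite {1}e1 iotaD subnKC.
Qed.

Lemma tcomp_single x k j B Y : tnorm B <= beta ->
  mnorm (tcomp (single j B) (single j B) (iota x k) Y) <= cs0 * mnorm Y.
Proof.
move=> hB; have [hj|hj] := boolP (x <= j < x + k)%N.
  rewrite (iota_split hj) tcomp_cat.
  rewrite (tcomp_const (A := A)); [|move=> i|move=> i]; last first.
  - by rewrite mem_iota /single => hi; rewrite ifF //; apply/eqP; lia.
  - by rewrite mem_iota /single => hi; rewrite ifF //; apply/eqP; lia.
  apply: le_trans (mix_iter hA _ _) _.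
  rewrite /= {1 2}/single eqxx.
  apply: (le_trans (ler_wpM2l c0 (tr2_beta _ hB hB))).
  rewrite (tcomp_const (A := A)); [|move=> i|move=> i]; last first.
  - by rewrite mem_iota /single => hi; rewrite ifF //; apply/eqP; lia.
  - by rewrite mem_iota /single => hi; rewrite ifF //; apply/eqP; lia.
  have h := mix_iter hA (size (iota j.+1 (x + k - j.+1))) Y.
  have h2 : 0 <= c * beta ^+ 2 by rewrite mulr_ge0 ?exprn_ge0.
  rewrite mulrA; apply: le_trans (ler_wpM2l h2 h) _.
  by rewrite (_ : c * beta ^+ 2 * (c * mnorm Y) = cs0 * mnorm Y) //; rewrite /cs0; ring.
rewrite (tcomp_const (A := A)); [|move=> i|move=> i]; last first.
- by rewrite mem_iota /single => hi; rewrite ifF //; apply: contraNF hj => /eqP <-.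
- by rewrite mem_iota /single => hi; rewrite ifF //; apply: contraNF hj => /eqP <-.
apply: le_trans (mix_iter hA _ _) _; rewrite ler_wpM2r ?mnorm_ge0 //.
by rewrite /cs0 expr2 -mulrA ler_peMr // mulr_ege1 // exprn_ege1.
Qed.

Lemma mnorm_delta (a b : 'I_D.+1) : mnorm (delta_mx a b : Mx) = 1.
Proof.
rewrite /mnorm (bigD1 a) //= (bigD1 b) //= mxE !eqxx cabs1.
rewrite big1 => [|j jb]; last by rewrite mxE (negPf jb) andbF cabs0.
rewrite addr0 big1 ?addr0 // => i ia; rewrite big1 // => j _.
by rewrite mxE (negPf ia) cabs0.
Qed.

Lemma tr2_delta p Z :
  mnorm (tr2 (fun i : 'I_P => (i == i0)%:R *: (delta_mx p.1 p.2 : Mx))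
             (fun i => (i == i0)%:R *: delta_mx p.1 p.2) Z) <= mnorm Z.
Proof.
rewrite /tr2 (bigD1 i0) //= eqxx !scale1r big1 => [|i /negPf ->]; last first.
  by rewrite !scale0r !mul0mx.
rewrite addr0; apply: le_trans (mnormM _ _) _; rewrite mnorm_hermc mnorm_delta mulr1.
by apply: le_trans (mnormM _ _) _; rewrite mnorm_delta mul1r.
Qed.

Definition cs := d2 * cs0.

Lemma cs_ge0 : 0 <= cs. Proof. by rewrite mulr_ge0. Qed.

Lemma snorm_mps n X (k : R) : 0 <= k ->
  (forall Y, mnorm (tcomp X X (iota 0 n) Y) <= k ^+ 2 * mnorm Y) ->
  snorm (mps n X) <= d2 * k.
Proof.
move=> k0 h; apply: snorm_le_inner; first by rewrite mulr_ge0.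
rewrite inner_mps; apply: le_trans (cabs_sum _ _ _) _.
apply: (@le_trans _ _ (\sum_(a < D.+1) d2 * k ^+ 2)).
  apply: ler_sum => a _; apply: le_trans (cabs_sum _ _ _) _.
  apply: (@le_trans _ _ (\sum_(b < D.+1) k ^+ 2)).
    apply: ler_sum => b _; apply: le_trans (mnorm_entry _ a b) _.
    by apply: le_trans (h _) _; rewrite mnorm_delta mulr1.
  by rewrite sumr_const card_ord mulr_natl.
by rewrite sumr_const card_ord exprMn -[(d2 * _) *+ _]mulr_natl mulrA -expr2.
Qed.

Lemma snorm_single n j B : tnorm B <= beta -> snorm (mps n (single j B)) <= cs.
Proof.
move=> hB; apply: snorm_mps => // Y; apply: le_trans (tcomp_single _ _ _ _ hB) _.
by rewrite ler_wpM2r ?mnorm_ge0 // expr2 ler_peMr // cs0_ge1.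
Qed.

(** The matrix unit at site [a] does not increase the norm and the other window sites act as the
    identity. The two outer pieces cost [cs0] each, and this [cs0 ^+ 2] is why [snorm_mps] is stated
    with a square. *)
Lemma snorm_frozen n a b j B p : (a < b)%N -> (b <= n)%N -> tnorm B <= beta ->
  snorm (mps n (frozen i0 a b (single j B) p)) <= cs.
Proof.
move=> ab bn hB; apply: snorm_mps => // Y.
have -> : iota 0 n = iota 0 a ++ [:: a] ++ iota a.+1 (b - a.+1) ++ iota b (n - b).
  have e1 : n = (a + (1 + ((b - a.+1) + (n - b))))%N by lia.
  by rewrite {1}e1 !iotaD !add0n addn1 subnKC.
rewrite !tcomp_cat.
have out X1 k : ~~ win a b k -> frozen i0 a b X1 p k = X1 k.
  by move=> nw; apply/funext => i; rewrite frozen_outside.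
rewrite [tcomp _ _ (iota b _) Y](@eq_tcomp _ _ _ _ _ (single j B) (single j B)); first last.
- by move=> k; rewrite mem_iota => hk; rewrite out // /win; lia.
- by move=> k; rewrite mem_iota => hk; rewrite out // /win; lia.
rewrite [tcomp _ _ (iota a.+1 _) _]tcomp_id; last first.
  move=> k Z; rewrite mem_iota => hk.
  rewrite (_ : frozen i0 a b (single j B) p k = fun i => (i == i0)%:R *: 1%:M).
    exact: tr2_indicator.
  apply/funext => i; rewrite /frozen /win ifT; last by lia.
  by rewrite gtn_eqF //; lia.
rewrite (@eq_tcomp _ _ _ _ _ (single j B) (single j B) (iota 0 a)); first last.
- by move=> k; rewrite mem_iota => hk; rewrite out // /win; lia.
- by move=> k; rewrite mem_iota => hk; rewrite out // /win; lia.
apply: le_trans (tcomp_single _ _ _ _ hB) _.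
rewrite expr2 -mulrA ler_wpM2l //=.
apply: (le_trans _ (tcomp_single b (n - b) j Y hB)).
rewrite (_ : frozen i0 a b (single j B) p a = fun i => (i == i0)%:R *: delta_mx p.1 p.2).
  exact: tr2_delta.
by apply/funext => i; rewrite /frozen /win leqnn ab eqxx.
Qed.

(** If two pairs of states agree after freezing, only their window kernels differ. There are
    [d2 ^+ 4] terms, each with two frozen states of norm at most [cs]. The scalar [z] covers both
    uses: [z = 0] for off-diagonal elements, an overlap for diagonal ones. *)
Lemma window_difference n a b (F : op R n P) X1 X1' X2 X2' (z : R[i]) (h : R) :
  (a < b)%N -> (b <= n)%N -> trivial_on i0 (win a b) F -> opnorm_le1 F -> 0 <= h ->
  (forall p p', cabs (window_kernel a b X1 X1' p p' - z * window_kernel a b X2 X2' p p') <= h) ->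
  (forall p, mps n (frozen i0 a b X1 p) = mps n (frozen i0 a b X2 p)) ->
  (forall p, mps n (frozen i0 a b X1' p) = mps n (frozen i0 a b X2' p)) ->
  (forall p, snorm (mps n (frozen i0 a b X2 p)) <= cs) ->
  (forall p, snorm (mps n (frozen i0 a b X2' p)) <= cs) ->
  cabs (inner (mps n X1') (apply F (mps n X1)) - z * inner (mps n X2') (apply F (mps n X2)))
    <= d2 ^+ 4 * cs ^+ 2 * h.
Proof.
move=> ab bn hF opF h0 hk e1 e1' s2 s2'.
rewrite !(@window_expansion _ _ _ _ i0 a b ab bn) // mulr_sumr -sumrB.
have card : #|{: 'I_D.+1 * 'I_D.+1}| = (D.+1 ^ 2)%N by rewrite card_prod card_ord.
apply: le_trans (cabs_sum _ _ _) _.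
apply: (@le_trans _ _ (\sum_(p : 'I_D.+1 * 'I_D.+1) \sum_(p' : 'I_D.+1 * 'I_D.+1) h * (cs * cs))).
  apply: ler_sum => p _; rewrite mulr_sumr -sumrB.
  apply: le_trans (cabs_sum _ _ _) _; apply: ler_sum => p' _.
  rewrite e1 e1' mulrA -mulrBl cabsM; apply: ler_pM; rewrite ?cabs_ge0 //.
  apply: le_trans (cabs_inner_apply _ _ opF) _.
  by apply: ler_pM; rewrite ?snorm_ge0.
rewrite !sumr_const card -mulrnA -[(h * _) *+ _]mulr_natl natrM natrX.
by rewrite (_ : d2 ^+ 2 * d2 ^+ 2 * (h * (cs * cs)) = d2 ^+ 4 * cs ^+ 2 * h) //; ring.
Qed.

Definition coff := d2 ^+ 4 * cs ^+ 2 * (c * beta ^+ 2).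

Lemma window_coff_ge0 : 0 <= coff.
Proof. by rewrite !mulr_ge0 ?exprn_ge0 ?cs_ge0. Qed.

(* The window ends at the leftmost excitation, where [l] meets the gauge
   condition; the other excitation may be arbitrarily close to it. *)
Lemma single_offdiag n k j j' B B' (F : op R n P) :
  j != j' -> (j < n)%N -> (j' < n)%N -> (k * m <= minn j j')%N ->
  tnorm B <= beta -> tnorm B' <= beta -> gauge B -> gauge B' ->
  trivial_on i0 (win (minn j j' - k * m) (minn j j').+1) F -> opnorm_le1 F ->
  cabs (inner (mps n (single j' B')) (apply F (mps n (single j B)))) <= coff * q ^+ k.
Proof.
move=> jj' jn j'n hk hB hB' [gB1 _] [_ gB2] hF opF.
set mu := minn j j' in hk hF.
have ab : (mu - k * m < mu.+1)%N by lia.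
have bn : (mu.+1 <= n)%N by rewrite /mu; lia.
have := @window_difference n _ _ F (single j B) (single j' B') (single j B) (single j' B')
  0 (c * beta ^+ 2 * q ^+ k) ab bn hF opF.
rewrite mul0r subr0 => W; rewrite (_ : coff * q ^+ k = d2 ^+ 4 * cs ^+ 2 * (c * beta ^+ 2 * q ^+ k)); last first.
  by rewrite /coff; ring.
apply: W => //.
- by rewrite !mulr_ge0 ?exprn_ge0.
- move=> p p'; rewrite mul0r subr0 /window_kernel; apply: le_trans (mnorm_entry _ _ _) _.
  have -> : iota (mu - k * m) (mu.+1 - (mu - k * m)) = iota (mu - k * m) (k * m) ++ [:: mu].
    have -> : (mu.+1 - (mu - k * m) = k * m + 1)%N by lia.
    by rewrite iotaD subnK.
  rewrite tcomp_cat (tcomp_const (A := A)); last first.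
  - by move=> i; rewrite mem_iota /single => hi; rewrite ifF //; apply/eqP; rewrite /mu in hi *; lia.
  - by move=> i; rewrite mem_iota /single => hi; rewrite ifF //; apply/eqP; rewrite /mu in hi *; lia.
  rewrite size_iota /=; set Z := tr2 _ _ _.
  have lZ : l Z = 0.
    rewrite /Z /single /mu; case: (ltngtP j j') jj' => // h _.
      by rewrite eqxx ltn_eqF.
    by rewrite eqxx ltn_eqF.
  have ZN : mnorm Z <= beta ^+ 2.
    rewrite -[_ ^+ 2]mulr1 -(mnorm_delta p.2 p'.2); apply: tr2_beta; rewrite /single; by case: ifP.
  have := mix_cvg hA k Z; rewrite lZ scale0r subr0 => /le_trans; apply.
  by rewrite mulrAC ler_wpM2r ?exprn_ge0 // ler_wpM2l.
- by move=> p; apply: snorm_frozen.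
- by move=> p; apply: snorm_frozen.
Qed.

Lemma functional_iter_inv k Y : l (iter k T Y) = l Y.
Proof. by elim: k => //= k IH; rewrite (mix_inv hA). Qed.

Let lB Y Z : l (Y - Z) = l Y - l Z.
Proof. by rewrite -scaleN1r (mixD hA) (mixZ hA) mulN1r. Qed.

(** The limiting factor by which an excitation changes a matrix element of the vacuum; on plane
    waves it plays the part of the squared norm per site. *)
Definition overlap B' B := l (tr2 B B' r).

Lemma cabs_overlap B B' : tnorm B <= beta -> tnorm B' <= beta ->
  cabs (overlap B' B) <= c * (beta ^+ 2 * mnorm r).
Proof.
move=> hB hB'; apply: le_trans (mix_bound hA _) _; rewrite ler_wpM2l //.
exact: tr2_beta.
Qed.

Definition cdiag0 := c ^+ 2 * beta ^+ 2 * (1 + mnorm r + c * mnorm r).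
Definition cdiag := d2 ^+ 4 * cs ^+ 2 * cdiag0.

(** With [Z1 = tr2 B B' (T^(km) Y)], the two terms approach [l Z1 *: r] and
    [overlap B' B * l Y *: r], and [T^(km) Y] is close to [l Y *: r] inside [l Z1]. These three
    replacements account for the summands [1], [c * mnorm r] and [mnorm r] of [cdiag0]: the outer
    convergences give the first two, the inner one the last. *)
Lemma diag_kernel k B B' Y : tnorm B <= beta -> tnorm B' <= beta -> mnorm Y = 1 ->
  mnorm (iter (k * m) T (tr2 B B' (iter (k * m) T Y))
    - overlap B' B *: iter (k * m) T (iter (k * m).+1 T Y)) <= cdiag0 * q ^+ k.
Proof.
move=> hB hB' Y1; set Z1 := tr2 _ _ _; set Z2 := iter (k * m).+1 T Y; set z := overlap _ _.
have qk : 0 <= q ^+ k by rewrite exprn_ge0.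
have E := mix_cvg hA k Y; rewrite Y1 mulr1 in E.
have NZ1 : mnorm Z1 <= beta ^+ 2 * c.
  apply: le_trans (tr2_beta _ hB hB') _; rewrite ler_wpM2l ?exprn_ge0 //.
  by have := mix_iter hA (k * m) Y; rewrite Y1 mulr1.
have NZ2 : mnorm Z2 <= c by have := mix_iter hA (k * m).+1 Y; rewrite Y1 mulr1.
have h1 := le_trans (mix_cvg hA k Z1) (ler_wpM2l (mulr_ge0 c0 qk) NZ1).
have h2 := le_trans (mix_cvg hA k Z2) (ler_wpM2l (mulr_ge0 c0 qk) NZ2).
have lZ2 : l Z2 = l Y by apply: functional_iter_inv.
have h3 : cabs (l Z1 - z * l Y) <= c * (beta ^+ 2 * (c * q ^+ k)).
  have -> : l Z1 - z * l Y = l (tr2 B B' (iter (k * m) T Y - l Y *: r)).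
    rewrite -[- (l Y *: r)]scaleN1r tr2D !tr2Z scaleN1r lB (mixZ hA) [l Y * _]mulrC.
    by [].
  apply: le_trans (mix_bound hA _) _; rewrite ler_wpM2l //.
  by apply: le_trans (tr2_beta _ hB hB') _; rewrite ler_wpM2l ?exprn_ge0.
have h4 := cabs_overlap hB hB'; rewrite -/z in h4.
have -> : iter (k * m) T Z1 - z *: iter (k * m) T Z2 =
  (iter (k * m) T Z1 - l Z1 *: r) + (l Z1 - z * l Y) *: r
    - z *: (iter (k * m) T Z2 - l Z2 *: r).
  by rewrite lZ2 scalerBr scalerBl scalerA addrA subrK opprB addrA subrK.
apply: le_trans (mnormB _ _) _; rewrite mnormZ.
apply: le_trans (lerD (mnormD _ _) (lexx _)) _; rewrite mnormZ.
have h5 : cabs z * mnorm (iter (k * m) T Z2 - l Z2 *: r) <=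
    c * (beta ^+ 2 * mnorm r) * (c * q ^+ k * c).
  by apply: ler_pM; rewrite ?cabs_ge0 ?mnorm_ge0.
have h6 := ler_wpM2r (mnorm_ge0 r) h3.
apply: le_trans (lerD (lerD h1 h6) h5) _.
by rewrite /cdiag0 le_eqVlt; apply/orP; left; apply/eqP; ring.
Qed.

(** The window reaches [k * m] sites to either side of [j]. Freezing it erases the excitation, so
    the comparison state is the vacuum, written as an excitation by [A] itself. *)
Lemma single_diag n k j B B' (F : op R n P) :
  (k * m <= j)%N -> (j + k * m < n)%N ->
  tnorm B <= beta -> tnorm B' <= beta ->
  trivial_on i0 (win (j - k * m) (j + k * m).+1) F -> opnorm_le1 F ->
  cabs (inner (mps n (single j B')) (apply F (mps n (single j B)))
    - overlap B' B * inner (mps n (fun=> A)) (apply F (mps n (fun=> A)))) <= cdiag * q ^+ k.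
Proof.
move=> kj jn hB hB' hF opF.
have ab : (j - k * m < (j + k * m).+1)%N by lia.
have frz B1 p : frozen i0 (j - k * m) (j + k * m).+1 (single j B1) p =
    frozen i0 (j - k * m) (j + k * m).+1 (single j A) p.
  apply/funext => a; apply/funext => i; rewrite /frozen /win /single; case: ifP => // w.
  by rewrite !ifF //; apply/eqP => aj; move: w; rewrite aj; lia.
have -> : (fun=> A) = single j A by apply/funext => a; rewrite /single; case: ifP.
rewrite (_ : cdiag * q ^+ k = d2 ^+ 4 * cs ^+ 2 * (cdiag0 * q ^+ k)); last first.
  by rewrite /cdiag; ring.
apply: (window_difference ab jn hF opF); last by move=> p; apply: snorm_frozen.
- rewrite mulr_ge0 ?exprn_ge0 // /cdiag0 !mulr_ge0 ?exprn_ge0 //.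
  by rewrite !addr_ge0 ?mulr_ge0 ?mnorm_ge0.
- move=> p p'; rewrite /window_kernel.
  set s1 := iota _ _; have -> : s1 = iota (j - k * m) (k * m) ++ [:: j] ++ iota j.+1 (k * m).
    rewrite /s1; have -> : ((j + k * m).+1 - (j - k * m) = k * m + (1 + k * m))%N by lia.
    by rewrite !iotaD subnK //= addn1.
  rewrite !tcomp_cat !(tcomp_const (A := A) (s := iota (j - k * m) (k * m))); first last.
  - by move=> i; rewrite mem_iota /single => hi; rewrite ifF //; apply/eqP; lia.
  - by move=> i; rewrite mem_iota /single => hi; rewrite ifF //; apply/eqP; lia.
  - by move=> i; rewrite mem_iota /single => hi; rewrite ifF //; apply/eqP; lia.
  - by move=> i; rewrite mem_iota /single => hi; rewrite ifF //; apply/eqP; lia.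
  rewrite !(tcomp_const (A := A) (s := iota j.+1 (k * m))); first last.
  - by move=> i; rewrite mem_iota /single => hi; rewrite ifF //; apply/eqP; lia.
  - by move=> i; rewrite mem_iota /single => hi; rewrite ifF //; apply/eqP; lia.
  - by move=> i; rewrite mem_iota /single => hi; rewrite ifF //; apply/eqP; lia.
  - by move=> i; rewrite mem_iota /single => hi; rewrite ifF //; apply/eqP; lia.
  rewrite !size_iota /= {1 2}/single eqxx.
  have := diag_kernel k hB hB' (mnorm_delta p.2 p'.2).
  set M1 := iter (k * m) T (tr2 B _ _); set M2 := iter (k * m) T (iter _ _ _) => h.
  have -> : tr2 (single j A j) (single j A j) (iter (k * m) T (delta_mx p.2 p'.2)) =
    iter (k * m).+1 T (delta_mx p.2 p'.2) by rewrite /single eqxx.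
  apply: le_trans h; apply: le_trans (mnorm_entry _ p.1 p'.1).
  by rewrite !mxE.
- by move=> p; rewrite frz.
- by move=> p; rewrite frz.
- by move=> p; apply: snorm_frozen.
Qed.

Definition cvac := d2 ^+ 2 * c ^+ 2.

(** The squared norm is the trace of [T^n], which converges to the rank-one map [Y |-> l Y *: r] of
    trace [l r = 1]; [cvac] counts the matrix units. *)
Lemma vacuum_norm n k : (k * m <= n)%N ->
  cabs (inner (mps n (fun=> A)) (mps n (fun=> A)) - 1) <= cvac * q ^+ k.
Proof.
move=> kn; rewrite inner_mps.
have -> : 1 = \sum_(a < D.+1) \sum_(b < D.+1) (l (delta_mx a b) *: r) a b.
  rewrite -(mix_one hA) {1}(matrix_sum_delta r).
  rewrite (big_morph l (mixD hA) (_ : l 0 = 0)); last first.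
    by rewrite -(scale0r 0) (mixZ hA) mul0r.
  apply: eq_bigr => a _; rewrite (big_morph l (mixD hA) (_ : l 0 = 0)); last first.
    by rewrite -(scale0r 0) (mixZ hA) mul0r.
  by apply: eq_bigr => b _; rewrite (mixZ hA) mxE mulrC.
rewrite -sumrB; apply: le_trans (cabs_sum _ _ _) _.
apply: (@le_trans _ _ (\sum_(a < D.+1) \sum_(b < D.+1) c ^+ 2 * q ^+ k)); last first.
  rewrite !sumr_const card_ord -mulrnA -[(c ^+ 2 * _) *+ _]mulr_natl natrM /cvac.
  by rewrite -expr2 mulrA.
apply: ler_sum => a _; rewrite -sumrB; apply: le_trans (cabs_sum _ _ _) _.
apply: ler_sum => b _; rewrite (tcomp_const (A := A)) // size_iota.
have -> : n = (k * m + (n - k * m))%N by rewrite subnKC.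
rewrite iterD; set Y := iter (n - _) _ _.
have lY : l Y = l (delta_mx a b) by apply: functional_iter_inv.
rewrite -lY; set M := iter _ _ _.
have -> : M a b - (l Y *: r) a b = (M - l Y *: r) a b by rewrite !mxE.
apply: le_trans (mnorm_entry _ a b) _; apply: le_trans (mix_cvg hA k Y) _.
rewrite expr2 mulrAC ler_wpM2r ?exprn_ge0 // ler_wpM2l //.
by have := mix_iter hA (n - k * m) (delta_mx a b); rewrite mnorm_delta mulr1.
Qed.

End SingleExcitation.

(** * Supports of local operators *)

Section Locality.
Context {R : realType} {P n : nat}.
Context (i0 : 'I_P).

(** Together with the cardinality of [S], this is all that locality contributes. Unlike the exact
    cardinality in [dlocal], it is monotone in [S]. *)
Definition supported_on (S : {set 'I_n}) (F : op R n P) :=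
  forall W : pred nat, (forall l : 'I_n, l \in S -> ~~ W l) -> trivial_on i0 W F.

Lemma dlocal_supported d (F : op R n P) : dlocal d F ->
  exists2 S : {set 'I_n}, #|S| = d & supported_on S F.
Proof.
move=> [S [cS [FS hF]]]; exists S => // W hW w w'.
have agree : [forall i, (i \notin S) ==> (w i == w' i)] =
    [forall l : 'I_n, W l ==> (w l == w' l)] &&
    [forall i, (i \notin S) ==> (reset i0 W w i == reset i0 W w' i)].
  apply/forallP/andP => [h|[/forallP h1 /forallP h2] i].
    split; apply/forallP => i; apply/implyP => hi.
      by have := h i; rewrite (contraL (hW i)) // hi.
    by rewrite !ffunE; case: ifP => // _; have := h i; rewrite hi.
  apply/implyP => iS; have := h1 i; have := h2 i; rewrite iS /= !ffunE.
  by case: (W i).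
have re u : restr S (reset i0 W u) = restr S u.
  by apply/ffunP => -[x xS]; rewrite !ffunE /= (negPf (hW x xS)).
rewrite !hF agree !re.
by case: [forall l : 'I_n, W l ==> _].
Qed.

Lemma idop_supported : supported_on finset.set0 (@idop R n P).
Proof.
move=> W _ w w'; rewrite /idop.
case: ifP => [/forallP h|h]; last first.
  by case: eqP => // ww'; rewrite ww' in h; move/forallP: h; case=> l; rewrite eqxx implybT.
congr (_%:R); congr nat_of_bool; apply/eqP/eqP => [->//|/ffunP e]; apply/ffunP => l.
by have := e l; have := h l; rewrite !ffunE; case: (W l) => //= /eqP.
Qed.

Lemma supported_sub (S S' : {set 'I_n}) F : S \subset S' ->
  supported_on S F -> supported_on S' F.
Proof. by move=> /fintype.subsetP sS h W hW; apply: h => l /sS /hW. Qed.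

Lemma card_interval a k : (#|[set j : 'I_n | (a <= j < a + k)%N]%SET| <= k)%N.
Proof.
rewrite cardE -(size_map val) -[X in (_ <= X)%N](size_iota a k); apply: uniq_leq_size.
  by rewrite map_inj_uniq ?enum_uniq //; exact: val_inj.
by move=> x /mapP[j]; rewrite mem_enum inE => h ->; rewrite mem_iota.
Qed.

End Locality.

(** * Plane waves restricted to a set of sites *)

Section ExcitationEstimates.
Context {R : realType} {P D : nat}.
Local Notation Mx := 'M[R[i]]_D.+1.
Implicit Types (B : 'I_P -> 'M[R[i]]_D.+1).
Context (i0 : 'I_P) (A : 'I_P -> Mx) (m : nat) (q c e : R) (r : Mx) (l : Mx -> R[i]).
Hypothesis hA : mixing A m q c e r l.
Context (beta : R).
Hypothesis beta1 : 1 <= beta.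
Hypothesis Abeta : tnorm A <= beta.
Context (n k : nat).
Local Notation De := (k * m)%N.
Local Notation cs := (@cs R D c beta).
Local Notation coff := (@coff R D c beta).
Local Notation cdiag := (@cdiag R D c r beta).

Let q01 : 0 <= q <= 1. Proof. by case: hA => _ /andP[-> /ltW]. Qed.
Let qk0 : 0 <= q ^+ k. Proof. by case/andP: q01 => *; apply: exprn_ge0. Qed.

Definition admissible B := tnorm B <= beta /\ gauge A l B.

Let cs_ge0' : 0 <= cs. Proof. exact: (cs_ge0 hA beta1). Qed.
Let coff_ge0' : 0 <= coff. Proof. exact: (window_coff_ge0 hA beta1). Qed.

Lemma cabs_expi (t : R) : cabs (expi t) = 1.
Proof.
apply/eqP; rewrite -(@eqrXn2 _ 2) ?cabs_ge0 // cabs_sqrE /= cos2Dsin2 expr1n.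
by [].
Qed.

Definition wave (J : {set 'I_n}) B (p : R) : state R n P :=
  \sum_(j in J) expi (p * j%:R) *: mps n (single A j B).

Lemma excitation_wave B p : excitation n A B p = wave [set: 'I_n]%SET B p.
Proof.
apply/ffunP => w; rewrite state_sum ffunE; apply: eq_big => j; first by rewrite inE.
move=> _; rewrite stateZ ffunE; congr (_ * \tr _).
by apply: eq_bigr => i _; rewrite /single val_eqE; case: ifP.
Qed.

Lemma wave_setU (J1 J2 : {set 'I_n}) B p : [disjoint J1 & J2] ->
  wave (J1 :|: J2) B p = wave J1 B p + wave J2 B p.
Proof.
by move=> dj; rewrite /wave -bigU //; apply: eq_bigl => j; rewrite !inE.
Qed.

Lemma snorm_wave J B p : admissible B -> snorm (wave J B p) <= #|J|%:R * cs.
Proof.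
move=> [hB _]; apply: le_trans (snorm_sum _ _ _) _.
apply: (@le_trans _ _ (\sum_(j in J) cs)); last by rewrite sumr_const mulr_natl.
by apply: ler_sum => j _; rewrite snormZ cabs_expi mul1r (snorm_single hA).
Qed.

Lemma wave_matrix_element J B B' p p' (F : op R n P) :
  inner (wave J B' p') (apply F (wave J B p)) =
  \sum_(j' in J) \sum_(j in J) ((expi (p' * j'%:R))^* * expi (p * j%:R)) *
     inner (mps n (single A j' B')) (apply F (mps n (single A j B))).
Proof.
rewrite apply_sum inner_suml; apply: eq_bigr => j' _.
rewrite inner_sumr; apply: eq_bigr => j _.
by rewrite applyZ innerZl innerZr mulrA.
Qed.

(** Each of the at most [n^2] pairs of distinct sites costs [coff * q ^+ k]. The window used lies to
    the left of the smaller site, which again belongs to [J], so assuming windows free for single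
    sites suffices. *)
Lemma wave_offdiag (J : {set 'I_n}) B B' p p' (S : {set 'I_n}) (F : op R n P) :
  admissible B -> admissible B' -> supported_on i0 S F -> opnorm_le1 F ->
  (forall j : 'I_n, j \in J -> (De <= j)%N /\
     forall s : 'I_n, s \in S -> ~~ (j - De <= s <= j)%N) ->
  cabs (inner (wave J B' p') (apply F (wave J B p)) -
    \sum_(j in J) ((expi (p' * j%:R))^* * expi (p * j%:R)) *
       inner (mps n (single A j B')) (apply F (mps n (single A j B))))
  <= n%:R ^+ 2 * (coff * q ^+ k).
Proof.
move=> [hB gB] [hB' gB'] sF opF hJ; rewrite wave_matrix_element -sumrB.
have cq0 : 0 <= coff * q ^+ k by apply: mulr_ge0.
have card_le (J0 : {set 'I_n}) (x : R) : 0 <= x -> \sum_(j in J0) x <= n%:R * x.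
  move=> x0; rewrite sumr_const -[x *+ _]mulr_natl ler_wpM2r // ler_nat.
  by rewrite -[X in (_ <= X)%N](card_ord n) max_card.
apply: le_trans (cabs_sum _ _ _) _.
apply: (@le_trans _ _ (\sum_(j' in J) n%:R * (coff * q ^+ k))); last first.
  by rewrite expr2 -mulrA card_le // mulr_ge0.
apply: ler_sum => j' j'J.
rewrite [X in X - _](bigD1 j') //= addrAC subrr add0r.
apply: le_trans (cabs_sum _ _ _) _.
apply: (@le_trans _ _ (\sum_(j in J) coff * q ^+ k)); last exact: card_le.
apply: (@le_trans _ _ (\sum_(j in J | j != j') coff * q ^+ k)); last first.
  rewrite [leRHS](bigID (fun j => j != j')) /= lerDl; apply: sumr_ge0 => *; exact: cq0.
apply: ler_sum => j /andP[jJ jj'].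
rewrite !cabsM cabs_conj !cabs_expi !mul1r.
apply: (single_offdiag (i0 := i0) hA beta1 Abeta) => //.
- by rewrite leq_min; have [-> _] := hJ _ jJ; have [-> _] := hJ _ j'J.
- have min_mem : exists2 j0 : 'I_n, j0 \in J & minn j j' = j0.
    by rewrite /minn; case: ifP => _; [exists j|exists j'].
  have [j0 j0J ->] := min_mem.
  apply: sF => s sS; by have [_ /(_ s sS)] := hJ _ j0J; rewrite /win ltnS.
Qed.

(** Distinct excitations are nearly orthogonal, by [wave_offdiag] for the identity with empty
    support. The norm therefore grows like the square root of the number of sites, not linearly as
    in [snorm_wave]. *)
Lemma snorm_wave_bulk (J : {set 'I_n}) B p (x : R) : admissible B ->
  (forall j : 'I_n, j \in J -> (De <= j)%N) -> n%:R ^+ 2 * q ^+ k <= x ->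
  snorm (wave J B p) <= Num.sqrt ((#|J|%:R + x) * (cs ^+ 2 + coff)).
Proof.
move=> hB hJ hx; have x0 : 0 <= x by apply: le_trans hx; rewrite mulr_ge0 ?sqr_ge0.
apply: snorm_le_inner; first exact: sqrtr_ge0.
rewrite sqr_sqrtr; last by rewrite mulr_ge0 ?addr_ge0 ?sqr_ge0.
pose X := \sum_(j in J) ((expi (p * j%:R))^* * expi (p * j%:R)) *
       inner (mps n (single A j B)) (apply (@idop R n P) (mps n (single A j B))).
have h : cabs (inner (wave J B p) (wave J B p) - X) <= n%:R ^+ 2 * (coff * q ^+ k).
  rewrite -{2}(apply_id (wave J B p)).
  apply: (wave_offdiag p p hB hB (@idop_supported R P n i0) (@opnorm_id R n P)).
  by move=> j jJ; split=> [|s]; [apply: hJ|rewrite inE].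
have hX : cabs X <= #|J|%:R * cs ^+ 2.
  apply: le_trans (cabs_sum _ _ _) _.
  rewrite mulr_natl -sumr_const; apply: ler_sum => j _.
  rewrite cabsM cabsM cabs_conj !cabs_expi !mul1r apply_id.
  apply: le_trans (cabs_inner _ _) _; rewrite expr2.
  by case: hB => hB _; apply: ler_pM; rewrite ?snorm_ge0 // (snorm_single hA).
rewrite -[inner _ _](subrK X); apply: le_trans (cabsD _ _) _.
have h3 : n%:R ^+ 2 * (coff * q ^+ k) <= x * coff.
  by rewrite mulrCA mulrC ler_wpM2r.
have h4 : 0 <= x * cs ^+ 2 by rewrite mulr_ge0 ?sqr_ge0.
have h5 : 0 <= #|J|%:R * coff by rewrite mulr_ge0.
move: h hX h3 h4 h5; rewrite mulrDl !mulrDr; lra.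
Qed.

End ExcitationEstimates.

Lemma interval_sym (j s d : nat) :
  (j - d <= s <= j + d)%N -> (s - d <= j < s - d + (d + d).+1)%N.
Proof. lia. Qed.

(** * Matrix elements between full plane waves *)

Section MatrixElements.
Context {R : realType} {P D : nat}.
Local Notation Mx := 'M[R[i]]_D.+1.
Implicit Types (B : 'I_P -> 'M[R[i]]_D.+1).
Context (i0 : 'I_P) (A : 'I_P -> Mx) (m : nat) (q c e : R) (r : Mx) (l : Mx -> R[i]).
Hypothesis hA : mixing A m q c e r l.
Context (beta : R).
Hypothesis beta1 : 1 <= beta.
Hypothesis Abeta : tnorm A <= beta.
Context (n k : nat).
Local Notation De := (k * m)%N.
Local Notation cs := (@cs R D c beta).
Local Notation coff := (@coff R D c beta).
Local Notation cdiag := (@cdiag R D c r beta).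
Local Notation N := (n%:R : R).

Let cs0' : 0 <= cs. Proof. exact: (cs_ge0 hA beta1). Qed.
Let coff0' : 0 <= coff. Proof. exact: (window_coff_ge0 hA beta1). Qed.
Let qk0 : 0 <= q ^+ k. Proof. by case: hA => _ /andP[q0 _] *; apply: exprn_ge0. Qed.
Let cdiag0' : 0 <= cdiag.
Proof.
have c0 : 0 <= c by case: hA => _ _ /(le_trans ler01).
have b0 : 0 <= beta by apply: le_trans beta1.
have h : 0 <= 1 + mnorm r + c * mnorm r by rewrite !addr_ge0 ?mulr_ge0 ?mnorm_ge0.
by rewrite /cdiag /cdiag0 !mulr_ge0 ?exprn_ge0.
Qed.
Let c0 : 0 <= c. Proof. by case: hA => _ _ /(le_trans ler01). Qed.

(* Keeping the excitation away from both ends makes every window an interval,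
   so that the cyclic structure of the trace never intervenes. *)
Definition edge : {set 'I_n} := [set j : 'I_n | (j < De)%N || (n - De <= j)%N]%SET.
Definition near (S : {set 'I_n}) : {set 'I_n} :=
  (\bigcup_(s in S) [set j : 'I_n | (s - De <= j < s - De + (De + De).+1)%N])%SET.
Definition far (S : {set 'I_n}) : {set 'I_n} := (~: (edge :|: near S))%SET.

Lemma card_edge : (#|edge| <= De + De)%N.
Proof.
apply: (@leq_trans #|([set j : 'I_n | (0 <= j < 0 + De)%N] :|:
   [set j : 'I_n | (n - De <= j < n - De + De)%N])%SET|).
  apply: subset_leq_card; apply/fintype.subsetP => j; rewrite !inE add0n /=.
  case/orP => [->//|h]; apply/orP; right; rewrite h /=.
  by apply: leq_trans (ltn_ord j) _; rewrite addnC -leq_subLR.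
by apply: leq_trans (leq_card_setU _ _) _; apply: leq_add; apply: card_interval.
Qed.

Lemma card_near S : (#|near S| <= #|S| * (De + De).+1)%N.
Proof.
rewrite /near -sum_nat_const.
elim/big_rec2: _ => [|s x y _ h]; first by rewrite cards0.
by apply: leq_trans (leq_card_setU _ _) _; apply: leq_add => //; apply: card_interval.
Qed.

Lemma far_edge S j : j \in far S -> (De <= j)%N /\ (j + De < n)%N.
Proof.
rewrite !inE negb_or => /andP[]; rewrite negb_or -leqNgt -ltnNge => /andP[h1 h2] _.
by split=> //; rewrite addnC -ltn_subRL.
Qed.

Lemma far_near S j s : j \in far S -> s \in S -> ~~ (j - De <= s <= j + De)%N.
Proof.
rewrite !inE negb_or => /andP[_] jn sS; apply: contra jn => h.
apply/finset.bigcupP; exists s => //; rewrite inE.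
exact: interval_sym.
Qed.

Definition phase_sum (p' p : R) : R[i] := \sum_(j < n) (expi (p' * j%:R))^* * expi (p * j%:R).

(** The terms bound, in order, the cross terms with the sites left out ([12 = 8 + 4]), the window
    errors at the far sites, and the phases that the left-out sites miss in [phase_sum]
    ([5 = 2 + 3], from [edge] and [near S]). *)
Definition cmain (x : R) : R :=
  12 * x ^+ 2 * (cs + Num.sqrt (cs ^+ 2 + coff)) ^+ 2 + x ^+ 2 * (coff + cdiag)
  + 5 * x * (c * (beta ^+ 2 * mnorm r)) * cs ^+ 2.

Lemma cmain_ge0 (x : R) : 0 <= x -> 0 <= cmain x.
Proof.
move=> x0; have W0 : 0 <= cs + Num.sqrt (cs ^+ 2 + coff) by rewrite addr_ge0 ?sqrtr_ge0.
have t1 : 0 <= 12 * x ^+ 2 * (cs + Num.sqrt (cs ^+ 2 + coff)) ^+ 2.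
  by apply: mulr_ge0 (sqr_ge0 _); apply: mulr_ge0 (sqr_ge0 _).
have t2 : 0 <= x ^+ 2 * (coff + cdiag).
  by apply: mulr_ge0 (sqr_ge0 _) _; apply: addr_ge0.
have t3 : 0 <= 5 * x * (c * (beta ^+ 2 * mnorm r)) * cs ^+ 2.
  apply: mulr_ge0 (sqr_ge0 _); apply: mulr_ge0; first exact: mulr_ge0.
  by apply: mulr_ge0 => //; apply: mulr_ge0 (sqr_ge0 _) (mnorm_ge0 _).
by rewrite /cmain; apply: addr_ge0 t3; apply: addr_ge0.
Qed.

(** Here [s] is the square root of [n] and [g] the relative error. The bound on [De] handles the
    ends through the triangle inequality, the bound on the product of [#|S|] and [De] handles the
    neighbourhood of the support through the square-root estimate, and the last one makes the sum of
    all window errors bounded. *)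
Lemma excitation_matrix_element (S : {set 'I_n}) (F : op R n P) B B' p p' (x g s : R) :
  admissible A l beta B -> admissible A l beta B' ->
  supported_on i0 S F -> opnorm_le1 F ->
  (0 < #|S|)%N -> (0 < De)%N -> 1 <= x -> 0 <= g <= 1 -> 0 <= s -> s ^+ 2 = N ->
  De%:R <= x * s * g -> #|S|%:R * De%:R <= x * (N * g ^+ 2) -> N ^+ 2 * q ^+ k <= x ->
  cabs (inner (excitation n A B' p') (apply F (excitation n A B p)) -
     phase_sum p' p * (overlap r l B' B *
       inner (mps n (fun=> A)) (apply F (mps n (fun=> A)))))
  <= cmain x * (N * g).
Proof.
move=> aB aB' sF opF S0 De0 x1 /andP[g0 g1] s0 sN hDe hd hq.
have x0 : 0 <= x by apply: le_trans x1.
have n0 : (0 < n)%N.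
  by rewrite -[n]card_ord; apply: leq_trans S0 (max_card _).
have N1 : 1 <= N by rewrite ler1n.
have N0 : 0 <= N by [].
have dDe1 : 1 <= #|S|%:R * De%:R :> R by rewrite -natrM ler1n muln_gt0 S0.
have Ded : De%:R <= #|S|%:R * De%:R :> R by rewrite -natrM ler_nat leq_pmull.
have dd : #|S|%:R <= #|S|%:R * De%:R :> R by rewrite -natrM ler_nat leq_pmulr.
set dD : R := #|S|%:R * De%:R in dDe1 Ded dd hd.
have t_le : N * g ^+ 2 <= N * g by rewrite expr2 mulrA ler_piMr // mulr_ge0.
have cE : #|edge|%:R <= 2 * De%:R :> R.
  have := card_edge; rewrite -(ler_nat R) natrD; lra.
have cN : #|near S|%:R <= 3 * dD.
  have := card_near S; rewrite -(ler_nat R) natrM -[(De + De).+1]addn1 !natrD.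
  by rewrite !mulrDr mulr1 -/dD; move: dd; lra.
set K := cs ^+ 2 + coff; set W := cs + Num.sqrt K.
have K0 : 0 <= K by rewrite addr_ge0 ?sqr_ge0.
have W0 : 0 <= W by rewrite addr_ge0 ?sqrtr_ge0.
have sK : Num.sqrt K <= W by rewrite lerDr.
have csW : cs <= W by rewrite lerDl sqrtr_ge0.
have sg0 : 0 <= s * g by rewrite mulr_ge0.
have xsg0 : 0 <= 2 * x * (s * g) by rewrite !mulr_ge0.
have xs0 : 0 <= 2 * x * s by rewrite !mulr_ge0.
(* Removing [edge] from [near S] matters: the square-root estimate requires a full window to the
   left of every site. *)
pose rest : {set 'I_n} := (edge :|: (near S :\: edge))%SET.
have restE : rest = (~: far S)%SET.
  by rewrite /rest /far finset.setCK; apply/setP => j; rewrite !inE; case: (j < De)%N; case: (n - De <= j)%N.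
have nrm_edge B1 p1 : admissible A l beta B1 ->
    snorm (wave A edge B1 p1) <= 2 * x * (s * g) * cs.
  move=> aB1; apply: le_trans (snorm_wave hA beta1 Abeta _ p1 aB1) _.
  rewrite ler_wpM2r //; apply: le_trans cE _.
  by rewrite -!mulrA ler_pM2l // mulrA.
have nrm_near B1 p1 : admissible A l beta B1 ->
    snorm (wave A (near S :\: edge)%SET B1 p1) <= 2 * x * (s * g) * Num.sqrt K.
  move=> aB1.
  have hJ (j : 'I_n) : j \in (near S :\: edge)%SET -> (De <= j)%N.
    by rewrite finset.in_setD => /andP[]; rewrite inE negb_or -leqNgt => /andP[].
  apply: le_trans (snorm_wave_bulk i0 hA beta1 Abeta p1 aB1 hJ hq) _.
  rewrite -/K sqrtrM; last by rewrite addr_ge0.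
  rewrite ler_wpM2r ?sqrtr_ge0 // -(ger0_norm xsg0) -sqrtr_sqr ler_wsqrtr //.
  have cND : #|(near S :\: edge)%SET|%:R <= 3 * dD.
    by apply: le_trans cN; rewrite ler_nat subset_leq_card // finset.subsetDl.
  have -> : (2 * x * (s * g)) ^+ 2 = 4 * x ^+ 2 * (N * g ^+ 2) by rewrite -sN; ring.
  have h1 : 1 <= x * (N * g ^+ 2) by apply: le_trans hd.
  have h2 : x <= x * (x * (N * g ^+ 2)) by rewrite ler_peMr.
  have h3 : x * (N * g ^+ 2) <= x * (x * (N * g ^+ 2)).
    by rewrite ler_peMl // (le_trans _ h1).
  rewrite (_ : 4 * x ^+ 2 * (N * g ^+ 2) = 4 * (x * (x * (N * g ^+ 2)))); last by ring.
  by move: cND hd h2 h3; lra.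
have nrm_far B1 p1 : admissible A l beta B1 ->
    snorm (wave A (far S) B1 p1) <= 2 * x * s * W.
  move=> aB1.
  have hJ (j : 'I_n) : j \in far S -> (De <= j)%N by move=> /far_edge[].
  apply: le_trans (snorm_wave_bulk i0 hA beta1 Abeta p1 aB1 hJ hq) _.
  rewrite -/K sqrtrM; last by rewrite addr_ge0.
  apply: ler_pM; rewrite ?sqrtr_ge0 //.
  rewrite -(ger0_norm xs0) -sqrtr_sqr ler_wsqrtr //.
  have cF : #|far S|%:R <= N by rewrite ler_nat -[X in (_ <= X)%N]card_ord max_card.
  have -> : (2 * x * s) ^+ 2 = 4 * (x * (x * N)) by rewrite -sN; ring.
  have h1 : x <= x * (x * N) by rewrite ler_peMr // mulr_ege1.
  have h2 : N <= x * (x * N) by rewrite mulrA ler_peMl // mulr_ege1.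
  by move: cF h1 h2; lra.
have nrm_rest B1 p1 : admissible A l beta B1 ->
    snorm (wave A rest B1 p1) <= 2 * x * (s * g) * W.
  move=> aB1; rewrite /rest wave_setU; last first.
    by rewrite -setI_eq0; apply/eqP/setP => j; rewrite !inE; case: (j < De)%N; case: (n - De <= j)%N.
  apply: le_trans (snormD _ _) _; rewrite mulrDr.
  by apply: lerD; [apply: nrm_edge|apply: nrm_near].
have split_wave B1 p1 : excitation n A B1 p1 = wave A (far S) B1 p1 + wave A rest B1 p1.
  rewrite excitation_wave -wave_setU ?restE ?finset.setUCr //.
  by rewrite -setI_eq0 finset.setICr.
have nrm_all B1 p1 : admissible A l beta B1 ->
    snorm (excitation n A B1 p1) <= 2 * (2 * x * s * W).
  move=> aB1; rewrite split_wave; apply: le_trans (snormD _ _) _.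
  have h1 := nrm_far _ p1 aB1; have h2 := nrm_rest _ p1 aB1.
  have h3 : 2 * x * (s * g) * W <= 2 * x * s * W.
    by rewrite mulrA ler_wpM2r // ler_piMr.
  by move: h1 h2 h3; lra.
pose U := wave A (far S) B p; pose U' := wave A (far S) B' p'.
pose V := wave A rest B p; pose V' := wave A rest B' p'.
pose Phi := excitation n A B p; pose Phi' := excitation n A B' p'.
pose ph (j : 'I_n) := (expi (p' * j%:R))^* * expi (p * j%:R) : R[i].
have cph j : cabs (ph j) = 1 by rewrite /ph cabsM cabs_conj !cabs_expi mulr1.
pose G (j : 'I_n) := inner (mps n (single A j B')) (apply F (mps n (single A j B))).
pose f := inner (mps n (fun=> A)) (apply F (mps n (fun=> A))).
pose z := overlap r l B' B.
have cross : cabs (inner Phi' (apply F Phi) - inner U' (apply F U)) <=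
    12 * x ^+ 2 * W ^+ 2 * (N * g).
  have -> : inner Phi' (apply F Phi) - inner U' (apply F U) =
     inner V' (apply F Phi) + inner U' (apply F V).
    rewrite /Phi' split_wave -/U' -/V' innerDl {1}/Phi split_wave -/U -/V applyD innerDr.
    by rewrite addrAC [X in X - _]addrC addrK addrC.
  apply: le_trans (cabsD _ _) _.
  have h1 : cabs (inner V' (apply F Phi)) <= 2 * x * (s * g) * W * (2 * (2 * x * s * W)).
    apply: le_trans (cabs_inner_apply _ _ opF) _.
    by apply: ler_pM; rewrite ?snorm_ge0 ?nrm_rest ?nrm_all.
  have h2 : cabs (inner U' (apply F V)) <= 2 * x * s * W * (2 * x * (s * g) * W).
    apply: le_trans (cabs_inner_apply _ _ opF) _.
    by apply: ler_pM; rewrite ?snorm_ge0 ?nrm_rest ?nrm_far.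
  apply: le_trans (lerD h1 h2) _.
  by rewrite -sN le_eqVlt; apply/orP; left; apply/eqP; ring.
have offd : cabs (inner U' (apply F U) - \sum_(j in far S) ph j * G j) <= x * coff.
  apply: le_trans (wave_offdiag (k := k) hA beta1 Abeta p p' aB aB' sF opF _) _.
    move=> j jf; have [h1 h2] := far_edge jf; split=> // s1 s1S.
    have := far_near jf s1S; apply: contra => /andP[-> h3] /=.
    by apply: leq_trans h3 (leq_addr _ _).
  by rewrite mulrCA mulrC ler_wpM2r.
have diag : cabs (\sum_(j in far S) ph j * G j - (\sum_(j in far S) ph j) * (z * f)) <= x * cdiag.
  rewrite mulr_suml -sumrB; apply: le_trans (cabs_sum _ _ _) _.
  have cd j : j \in far S -> cabs (ph j * G j - ph j * (z * f)) <= cdiag * q ^+ k.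
    move=> jf; have [h1 h2] := far_edge jf; rewrite -mulrBr cabsM cph mul1r.
    case: aB aB' => hB _ [hB' _].
    apply: (single_diag (k := k) (i0 := i0) hA beta1 Abeta h1 h2 hB hB' _ opF).
    by apply: sF => s1 s1S; have := far_near jf s1S; rewrite /win ltnS.
  apply: le_trans (ler_sum _ cd) _; rewrite sumr_const -[_ *+ _]mulr_natl.
  have cF : #|far S|%:R <= N by rewrite ler_nat -[X in (_ <= X)%N]card_ord max_card.
  have h1 : N * q ^+ k <= x.
    by apply: le_trans hq; rewrite ler_wpM2r // expr2 ler_peMl.
  have h2 := ler_wpM2r (mulr_ge0 cdiag0' qk0) cF.
  have h3 := ler_wpM2l cdiag0' h1.
  by apply: le_trans h2 _; rewrite mulrCA mulrC [x * _]mulrC [_ * cdiag]mulrC.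
have zf : cabs (z * f) <= c * (beta ^+ 2 * mnorm r) * cs ^+ 2.
  rewrite cabsM; apply: ler_pM; rewrite ?cabs_ge0 //.
    by case: aB aB' => hB _ [hB' _]; exact: (cabs_overlap hA).
  apply: le_trans (cabs_inner_apply _ _ opF) _; rewrite expr2.
  have -> : mps n (fun=> A) = mps n (single A 0%N A).
    by congr mps; apply/funext => a; rewrite /single; case: ifP.
  by apply: ler_pM; rewrite ?snorm_ge0 // (snorm_single hA beta1 Abeta).
have fin : cabs ((\sum_(j in far S) ph j) * (z * f) - phase_sum p' p * (z * f)) <=
    5 * x * (c * (beta ^+ 2 * mnorm r)) * cs ^+ 2 * (N * g).
  rewrite -mulrBl cabsM.
  have h1 : cabs ((\sum_(j in far S) ph j) - phase_sum p' p) <= 5 * x * (N * g).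
    rewrite cabsC /phase_sum (bigID (fun j => j \in far S)) /= addrC addrK.
    apply: le_trans (cabs_sum _ _ _) _; under eq_bigr => j _ do rewrite cph.
    have -> : \sum_(j < n | j \notin far S) (1 : R) = #|edge :|: near S|%:R.
      rewrite -[in RHS](finset.setCK (edge :|: near S)%SET) -/(far S) -sum1_card natr_sum.
      by apply: eq_bigl => j; rewrite [in RHS]inE.
    have h : #|(edge :|: near S)%SET|%:R <= #|edge|%:R + #|near S|%:R :> R.
      by rewrite -natrD ler_nat leq_card_setU.
    have h2 := ler_wpM2l x0 t_le.
    by rewrite -mulrA; move: h cE cN Ded hd h2; lra.
  apply: le_trans (ler_pM (cabs_ge0 _) (cabs_ge0 _) h1 zf) _.
  by rewrite le_eqVlt; apply/orP; left; apply/eqP; ring.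
have xN : x <= x ^+ 2 * (N * g).
  have h1 : 1 <= x * (N * g ^+ 2) by apply: le_trans hd.
  have h2 : x <= x * (x * (N * g ^+ 2)) by rewrite ler_peMr.
  apply: le_trans h2 _; rewrite expr2 -mulrA ler_wpM2l // ler_wpM2l //.
rewrite -/Phi -/Phi' -/z -/f.
have -> : inner Phi' (apply F Phi) - phase_sum p' p * (z * f) =
   (inner Phi' (apply F Phi) - inner U' (apply F U)) +
   (inner U' (apply F U) - \sum_(j in far S) ph j * G j) +
   (\sum_(j in far S) ph j * G j - (\sum_(j in far S) ph j) * (z * f)) +
   ((\sum_(j in far S) ph j) * (z * f) - phase_sum p' p * (z * f)).
  by rewrite !addrA !subrK.
apply: le_trans (cabsD _ _) _; apply: le_trans (lerD (cabsD _ _) fin) _.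
apply: le_trans (lerD (lerD (cabsD _ _) (lexx _)) (lexx _)) _.
apply: le_trans (lerD (lerD (lerD cross offd) diag) (lexx _)) _.
have hoff := ler_wpM2r coff0' xN; have hdg := ler_wpM2r cdiag0' xN.
rewrite /cmain -/K -/W.
rewrite (_ : (12 * x ^+ 2 * W ^+ 2 + x ^+ 2 * (coff + cdiag) +
   5 * x * (c * (beta ^+ 2 * mnorm r)) * cs ^+ 2) * (N * g) =
   12 * x ^+ 2 * W ^+ 2 * (N * g) + (x ^+ 2 * (N * g) * coff + x ^+ 2 * (N * g) * cdiag)
   + 5 * x * (c * (beta ^+ 2 * mnorm r)) * cs ^+ 2 * (N * g)); last by ring.
by rewrite lerD2r -addrA lerD2l lerD.
Qed.

End MatrixElements.

(** * Error detection from nearly scalar matrix elements *)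

Section Detection.
Context {R : realType} {n P : nat}.
Local Notation state := (state R n P).
Implicit Types (u v psi phi : state) (F G : op R n P).

Lemma apply_mulop F G v : apply (mulop F G) v = apply F (apply G v).
Proof.
apply/ffunP => w; rewrite !applyE /mulop.
transitivity (\sum_w' \sum_u F w u * (G u w' * v w') : R[i]).
  by apply: eq_bigr => w' _; rewrite mulr_suml; apply: eq_bigr => u _; rewrite mulrA.
rewrite exchange_big; apply: eq_bigr => u _ /=.
by rewrite applyE mulr_sumr.
Qed.

Lemma inner_adjop F u v : inner (apply F u) v = inner u (apply (adjop F) v).
Proof.
transitivity (\sum_w \sum_w' (F w w' * u w')^* * v w : R[i]).
  by apply: eq_bigr => w _; rewrite applyE rmorph_sum mulr_suml.
rewrite exchange_big; apply: eq_bigr => w _; rewrite applyE mulr_sumr.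
by apply: eq_bigr => w' _; rewrite rmorphM /adjop /=; ring.
Qed.

Lemma apply_outer u v : apply (outer u) v = inner u v *: u.
Proof.
apply/ffunP => w; rewrite applyE stateZ mulr_suml; apply: eq_bigr => w' _.
by rewrite /outer; ring.
Qed.

Lemma conjugate_outer F u w w' :
  mulop (mulop F (outer u)) (adjop F) w w' = outer (apply F u) w w'.
Proof.
rewrite /outer !applyE rmorph_sum mulr_sumr; apply: eq_bigr => v _.
rewrite /mulop /adjop rmorphM /= mulr_suml mulr_suml; apply: eq_bigr => v' _.
by ring.
Qed.

Lemma trop_outer F u : trop (mulop F (outer u)) = inner u (apply F u).
Proof.
apply: eq_bigr => w _; rewrite applyE mulr_sumr; apply: eq_bigr => w' _.
by rewrite /outer; ring.
Qed.

Lemma eq_apply F G v : (forall w w', F w w' = G w w') -> apply F v = apply G v.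
Proof.
by move=> h; apply/ffunP => w; rewrite !applyE; apply: eq_bigr => w' _; rewrite h.
Qed.

Section Projection.
Context (V : {vspace state}) (Pr : op R n P).
Hypothesis hPr : is_projection Pr V.

Let PrPr v : apply Pr (apply Pr v) = apply Pr v.
Proof. by rewrite -apply_mulop; apply: eq_apply; case: hPr. Qed.

Lemma projection_adj u v : inner (apply Pr u) v = inner u (apply Pr v).
Proof. by rewrite inner_adjop; congr inner; apply: eq_apply; case: hPr. Qed.

Let Pr_in v : apply Pr v \in V. Proof. by case: hPr. Qed.
Let Pr_id v : v \in V -> apply Pr v = v. Proof. by case: hPr => _ _ _; apply. Qed.

(** [phi] is the part of [P F psi] orthogonal to [psi]. Testing the hypothesis on [phi] itself gives
    [snorm phi ^+ 2 <= eta * snorm phi], and Pythagoras concludes. *)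
Lemma projection_deviation psi F (eta : R) : psi \in V -> inner psi psi = 1 ->
  (forall phi, phi \in V -> inner phi psi = 0 ->
     cabs (inner phi (apply F psi)) <= eta * snorm phi) ->
  snorm (apply Pr (apply F psi)) ^+ 2 <= cabs (inner psi (apply F psi)) ^+ 2 + eta ^+ 2.
Proof.
move=> psiV psi1 hF; set v := apply F psi; set z := inner psi v.
pose phi := apply Pr v - z *: psi.
have phiV : phi \in V by rewrite memvB ?memvZ.
have psiPv : inner psi (apply Pr v) = z by rewrite -projection_adj Pr_id.
have orth' : inner psi phi = 0 by rewrite innerBr innerZr psi1 mulr1 psiPv subrr.
have orth : inner phi psi = 0 by rewrite -inner_conj orth' rmorph0.
have e1 : inner phi phi = inner phi v.
  rewrite {2}/phi innerBr innerZr orth mulr0 subr0 -projection_adj.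
  by rewrite Pr_id.
have phi_le : snorm phi ^+ 2 <= eta ^+ 2.
  have h := hF _ phiV orth; rewrite -/v -e1 inner_self cabs_rC ?sqr_ge0 // in h.
  have [p0|p0] := eqVneq (snorm phi) 0; first by rewrite p0 expr0n sqr_ge0.
  have pp : 0 < snorm phi by rewrite lt_neqAle eq_sym p0 snorm_ge0.
  have {}h : snorm phi <= eta by rewrite -(ler_pM2r pp) -expr2.
  by rewrite ler_pXn2r // nnegrE ?snorm_ge0 // (le_trans _ h) ?snorm_ge0.
have e2 : apply Pr v = phi + z *: psi by rewrite subrK.
clearbody phi.
have e3 : inner (apply Pr v) (apply Pr v) = inner phi phi + rC (cabs z ^+ 2).
  rewrite e2 innerDl !innerDr !innerZl !innerZr orth orth' psi1 cabs_sqr.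
  by ring.
have {}e3 : snorm (apply Pr v) ^+ 2 = snorm phi ^+ 2 + cabs z ^+ 2.
  by apply: rC_inj; rewrite rCD -!inner_self.
by rewrite e3 addrC lerD2l.
Qed.

Lemma projection_norm v : inner v (apply Pr v) = rC (snorm (apply Pr v) ^+ 2).
Proof. by rewrite -inner_self projection_adj PrPr. Qed.

End Projection.

(** The acceptance probability is the mean of the [a j] and the fidelity is the mean of the [b j]
    divided by it. Since [a j <= b j + eta ^+ 2], the infidelity is at most [eta ^+ 2 / t], and
    [t >= delta]. *)
Lemma approx_detection (V : {vspace state}) (eps delta eta : R)
    (m : nat) (pr : 'I_m -> R) (Fs : 'I_m -> op R n P) :
  0 < delta -> eta ^+ 2 <= eps * delta ->
  (forall j, 0 <= pr j) -> \sum_(j < m) pr j = 1 ->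
  (forall j psi phi, psi \in V -> phi \in V -> inner psi psi = 1 -> inner phi psi = 0 ->
     cabs (inner phi (apply (Fs j) psi)) <= eta * snorm phi) ->
  approx_detection_code eps delta V (channel pr Fs).
Proof.
move=> d0 heta pr0 pr1 hF Pr hPr psi psiV psi1; set N := channel pr Fs (outer psi).
pose a j := snorm (apply Pr (apply (Fs j) psi)) ^+ 2.
pose b j := cabs (inner psi (apply (Fs j) psi)) ^+ 2.
have tE : trop (mulop Pr N) = rC (\sum_j pr j * a j).
  rewrite rC_sum; transitivity (\sum_j rC (pr j) * trop (mulop Pr (outer (apply (Fs j) psi)))).
    rewrite /trop /mulop; under [RHS]eq_bigr => j _ do rewrite mulr_sumr.
    rewrite [RHS]exchange_big; apply: eq_bigr => w _ /=.
    under [RHS]eq_bigr => j _ do rewrite mulr_sumr.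
    rewrite [RHS]exchange_big; apply: eq_bigr => u _ /=.
    rewrite /N /channel mulr_sumr; apply: eq_bigr => j _.
    by rewrite conjugate_outer; ring.
  by apply: eq_bigr => j _; rewrite trop_outer (projection_norm hPr) rCM.
move=> t ht.
pose rho : op R n P := fun w w' => t^-1 * mulop (mulop Pr N) Pr w w'.
change (is_true (rC (1 - eps) <= inner psi (apply rho psi))).
have tE' : t = rC (\sum_j pr j * a j) by rewrite -tE.
have dt : delta <= \sum_j pr j * a j by move: ht; rewrite tE' lecR.
have t0 : 0 < \sum_j pr j * a j by apply: lt_le_trans dt.
have fid : inner psi (apply rho psi) = rC ((\sum_j pr j * a j)^-1 * \sum_j pr j * b j).
  have -> : apply rho psi = t^-1 *: apply (mulop (mulop Pr N) Pr) psi.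
    apply/ffunP => w; rewrite stateZ !applyE mulr_sumr; apply: eq_bigr => w' _.
    by rewrite /rho mulrA.
  have [_ _ _ Pid] := hPr.
  rewrite innerZr !apply_mulop (Pid psi psiV) tE' rCM rCV; congr (_ * _).
  have -> : inner psi (apply Pr (apply N psi)) = inner psi (apply N psi).
    by rewrite -(projection_adj hPr) (Pid psi psiV).
  have -> : apply N psi = \sum_j rC (pr j) *: (inner (apply (Fs j) psi) psi *: apply (Fs j) psi).
    apply/ffunP => w; rewrite state_sum applyE.
    transitivity (\sum_w' \sum_j rC (pr j) * (outer (apply (Fs j) psi) w w' * psi w') : R[i]).
      apply: eq_bigr => w' _; rewrite /N /channel mulr_suml; apply: eq_bigr => j _.
      by rewrite conjugate_outer mulrA.
    rewrite exchange_big; apply: eq_bigr => j _ /=.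
    by rewrite stateZ -apply_outer applyE mulr_sumr.
  rewrite inner_sumr rC_sum; apply: eq_bigr => j _.
  by rewrite !innerZr rCM cabs_sqr inner_conj.
rewrite fid lecR mulrC ler_pdivlMr //.
have hab j : a j <= b j + eta ^+ 2.
  by apply: (projection_deviation hPr) => // phi phiV orth; apply: hF.
have h : \sum_j pr j * a j <= \sum_j pr j * b j + eta ^+ 2.
  rewrite -[eta ^+ 2]mul1r -pr1 mulr_suml -big_split /=; apply: ler_sum => j _.
  by rewrite -mulrDr ler_wpM2l.
have heps : eta ^+ 2 <= eps * \sum_j pr j * a j.
  apply: (le_trans heta); rewrite ler_wpM2l //.
  by rewrite -(pmulr_lge0 _ d0); apply: (le_trans _ heta); apply: sqr_ge0.
move: h heps; rewrite mulrBl mul1r; lra.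
Qed.

End Detection.

(** * Codes spanned by nearly orthogonal vectors *)

Section NearlyOrthogonalCode.
Context {R : realType} {n P M : nat}.
Local Notation state := (state R n P).
Context (Phi : 'I_M -> state) (N g cf : R).
Hypothesis N0 : 0 < N.
Hypothesis g0 : 0 <= g.
Hypothesis cf0 : 0 <= cf.
Hypothesis Mg : M%:R * g <= 4^-1.

(** An approximate Knill-Laflamme condition for unnormalized vectors, whose squared norms are of
    order [N]. *)
Definition near_scalar (F : op R n P) (f : R[i]) :=
  forall i j, cabs (inner (Phi i) (apply F (Phi j)) - (i == j)%:R * (rC N * f)) <= N * g.

Definition comb (x : 'I_M -> R[i]) : state := \sum_i x i *: Phi i.
Definition vnorm (x : 'I_M -> R[i]) : R := Num.sqrt (\sum_i cabs (x i) ^+ 2).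
Definition vdot (x y : 'I_M -> R[i]) : R[i] := \sum_i (x i)^* * y i.

Lemma vnorm_ge0 x : 0 <= vnorm x. Proof. exact: sqrtr_ge0. Qed.

Lemma vnorm_sqr x : vnorm x ^+ 2 = \sum_i cabs (x i) ^+ 2.
Proof. by rewrite sqr_sqrtr // sumr_ge0 // => i _; apply: sqr_ge0. Qed.

Lemma vdot_self x : vdot x x = rC (vnorm x ^+ 2).
Proof. by rewrite vnorm_sqr rC_sum; apply: eq_bigr => i _; rewrite cabs_sqr. Qed.

Lemma sum_cabs_vnorm x : \sum_i cabs (x i) <= Num.sqrt M%:R * vnorm x.
Proof.
have := cauchy_schwarz_sum (a := fun=> 1) (b := fun i => cabs (x i)) (fun=> ler01)
  (fun i => cabs_ge0 (x i)).
under eq_bigr => i _ do rewrite mul1r.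
by under [X in Num.sqrt X * _]eq_bigr => i _ do rewrite expr1n;
   rewrite sumr_const card_ord.
Qed.

(** The entrywise error is summed against the absolute values of the coefficients. Passing from
    their sum to the Euclidean norm costs the square root of [M] on each side, hence the factor
    [M]. *)
Lemma comb_matrix_element F f x y : near_scalar F f ->
  cabs (inner (comb x) (apply F (comb y)) - rC N * f * vdot x y)
  <= N * g * M%:R * (vnorm x * vnorm y).
Proof.
move=> hF.
have -> : inner (comb x) (apply F (comb y)) - rC N * f * vdot x y =
    \sum_i \sum_j (x i)^* * y j *
      (inner (Phi i) (apply F (Phi j)) - (i == j)%:R * (rC N * f)).
  rewrite apply_sum inner_suml mulr_sumr -sumrB; apply: eq_bigr => i _.
  rewrite inner_sumr.
  have -> : rC N * f * ((x i)^* * y i) =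
      \sum_j (x i)^* * y j * ((i == j)%:R * (rC N * f)).
    rewrite (bigD1 i) //= eqxx mul1r big1 => [|j]; first by rewrite addr0 mulrC.
    by rewrite eq_sym => /negPf ->; rewrite mul0r mulr0.
  rewrite -sumrB; apply: eq_bigr => j _.
  by rewrite applyZ innerZl innerZr [X in X - _]mulrA -mulrBr.
apply: le_trans (cabs_sum _ _ _) _.
apply: (@le_trans _ _ (\sum_i \sum_j (cabs (x i) * cabs (y j)) * (N * g))).
  apply: ler_sum => i _; apply: le_trans (cabs_sum _ _ _) _; apply: ler_sum => j _.
  by rewrite !cabsM cabs_conj ler_wpM2l // mulr_ge0 ?cabs_ge0.
under eq_bigr => i _ do rewrite -mulr_suml -mulr_sumr.
rewrite -mulr_suml -mulr_suml mulrC -!mulrA ler_wpM2l ?(ltW N0) // ler_wpM2l //.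
have h0 (z : 'I_M -> R[i]) : 0 <= \sum_i cabs (z i) by apply: sumr_ge0 => i _; apply: cabs_ge0.
apply: le_trans (ler_pM (h0 x) (h0 y) (sum_cabs_vnorm x) (sum_cabs_vnorm y)) _.
rewrite mulrACA -expr2 sqr_sqrtr ?ler0n //.
Qed.

Context (f1 : R[i]).
Hypothesis hid : near_scalar (@idop R n P) f1.
Hypothesis hf1 : cabs (f1 - 1) <= 4^-1.

(** The real part of [f1] is at least 3/4 and the error takes away at most 1/4, so the Gram form
    keeps half of [N]. This also yields linear independence. *)
Lemma comb_lower x : N * vnorm x ^+ 2 <= 2 * snorm (comb x) ^+ 2.
Proof.
have := comb_matrix_element x x hid; rewrite apply_id inner_self vdot_self => h.
have {}h := le_trans (Re_le_cabs _) h.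
have hR : complex.Re (rC (snorm (comb x) ^+ 2) - rC N * f1 * rC (vnorm x ^+ 2)) =
   snorm (comb x) ^+ 2 - N * complex.Re f1 * vnorm x ^+ 2.
  by case: f1 => a b /=; ring.
rewrite hR ler_norml in h; case/andP: h => h _.
have hre : 3 / 4 <= complex.Re f1.
  have := le_trans (Re_le_cabs _) hf1; case: (f1) => a b /=.
  rewrite ler_norml => /andP[]; lra.
have x0 : 0 <= N * vnorm x ^+ 2 by rewrite mulr_ge0 ?sqr_ge0 // ltW.
have h1 : 3 / 4 * (N * vnorm x ^+ 2) <= N * complex.Re f1 * vnorm x ^+ 2.
  rewrite (_ : N * complex.Re f1 * vnorm x ^+ 2 = complex.Re f1 * (N * vnorm x ^+ 2)).
    by rewrite ler_wpM2r.
  by ring.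
have h2 : N * g * M%:R * (vnorm x * vnorm x) <= 4^-1 * (N * vnorm x ^+ 2).
  rewrite (_ : N * g * M%:R * (vnorm x * vnorm x) = M%:R * g * (N * vnorm x ^+ 2)); last by ring.
  by rewrite ler_wpM2r.
by move: h h1 h2; lra.
Qed.

Lemma comb_inj x : comb x = 0 -> forall i, x i = 0.
Proof.
move=> hx i; have := comb_lower x; rewrite hx snorm0 expr0n mulr0 vnorm_sqr.
rewrite pmulr_rle0 // => h.
have h' : \sum_i cabs (x i) ^+ 2 == 0.
  by rewrite eq_le h sumr_ge0 // => j _; apply: sqr_ge0.
move: h'; rewrite psumr_eq0 => [/allP hh|j _]; last exact: sqr_ge0.
by have := hh i (mem_index_enum i); rewrite sqrf_eq0 cabs_eq0 => /eqP.
Qed.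

Definition code_defect := 2 * (2 * cf + 1) * (M%:R * g).

(** Orthogonal states have only nearly orthogonal coefficients. The identity operator bounds
    [vdot x y], which contributes [2 * cf] when multiplied by [f]; the error for [F] itself
    contributes 1. The outer factor 2 of [code_defect] comes from [comb_lower]. *)
Lemma comb_orthogonal F f x y : near_scalar F f -> cabs f <= cf ->
  inner (comb x) (comb y) = 0 ->
  cabs (inner (comb x) (apply F (comb y))) <= code_defect * (snorm (comb x) * snorm (comb y)).
Proof.
move=> hF hf orth.
have := comb_matrix_element x y hid; rewrite apply_id orth sub0r cabsN !cabsM (cabs_rC (ltW N0)).
move=> h1.
have hf1' : 3 / 4 <= cabs f1.
  have := cabsD f1 (1 - f1); rewrite addrC subrK cabs1 cabsC => h.
  by move: h hf1; rewrite [cabs (f1 - 1)]cabsC; lra.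
set xy := vnorm x * vnorm y in h1 *.
have xy0 : 0 <= xy by rewrite mulr_ge0 ?vnorm_ge0.
have NN := ltW N0.
have h2 : cabs (vdot x y) <= 2 * (M%:R * g * xy).
  have h3 : N * (3 / 4 * cabs (vdot x y)) <= N * (M%:R * g * xy).
    apply: (@le_trans _ _ (N * cabs f1 * cabs (vdot x y))).
      by rewrite -[N * cabs f1 * _]mulrA ler_wpM2l // ler_wpM2r ?cabs_ge0.
    by apply: le_trans h1 _; rewrite le_eqVlt; apply/orP; left; apply/eqP; ring.
  rewrite ler_pM2l // in h3.
  have := mulr_ge0 (mulr_ge0 (ler0n R M) g0) xy0.
  by move: h3; lra.
have h3 := comb_matrix_element x y hF.
have h4 : cabs (inner (comb x) (apply F (comb y))) <=
    (2 * cf + 1) * (M%:R * g) * (N * xy).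
  rewrite -[inner _ _](subrK (rC N * f * vdot x y)).
  apply: le_trans (cabsD _ _) _.
  have h5 : cabs (rC N * f * vdot x y) <= N * cf * (2 * (M%:R * g * xy)).
    rewrite !cabsM cabs_rC //.
    by apply: ler_pM; rewrite ?cabs_ge0 ?mulr_ge0 ?cabs_ge0 // ler_wpM2l.
  apply: le_trans (lerD h3 h5) _.
  by rewrite le_eqVlt; apply/orP; left; apply/eqP; rewrite /xy; ring.
apply: le_trans h4 _; rewrite /code_defect.
have h6 : N * xy <= 2 * (snorm (comb x) * snorm (comb y)).
  rewrite -(@ler_pXn2r _ 2) ?nnegrE ?mulr_ge0 ?snorm_ge0 ?vnorm_ge0 //.
  have hx := comb_lower x; have hy := comb_lower y.
  have h := ler_pM (mulr_ge0 NN (sqr_ge0 (vnorm x))) (mulr_ge0 NN (sqr_ge0 (vnorm y))) hx hy.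
  rewrite (_ : (N * xy) ^+ 2 = N * vnorm x ^+ 2 * (N * vnorm y ^+ 2)); last by rewrite /xy; ring.
  rewrite (_ : (2 * (snorm (comb x) * snorm (comb y))) ^+ 2 =
     2 * snorm (comb x) ^+ 2 * (2 * snorm (comb y) ^+ 2)) //.
  by ring.
have h7 : 0 <= (2 * cf + 1) * (M%:R * g).
  by apply: mulr_ge0; [rewrite addr_ge0 // mulr_ge0|apply: mulr_ge0].
apply: le_trans (ler_wpM2l h7 h6) _.
by rewrite le_eqVlt; apply/orP; left; apply/eqP; ring.
Qed.

Lemma span_comb (s : 'I_M -> R[i]) v :
  v \in <<[tuple s i *: Phi i | i < M]>>%VS -> exists x, v = comb x.
Proof.
move=> hv; exists (fun i => coord [tuple s i *: Phi i | i < M] i v * s i).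
rewrite {1}(coord_span hv); apply: eq_bigr => i _.
by rewrite -tnth_nth tnth_mktuple scalerA.
Qed.

Lemma dim_comb (s : 'I_M -> R[i]) : (forall i, s i != 0) ->
  \dim <<[tuple s i *: Phi i | i < M]>>%VS = M.
Proof.
move=> s0; rewrite -[RHS](size_tuple [tuple s i *: Phi i | i < M]).
apply/eqP; rewrite -/(free _); apply/freeP => x hx i.
have h : comb (fun i => x i * s i) = 0.
  rewrite -[RHS]hx; apply: eq_bigr => j _.
  by rewrite -tnth_nth tnth_mktuple scalerA.
by have /eqP := comb_inj h i; rewrite mulf_eq0 (negPf (s0 i)) orbF => /eqP.
Qed.

Lemma near_scalar_code (s : 'I_M -> R[i]) (d : nat) (eps delta : R) (kk : nat) :
  (forall i, s i != 0) -> M = (P ^ kk)%N -> 0 < delta ->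
  code_defect ^+ 2 <= eps * delta ->
  (forall F, dlocal d F -> opnorm_le1 F -> exists2 f, near_scalar F f & cabs f <= cf) ->
  AQEDC kk d eps delta <<[tuple s i *: Phi i | i < M]>>%VS.
Proof.
move=> s0 MP d0 heps hF; split; first by rewrite dim_comb.
move=> m pr Fs pr0 pr1 hFs.
apply: (approx_detection d0 heps pr0 pr1) => j psi phi /span_comb[y ->] /span_comb[x ->].
rewrite inner_self => psi1 orth.
have [Fl Fo] := hFs j; have [f hf fcf] := hF _ Fl Fo.
apply: le_trans (comb_orthogonal hf fcf orth) _.
have -> : snorm (comb y) = 1.
  apply/eqP; rewrite -(@eqrXn2 _ 2) ?snorm_ge0 // expr1n; apply/eqP.
  exact: (rC_inj psi1).
by rewrite mulr1.
Qed.

End NearlyOrthogonalCode.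

(** * Momenta, normalization and asymptotics *)

Section Momenta.
Context {R : realType}.

Lemma expiD (a b : R) : expi (a + b) = expi a * expi b.
Proof. by rewrite /expi cosD sinD; apply/eqP; rewrite eq_complex /= eqxx addrC eqxx. Qed.

Lemma expi0 : expi 0 = 1 :> R[i].
Proof. by rewrite /expi cos0 sin0. Qed.

Lemma expiMn (a : R) j : expi (a * j%:R) = expi a ^+ j.
Proof.
elim: j => [|j IH]; first by rewrite mulr0 expi0.
by rewrite -natr1 mulrDr mulr1 expiD IH exprSr.
Qed.

Lemma expi_conj (a : R) : (expi a)^* = expi (- a).
Proof. by rewrite /expi cosN sinN. Qed.

Lemma expi_2pi : expi (2 * pi) = 1 :> R[i].
Proof.
rewrite mulrC expiMn /expi cospi sinpi.
rewrite (_ : Complex (-1) 0 = -1 :> R[i]); first by rewrite sqrrN expr1n.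
by apply/eqP; rewrite eq_complex /= oppr0 !eqxx.
Qed.

Lemma expi_neq1 (t : R) : 0 < t < 2 * pi -> expi t != 1.
Proof.
move=> /andP[t0 t2]; apply/eqP => /(congr1 (@complex.Re R)) /= ht.
have h : 0 < sin (t / 2) by apply: sin_gt0_pi; apply/andP; split; lra.
have e1 : cos t = 1 - 2 * sin (t / 2) ^+ 2.
  rewrite {1}(_ : t = (t / 2) *+ 2); last by rewrite mulr2n; lra.
  by rewrite cos_mulr2n cos2sin2 mulr2n; ring.
have := exprn_gt0 2 h; move: ht; rewrite e1; lra.
Qed.

Definition momentum (n k : nat) : R := 2 * pi * k%:R / n%:R.

(** For distinct indices this is a geometric sum over a nontrivial [n]-th root of unity. Indices 0
    and [n] carry the same phase, hence the range from 1 to [n]. *)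
Lemma phase_sum_momentum (n a b : nat) : (0 < a <= n)%N -> (0 < b <= n)%N ->
  phase_sum n (momentum n a) (momentum n b) = (a == b)%:R * n%:R.
Proof.
move=> /andP[a0 an] /andP[b0 bn].
have n0 : (0 < n)%N by apply: leq_trans an.
have nn0 : (n%:R : R) != 0 by rewrite pnatr_eq0 -lt0n.
rewrite /phase_sum; case: eqVneq => [->|ab].
  under eq_bigr => j _ do rewrite expi_conj -expiD addNr expi0.
  by rewrite sumr_const card_ord mul1r.
rewrite mul0r.
under eq_bigr => j _ do rewrite expi_conj -expiD -mulNr -mulrDl expiMn.
set z := expi _.
have zn : z ^+ n = 1.
  rewrite -expiMn mulrDl mulNr /momentum !mulfVK // expiD -expi_conj !expiMn.
  by rewrite expi_2pi !expr1n rmorph1 mulr1.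
have z1 : z != 1.
  have big (x y : nat) : (0 < x)%N -> (x < y <= n)%N -> expi (momentum n y - momentum n x) != 1.
    move=> x0 /andP[xy yn]; apply: expi_neq1.
    have -> : momentum n y - momentum n x = 2 * pi * ((y - x)%N%:R / n%:R).
      by rewrite /momentum natrB ?(ltnW xy) //; field.
    have pi2 : 0 < 2 * pi :> R by rewrite mulr_gt0 // pi_gt0.
    rewrite mulr_gt0 ?divr_gt0 ?ltr0n ?subn_gt0 //= gtr_pMr // ltr_pdivrMr ?ltr0n // mul1r ltr_nat.
    by move: x0 xy yn; clear; lia.
  rewrite /z addrC; case: (ltngtP a b) ab => // h _.
    by apply: big => //; rewrite h bn.
  have := big b a b0; rewrite h an => /(_ isT); apply: contra => /eqP e1.
  by rewrite -opprB -expi_conj e1 rmorph1.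
apply/eqP; have := subrX1 z n; rewrite zn subrr => /esym/eqP.
by rewrite mulf_eq0 subr_eq0 (negPf z1).
Qed.

End Momenta.

(** * Rescaling of the excitation tensors *)

Section Normalization.
Context {R : realType} {P D : nat}.
Local Notation Mx := 'M[R[i]]_D.+1.
Implicit Types (B : 'I_P -> 'M[R[i]]_D.+1).
Context (A : 'I_P -> Mx) (m : nat) (q c e : R) (r : Mx) (l : Mx -> R[i]).
Hypothesis hA : mixing A m q c e r l.

(* [B p] is arbitrary in [p]; rescaling each [B p] to weight 1 leaves the span
   unchanged and bounds all tensors uniformly in [p]. *)
Definition weight B : R := complex.Re (overlap r l B B).

Lemma overlap_weight B : overlap r l B B = rC (weight B).
Proof.
have e0 := mix_e hA.
apply: ReE_ge0; apply: le_trans (mix_pos hA (tr2_psd B (mix_psd hA))).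
by rewrite rCE ler0c mulr_ge0 ?mnorm_ge0 ?ltW.
Qed.

(** One factor [e] is the lower bound of [l] on the semidefinite matrix [tr2 B B r], the other the
    lower bound of [r], tested on the image of a basis vector under the adjoint of [B i]. *)
Lemma weight_lower B i a : e ^+ 2 * mnorm (row a (B i)) ^+ 2 <= weight B.
Proof.
have e0 := mix_e hA.
have h1 := mix_pos hA (tr2_psd B (mix_psd hA)).
rewrite -/(overlap r l B B) overlap_weight lecR in h1.
pose v : 'cV[R[i]]_D.+1 := delta_mx a 0.
have Nv : mnorm v = 1.
  rewrite /mnorm (bigD1 a) //= big_ord1 mxE !eqxx cabs1 big1 ?addr0 // => j ja.
  by rewrite big_ord1 mxE (negPf ja) cabs0.
have h2 := le_trans (ler_norm _) (rq_le (tr2 B B r) v); rewrite Nv expr1n mulr1 in h2.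
have rq_conj X Y : rq (X *m Y *m hermc X) v = rq Y (hermc X *m v).
  have e1 : vadj (hermc X *m v) = vadj v *m X.
    by rewrite /vadj trmx_mul map_mxM -[in RHS](hermcK X).
  by rewrite /rq /qform e1 !mulmxA.
have rq_sum (f : 'I_P -> Mx) : rq (\sum_j f j) v = \sum_j rq (f j) v.
  apply: (big_morph (fun Y => rq Y v)) => [Y Z|]; first exact: rqD.
  by rewrite /rq /qform mulmx0 mul0mx mxE.
have pos j : 0 <= rq (B j *m r *m hermc (B j)) v.
  by rewrite rq_conj; apply: le_trans (mix_lower hA _); rewrite mulr_ge0 ?exprn_ge0 ?mnorm_ge0 ?ltW.
have h3 : rq (B i *m r *m hermc (B i)) v <= rq (tr2 B B r) v.
  by rewrite /tr2 rq_sum (bigD1 i) //= lerDl sumr_ge0.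
rewrite rq_conj in h3.
have h4 := mix_lower hA (hermc (B i) *m v).
have e2 : mnorm (hermc (B i) *m v) = mnorm (row a (B i)).
  rewrite -[in RHS]mnorm_conjT; congr mnorm; rewrite /v -colE.
  by apply/matrixP => x y; rewrite !mxE.
rewrite e2 in h4; rewrite expr2 -mulrA.
apply: (le_trans _ h1); rewrite ler_pM2l //.
by apply: (le_trans h4); apply: (le_trans h3).
Qed.

(** After rescaling, each of the [P * D.+1] rows has norm at most [1 / e]. The bound depends on [A]
    alone and so is uniform in the momentum and in [n]. *)
Definition beta0 : R := 1 + tnorm A + (P * D.+1)%:R / e.

Lemma beta0_ge1 : 1 <= beta0.
Proof.
have e0 := mix_e hA.
by rewrite /beta0 -addrA lerDl addr_ge0 ?tnorm_ge0 // divr_ge0 // ltW.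
Qed.

Lemma tnorm_le_beta0 : tnorm A <= beta0.
Proof.
have e0 := mix_e hA; have h : 0 <= (P * D.+1)%:R / e by rewrite divr_ge0 // ltW.
by rewrite /beta0; lra.
Qed.

Definition normalized B : 'I_P -> Mx := fun i => rC (Num.sqrt (weight B))^-1 *: B i.

Section Nonzero.
Context (B : 'I_P -> Mx).
Hypothesis B0 : exists i, B i != 0.

Lemma weight_gt0 : 0 < weight B.
Proof.
have [i Bi] := B0; have e0 := mix_e hA.
have [a ra] : exists a, row a (B i) != 0.
  case: (pickP (fun a => row a (B i) != 0)) => [a h|h]; first by exists a.
  case/negP: Bi; apply/eqP/row_matrixP => a; rewrite row0; apply/eqP.
  exact: negbFE (h a).
apply: lt_le_trans (weight_lower B i a).
by rewrite mulr_gt0 ?exprn_gt0 ?mnorm_gt0.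
Qed.

Let w0 : 0 < Num.sqrt (weight B). Proof. by rewrite sqrtr_gt0 weight_gt0. Qed.

Lemma tr2_scale (s t : R) (B1 B2 : 'I_P -> Mx) Y :
  tr2 (fun i => rC s *: B1 i) (fun i => rC t *: B2 i) Y = rC (s * t) *: tr2 B1 B2 Y.
Proof.
rewrite /tr2 scaler_sumr; apply: eq_bigr => i _.
by rewrite hermcZr -!scalemxAl -scalemxAr scalerA rCM.
Qed.

Lemma overlap_normalized : overlap r l (normalized B) (normalized B) = 1.
Proof.
rewrite /overlap /normalized tr2_scale (mixZ hA) -/(overlap r l B B) overlap_weight -rCM.
rewrite -invfM -expr2 sqr_sqrtr ?(ltW weight_gt0) // mulVf ?gt_eqF ?weight_gt0 //.
Qed.

Lemma tnorm_normalized : tnorm (normalized B) <= beta0.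
Proof.
have e0 := mix_e hA.
have h i a : mnorm (row a (normalized B i)) <= e^-1.
  have -> : row a (normalized B i) = rC (Num.sqrt (weight B))^-1 *: row a (B i).
    by apply/matrixP => x y; rewrite !mxE.
  rewrite mnormZ cabs_rC ?invr_ge0 ?sqrtr_ge0 // mulrC ler_pdivrMr // -ler_pdivrMl ?invr_gt0 // invrK.
  rewrite -(@ler_pXn2r _ 2) ?nnegrE ?mulr_ge0 ?mnorm_ge0 ?sqrtr_ge0 ?(ltW e0) //.
  by rewrite exprMn sqr_sqrtr ?(ltW weight_gt0) // weight_lower.
have h2 : tnorm (normalized B) <= (P * D.+1)%:R / e.
  rewrite /tnorm; apply: (@le_trans _ _ (\sum_(i < P) \sum_(a < D.+1) e^-1)).
    apply: ler_sum => i _; rewrite /mnorm; apply: ler_sum => a _.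
    apply: le_trans (h i a); rewrite /mnorm big_ord1; apply: ler_sum => b _.
    by rewrite [in leRHS]mxE.
  by rewrite !sumr_const !card_ord -mulrnA mulnC mulr_natl.
by apply: le_trans h2 _; rewrite /beta0 lerDr addr_ge0 ?tnorm_ge0.
Qed.

(** Every summand of the excitation state contains exactly one factor [B], so the scalar comes out
    once. *)
Lemma excitation_normalized n p :
  excitation n A B p = rC (Num.sqrt (weight B)) *: excitation n A (normalized B) p.
Proof.
rewrite !excitation_wave /wave scaler_sumr; apply: eq_bigr => j _.
rewrite [RHS]scalerA [X in _ = X *: _]mulrC -[RHS]scalerA; congr (_ *: _).
apply/ffunP => w; rewrite stateZ !ffunE -mxtraceZ; congr (\tr _).
set t := Num.sqrt _.
have e1 (k : 'I_n) : single A j B k (w k) =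
    rC (if k == j then t else 1) *: single A j (normalized B) k (w k).
  rewrite /single val_eqE; case: ifP => _; last by rewrite rC1 scale1r.
  by rewrite /normalized scalerA -rCM mulfV ?rC1 ?scale1r // gt_eqF.
rewrite (eq_bigr _ (fun k _ => e1 k)) scaler_prod; congr (_ *: _).
rewrite (bigD1 j) //= eqxx big1 ?mulr1 // => k /negPf ->.
exact: rC1.
Qed.

End Nonzero.
End Normalization.

Section Asymptotics.
Context {R : realType}.

Lemma geometric_poly_bound (q : R) (J : nat) : 0 <= q < 1 ->
  exists2 C, 0 <= C & forall k, q ^+ k * k.+1%:R ^+ J <= C.
Proof.
move=> /andP[q0 q1]; have [->|qn0] := eqVneq q 0.
  exists 1 => // -[|k]; first by rewrite expr0 expr1n mulr1.
  by rewrite expr0n mul0r.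
have qp : 0 < q by rewrite lt_neqAle eq_sym qn0.
have s0 : 0 < - ln q by rewrite oppr_gt0 ln_lt0 // qp.
set s := - ln q in s0.
have J0 : 0 < J.+1%:R / s :> R by rewrite divr_gt0.
have bound0 : 0 <= (J.+1%:R / s) ^+ J.+1 / q by rewrite divr_ge0 ?exprn_ge0 ?ltW.
exists ((J.+1%:R / s) ^+ J.+1 / q) => // k.
(* Raising [y <= expR y] to the power [J + 1] gives (k+1)^(J+1) <= ((J+1)/s)^(J+1) q^(-(k+1)),
   because [expR s] is the inverse of [q]. *)
pose y : R := s * k.+1%:R / J.+1%:R.
have y_le : y <= expR y by apply: le_trans (expR_ge1Dx y); rewrite lerDr.
have kE : k.+1%:R = J.+1%:R / s * y.
  have : (J.+1%:R : R) != 0 by rewrite pnatr_eq0.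
  rewrite /y; move: (J.+1%:R) (k.+1%:R) => j z j0.
  by field; rewrite j0 gt_eqF.
have h1 : k.+1%:R ^+ J.+1 <= (J.+1%:R / s) ^+ J.+1 * expR y ^+ J.+1.
  rewrite {1}kE exprMn ler_wpM2l ?exprn_ge0 ?(ltW J0) //.
  rewrite lerXn2r ?nnegrE ?expR_ge0 // /y.
  by rewrite divr_ge0 // mulr_ge0 // ltW.
have h2 : expR y ^+ J.+1 = (q ^+ k.+1)^-1.
  rewrite -expRM_natl /y mulrC divfK ?pnatr_eq0 // mulrC expRM_natl.
  by rewrite /s expRN lnK ?posrE // exprVn.
have h3 : k.+1%:R ^+ J <= k.+1%:R ^+ J.+1 :> R by rewrite ler_weXn2l ?ler1n.
apply: (@le_trans _ _ (q ^+ k * ((J.+1%:R / s) ^+ J.+1 * (q ^+ k.+1)^-1))).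
  by rewrite ler_wpM2l ?exprn_ge0 // -h2 (le_trans h3).
rewrite [q ^+ k.+1]exprS le_eqVlt; apply/orP; left; apply/eqP.
have := expf_neq0 k qn0; move: (q ^+ k) ((J.+1%:R / s) ^+ J.+1) => z b z0.
by field; rewrite qn0 z0.
Qed.

Lemma powR_eventually_small (t e : R) : 0 < t -> 0 < e ->
  exists N, forall n : nat, (N <= n)%N -> (n%:R : R) `^ (- t) <= e.
Proof.
move=> t0 e0; exists (Num.truncn ((e^-1) `^ t^-1)).+1 => n hn.
have hx : (e^-1) `^ t^-1 <= n%:R.
  apply: (@le_trans _ _ (Num.truncn ((e^-1) `^ t^-1)).+1%:R); last by rewrite ler_nat.
  by apply/ltW; apply: truncnS_gt.
have h : e^-1 <= n%:R `^ t.
  have -> : e^-1 = ((e^-1) `^ t^-1) `^ t.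
    by rewrite -powRrM mulVf ?gt_eqF // powRr1 // invr_ge0 ltW.
  by apply: ge0_ler_powR => //; rewrite ?nnegrE ?powR_ge0 // ltW.
rewrite powRN -[e]invrK lef_pV2 // posrE ?invr_gt0 //.
by apply: lt_le_trans h; rewrite invr_gt0.
Qed.

Lemma nat_eventually (x : R) : exists N, forall n : nat, (N <= n)%N -> x <= n%:R.
Proof.
exists (Num.truncn x).+1 => n hn; apply: (@le_trans _ _ (Num.truncn x).+1%:R).
  by apply/ltW; apply: truncnS_gt.
by rewrite ler_nat.
Qed.

Lemma pow_truncn_le (p n : nat) (kappa : R) : (1 < p)%N -> (0 < n)%N -> 0 < kappa ->
  ((p ^ Num.truncn (kappa * ln n%:R / ln p%:R))%N%:R : R) <= n%:R `^ kappa.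
Proof.
move=> p1 n0 k0; set kk := Num.truncn _.
have lp : 0 < ln (p%:R : R) by rewrite ln_gt0 // ltr1n.
have ln0 : 0 <= ln (n%:R : R) by rewrite ln_ge0 // ler1n.
have h : (kk%:R : R) <= kappa * ln n%:R / ln p%:R.
  rewrite truncn_le; apply: divr_ge0 (ltW lp).
  exact: mulr_ge0 (ltW k0) ln0.
have np : (n%:R : R) != 0 by rewrite pnatr_eq0 -lt0n.
rewrite /powR (negPf np) natrX.
have -> : (p%:R : R) ^+ kk = expR (kk%:R * ln p%:R).
  by rewrite expRM_natl lnK // posrE ltr0n (ltn_trans _ p1).
by rewrite ler_expR -ler_pdivlMr.
Qed.

Lemma truncn_powR_gt0 (n : nat) (a : R) : (0 < n)%N -> 0 <= a ->
  (0 < Num.truncn ((n%:R : R) `^ a))%N.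
Proof.
move=> n0 a0; rewrite truncn_gt0; rewrite -[X in X <= _](@powRr0 _ n%:R).
by rewrite ler_powR // ler1n.
Qed.

Lemma truncn_powR_le (n : nat) (a : R) :
  ((Num.truncn ((n%:R : R) `^ a))%:R : R) <= n%:R `^ a.
Proof. by rewrite truncn_le // powR_ge0. Qed.

Lemma powR_mul (n : nat) (a b : R) : (0 < n)%N ->
  (n%:R : R) `^ a * n%:R `^ b = n%:R `^ (a + b).
Proof. by move=> n0; rewrite powRD // pnatr_eq0 -lt0n n0 implybT. Qed.

End Asymptotics.

Lemma gauge_normalized {R : realType} {P D : nat} (A B : 'I_P -> 'M[R[i]]_D.+1)
    (r L : 'M[R[i]]_D.+1) (z : R[i]) (l := fun X => z * pairing L X) :
  gauge_condition A B L -> gauge A l (normalized r l B).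
Proof.
move=> h; have A1 : A = (fun i => rC 1 *: A i).
  by apply/funext => i; rewrite rC1 scale1r.
split=> Y; rewrite /l; have [h1 h2] := h Y.
  by rewrite [in tr2 _ A]A1 tr2_scale pairingZ [pairing L _]h1 !mulr0.
by rewrite [in tr2 A]A1 tr2_scale pairingZ [pairing L _]h2 !mulr0.
Qed.

Lemma map_enum_tuple (T : finType) (K : {set T}) (V : Type) (G : T -> V) :
  [seq G k | k <- enum K] = [tuple G (enum_val i) | i < #|K|].
Proof.
have -> : enum K = [seq tnth (enum_tuple (mem K)) i | i <- enum 'I_#|K|].
  by rewrite map_tnth_enum.
rewrite -map_comp; apply: eq_map => i /=.
by rewrite (tnth_nth (enum_val i)) -enum_val_nth.
Qed.

(** * The excitation code *)

Section Assembly.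
Context {R : realType} {P D : nat}.
Context (A : 'I_P -> 'M[R[i]]_D.+1) (B : R -> 'I_P -> 'M[R[i]]_D.+1).
Context (L r : 'M[R[i]]_D.+1) (m : nat) (q c e : R) (z : R[i]).
Let l := fun X => z * pairing L X.
Hypothesis hA : mixing A m q c e r l.
Hypothesis hgauge : forall p : R, 0 < p <= 2 * pi -> gauge_condition A (B p) L.
Hypothesis hB : forall p : R, 0 <= p <= 2 * pi -> exists i, B p i != 0.
Context (i0 : 'I_P).
Local Notation beta := (beta0 A e).
Local Notation Bh p := (normalized r l (B p)).

Lemma momentum_range (n a : nat) : (0 < a <= n)%N -> 0 < (momentum n a : R) <= 2 * pi.
Proof.
move=> /andP[a0 an]; have pi2 : 0 < 2 * pi :> R by rewrite mulr_gt0 // pi_gt0.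
have n0 : 0 < n%:R :> R by rewrite ltr0n (leq_trans a0).
rewrite /momentum; apply/andP; split; first by rewrite divr_gt0 // mulr_gt0 // ltr0n.
by rewrite ler_pdivrMr // ler_pM2l // ler_nat.
Qed.

Lemma normalized_admissible p : 0 < p <= 2 * pi -> admissible A l beta (Bh p).
Proof.
move=> hp; split; last by apply: gauge_normalized; apply: hgauge.
apply: (tnorm_normalized hA); apply: hB.
by case/andP: hp => /ltW -> ->.
Qed.

Lemma normalized_overlap p : 0 < p <= 2 * pi -> overlap r l (Bh p) (Bh p) = 1.
Proof.
move=> hp; apply: (overlap_normalized hA); apply: hB.
by case/andP: hp => /ltW -> ->.
Qed.

Lemma vacuum_element n (F : op R n P) : opnorm_le1 F ->
  cabs (inner (mps n (fun=> A)) (apply F (mps n (fun=> A)))) <= @cs R D c beta ^+ 2.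
Proof.
move=> opF; apply: le_trans (cabs_inner_apply _ _ opF) _; rewrite expr2.
have -> : mps n (fun=> A) = mps n (single A 0%N A).
  by congr mps; apply/funext => a; rewrite /single; case: ifP.
have h := snorm_single hA (beta0_ge1 hA) (tnorm_le_beta0 hA) n 0%N (tnorm_le_beta0 hA).
by apply: ler_pM; rewrite ?snorm_ge0.
Qed.

(** Separates the construction from the asymptotics: every largeness condition on [n] is a
    hypothesis. The scalar attached to [F] is its vacuum element, because the diagonal overlaps
    equal 1 after rescaling. *)
Lemma excitation_code (n k d kk : nat) (K : {set 'I_n.+1}) (x g eps delta : R)
    (C := @cmain R D c r beta x) :
  (forall a, a \in K -> (0 < a <= n)%N) -> #|K| = (P ^ kk)%N ->
  (0 < n)%N -> (0 < d)%N -> (0 < k * m)%N -> (k * m <= n)%N ->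
  1 <= x -> 0 <= g <= 1 ->
  (k * m)%:R <= x * Num.sqrt n%:R * g -> d%:R * (k * m)%:R <= x * (n%:R * g ^+ 2) ->
  n%:R ^+ 2 * q ^+ k <= x -> @cvac R D c * q ^+ k <= 4^-1 ->
  #|K|%:R * (C * g) <= 4^-1 -> 0 < delta ->
  (2 * (2 * @cs R D c beta ^+ 2 + 1) * (#|K|%:R * (C * g))) ^+ 2 <= eps * delta ->
  AQEDC kk d eps delta
    (<<[seq excitation n A (B (momentum n (val a))) (momentum n (val a)) | a <- enum K]>>%VS).
Proof.
move=> hK cK n0 d0 De0 Den x1 /andP[g0 g1] hDe hd hq hvac hM del0 heps.
have b1 := beta0_ge1 hA; have bA := tnorm_le_beta0 hA.
have c0 : 0 <= c by have := mix_c hA; apply: le_trans.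
have q0 : 0 <= q by case/andP: (mix_q hA).
have cs0' := cs_ge0 hA b1 (D := D).
have N0 : 0 < n%:R :> R by rewrite ltr0n.
have sN : Num.sqrt (n%:R : R) ^+ 2 = n%:R by rewrite sqr_sqrtr // ltW.
pose p (i : 'I_#|K|) : R := momentum n (val (enum_val i)).
have iK (i : 'I_#|K|) : (0 < val (enum_val i) <= n)%N by apply: hK; apply: enum_valP.
have pr i : 0 < p i <= 2 * pi by apply: momentum_range.
pose Phi i : state R n P := excitation n A (Bh (p i)) (p i).
pose s i : R[i] := rC (Num.sqrt (weight r l (B (p i)))).
have Bnz i : exists j, B (p i) j != 0.
  by apply: hB; case/andP: (pr i) => /ltW -> ->.
have C0 : 0 <= C.
  by apply: (cmain_ge0 hA b1); apply: le_trans x1.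
have hns (F : op R n P) (S : {set 'I_n}) : supported_on i0 S F -> opnorm_le1 F ->
    (0 < #|S|)%N -> (#|S| <= d)%N ->
    near_scalar Phi n%:R (C * g) F (inner (mps n (fun=> A)) (apply F (mps n (fun=> A)))).
  move=> sF opF S0 Sd i j.
  have hS : #|S|%:R * (k * m)%:R <= x * (n%:R * g ^+ 2).
    by apply: le_trans hd; rewrite ler_wpM2r // ler_nat.
  have g01 : 0 <= g <= 1 by rewrite g0.
  have := excitation_matrix_element hA b1 bA (p j) (p i) (normalized_admissible (pr j))
    (normalized_admissible (pr i)) sF opF S0 De0 x1 g01 (sqrtr_ge0 _) sN hDe hS hq.
  have -> : phase_sum n (p i) (p j) = (val (enum_val i) == val (enum_val j))%:R * n%:R.
    exact: phase_sum_momentum (iK i) (iK j).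
  rewrite -/C [C * _]mulrCA -/(Phi i) -/(Phi j).
  have -> : (val (enum_val i) == val (enum_val j)) = (i == j).
    by rewrite val_eqE (inj_eq enum_val_inj).
  case: (eqVneq i j) => [<-|ij]; last by rewrite !mul0r.
  by rewrite normalized_overlap // !mul1r rCnat.
(* The identity has empty support, but the matrix element estimate wants a nonempty one; any single
   site will do. *)
have [S S0 Sd] : exists2 S : {set 'I_n}, (0 < #|S|)%N & (#|S| <= d)%N.
  by exists (finset.set1 (Ordinal n0)); rewrite finset.cards1.
have idS : supported_on i0 S (@idop R n P).
  exact: supported_sub (finset.sub0set S) (@idop_supported R P n i0).
have hid := hns _ _ idS (@opnorm_id R n P) S0 Sd; rewrite apply_id in hid.
have hf1 := le_trans (vacuum_norm hA Den) hvac.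
rewrite map_enum_tuple.
have -> : [tuple excitation n A (B (momentum n (val (enum_val i)))) (momentum n (val (enum_val i)))
    | i < #|K|] = [tuple s i *: Phi i | i < #|K|].
  by apply: eq_from_tnth => i; rewrite !tnth_mktuple (excitation_normalized hA (Bnz i)).
have cf0 : 0 <= @cs R D c beta ^+ 2 by apply: sqr_ge0.
apply: (near_scalar_code N0 (mulr_ge0 C0 g0) cf0 hM hid hf1 _ cK del0 heps).
- move=> i; apply/eqP => /(congr1 (@complex.Re R)) /= s0.
  have := weight_gt0 hA (Bnz i); rewrite -sqrtr_gt0.
  by rewrite s0 ltxx.
- move=> F lF opF; have [S1 cS1 sF] := dlocal_supported i0 lF.
  eexists; last exact: vacuum_element opF.
  by apply: (hns F S1) => //; rewrite cS1.
Qed.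

End Assembly.

Theorem theorem4 (R : realType) (P D : nat)
  (A : 'I_P -> 'M[R[i]]_D.+1) (B : R -> 'I_P -> 'M[R[i]]_D.+1)
  (nu kappa lambda : R) :
  (1 < P)%N ->
  0 < nu < 1 -> 0 < kappa -> 0 < lambda -> 5 * kappa + lambda < nu ->
  primitive_map (transfer A) -> spectral_radius1 (transfer A) ->
  (exists L, left_fixed_point A L /\
     forall p : R, 0 < p <= 2 * pi -> gauge_condition A (B p) L) ->
  (forall p : R, 0 <= p <= 2 * pi -> exists i, B p i != 0) ->
  exists c : R, 0 < c /\ exists N : nat, forall n : nat, (N <= n)%N ->
    exists K : {set 'I_n.+1},
      AQEDC (Num.truncn (kappa * ln (n%:R) / ln (P%:R)))
            (Num.truncn ((n%:R : R) `^ (1 - nu)))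
            (c * (n%:R : R) `^ (- (nu - (5 * kappa + lambda))))
            ((n%:R : R) `^ (- lambda))
            (<<[seq excitation n A (B (2 * pi * (val k)%:R / n%:R)) (2 * pi * (val k)%:R / n%:R)
                 | k <- enum K]>>%VS).
Proof.
move=> P1 /andP[nu0 nu1] kap0 lam0 hsum prim spec [L [Lfix gau]] Bnz.
have factor (u v w y : R) : 2 * (2 * u + 1) * (v * (w * y)) = 2 * (2 * u + 1) * w * (v * y).
  by ring.
(* n^(-t) bounds the code dimension times the relative error; by [E7] its square has the same
   exponent as [eps * delta]. *)
pose t := (nu - 5 * kappa) / 2.
have t0 : 0 < t by rewrite /t; lra.
(* [E1] makes the relative error at most 1, [E2] absorbs the chain ends, [E4] the neighbourhood of
   the support, [E5] the dimension, and [E6] leaves enough momenta. *)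
have E1 : (3 * kappa - nu) / 2 <= 0 by lra.
have E2 : kappa <= 2^-1 + (3 * kappa - nu) / 2 by lra.
have E3 : (3 * kappa - nu) / 2 + (3 * kappa - nu) / 2 = 3 * kappa - nu by lra.
have E4 : 1 - nu + kappa <= 1 + (3 * kappa - nu) by lra.
have E5 : kappa + (3 * kappa - nu) / 2 <= - t by rewrite /t; lra.
have E6 : kappa <= 1 by lra.
have E7 : - (nu - (5 * kappa + lambda)) + - lambda = - t + - t by rewrite /t; lra.
have [m [q [c [e [r [z hA]]]]]] := transfer_mixing prim spec Lfix.
have i0 : 'I_P := Ordinal (ltnW P1).
have m0 := mix_m hA; have /andP[q0 q1] := mix_q hA.
have c0 : 0 <= c by apply: le_trans (mix_c hA).
(* As [kappa * J >= 2], [n^2] is at most the [J]-th power of n^kappa, hence of [k + 1]; the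
   successor makes up for truncating [k]. *)
pose J := (Num.truncn (2 / kappa)).+1.
have hJ : 2 <= kappa * J%:R.
  by rewrite mulrC -ler_pdivrMr //; apply/ltW; apply: truncnS_gt.
have [Cq Cq0 hCq] := geometric_poly_bound J (mix_q hA).
pose x : R := 1 + m%:R + Cq.
have x1 : 1 <= x by rewrite /x -addrA lerDl addr_ge0.
have x0 : 0 <= x by apply: le_trans x1.
have mx : m%:R <= x by rewrite /x; have := ler0n R m; move: Cq0; lra.
have Cqx : Cq <= x by rewrite /x; have := ler0n R m; lra.
pose C := @cmain R D c r (beta0 A e) x.
have C0 : 0 <= C by apply: (cmain_ge0 hA (beta0_ge1 hA)).
pose cf := @cs R D c (beta0 A e) ^+ 2.
have cf0 : 0 <= cf by apply: sqr_ge0.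
pose C1 := 2 * (2 * cf + 1) * C.
have C10 : 0 <= C1.
  by apply: mulr_ge0 C0; apply: mulr_ge0 => //; apply: addr_ge0 => //; apply: mulr_ge0.
have cv0 : 0 <= @cvac R D c by rewrite mulr_ge0 ?sqr_ge0.
exists (C1 ^+ 2 + 1); split; first by rewrite ltr_wpDl ?sqr_ge0.
have e0 : 0 < (4 * (C + 1))^-1 :> R by rewrite invr_gt0 mulr_gt0 // ltr_wpDl.
(* The thresholds ensure in turn that the code vectors are independent with room to spare, that a
   window fits into the chain, and that the squared vacuum norm is within 1/4 of 1. *)
have [N1 hN1] := powR_eventually_small t0 e0.
have [N2 hN2] := nat_eventually (x ^+ 2).
have [N3 hN3] := nat_eventually (4 * (@cvac R D c * Cq)).
exists (N1 + N2 + N3 + 1)%N => n hn.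
have n0 : (0 < n)%N by apply: leq_trans hn; rewrite addn1.
have {}hN1 : n%:R `^ (- t) <= (4 * (C + 1))^-1 by apply: hN1; apply: leq_trans hn; rewrite -!addnA leq_addr.
have {}hN2 : x ^+ 2 <= n%:R by apply: hN2; apply: leq_trans hn; rewrite -!addnA addnCA leq_addr.
have {}hN3 : 4 * (@cvac R D c * Cq) <= n%:R by apply: hN3; apply: leq_trans hn; rewrite addnAC leq_addl.
have n1 : 1 <= (n%:R : R) by rewrite ler1n.
have nn0 : 0 <= (n%:R : R) by [].
have nne : (n%:R : R) != 0 by rewrite pnatr_eq0 -lt0n.
set kk := Num.truncn (kappa * ln n%:R / _); set d := Num.truncn (_ `^ (1 - nu)).
pose k := Num.truncn ((n%:R : R) `^ kappa).
pose g := (n%:R : R) `^ ((3 * kappa - nu) / 2).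
have powE (a b : R) : a <= b -> (n%:R : R) `^ a <= n%:R `^ b by apply: ler_powR.
have hM : ((P ^ kk)%N%:R : R) <= n%:R `^ kappa by apply: pow_truncn_le.
have k0 : (0 < k)%N by apply: truncn_powR_gt0; rewrite ?ltW.
have d0 : (0 < d)%N by apply: truncn_powR_gt0; rewrite // subr_ge0 ltW.
have g0 : 0 <= g by apply: powR_ge0.
have g1 : g <= 1.
  by rewrite /g -[leRHS](@powRr0 _ n%:R); apply: powE.
have sE : Num.sqrt (n%:R : R) = n%:R `^ 2^-1 by rewrite powR12_sqrt.
have De_le : (k * m)%:R <= x * n%:R `^ kappa :> R.
  by rewrite natrM mulrC ler_pM // truncn_powR_le.
have hDe : (k * m)%:R <= x * Num.sqrt n%:R * g.
  apply: le_trans De_le _; rewrite -mulrA ler_wpM2l // sE /g powR_mul //.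
  by apply: powE.
have g2 : g ^+ 2 = n%:R `^ (3 * kappa - nu).
  by rewrite expr2 /g powR_mul // E3.
have hd : d%:R * (k * m)%:R <= x * (n%:R * g ^+ 2).
  have h1 : (d%:R : R) <= n%:R `^ (1 - nu) by apply: truncn_powR_le.
  apply: (le_trans (ler_pM (ler0n _ _) (ler0n _ _) h1 De_le)).
  rewrite mulrCA ler_wpM2l // g2 powR_mul // -{2}[n%:R](powRr1 nn0) powR_mul //.
  by apply: powE.
have Den : (k * m <= n)%N.
  rewrite -(ler_nat R); apply: le_trans hDe _.
  have xs : x <= Num.sqrt n%:R by rewrite -[x]ger0_norm // -sqrtr_sqr ler_wsqrtr.
  have sn : Num.sqrt (n%:R : R) * Num.sqrt n%:R = n%:R by rewrite -expr2 sqr_sqrtr.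
  rewrite -[leRHS]sn; apply: (@le_trans _ _ (x * Num.sqrt n%:R)).
    by rewrite ler_piMr // mulr_ge0 ?sqrtr_ge0.
  by rewrite ler_wpM2r ?sqrtr_ge0.
have nq : n%:R ^+ 2 * q ^+ k <= Cq.
  apply: (le_trans _ (hCq k)); rewrite mulrC ler_wpM2l ?exprn_ge0 //.
  rewrite -powR_mulrn //; apply: (le_trans (powE _ _ hJ)).
  rewrite powRrM powR_mulrn ?powR_ge0 // lerXn2r ?nnegrE ?powR_ge0 //.
  by apply/ltW; apply: truncnS_gt.
have hvac : @cvac R D c * q ^+ k <= 4^-1.
  have h1 : n%:R * (@cvac R D c * q ^+ k) <= @cvac R D c * Cq.
    rewrite mulrCA ler_wpM2l //; apply: le_trans nq; rewrite ler_wpM2r ?exprn_ge0 //.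
    by rewrite expr2 ler_peMl.
  have n0' : 0 < (n%:R : R) by rewrite ltr0n.
  rewrite -(ler_pM2l n0'); apply: (le_trans h1).
  by rewrite ler_pdivlMr // mulrC.
have MG : ((P ^ kk)%N%:R : R) * g <= n%:R `^ (- t).
  apply: (le_trans (ler_wpM2r g0 hM)); rewrite /g powR_mul //.
  by apply: powE.
have MCg : ((P ^ kk)%N%:R : R) * (C * g) <= 4^-1.
  rewrite mulrCA; apply: (le_trans (ler_wpM2l C0 (le_trans MG hN1))).
  rewrite invfM mulrCA -[leRHS]mulr1 ler_wpM2l // ler_pdivrMr ?mul1r ?lerDl //.
  by rewrite ltr_wpDl.
have Mn : (P ^ kk <= n)%N.
  rewrite -(ler_nat R); apply: le_trans hM _; rewrite -[leRHS](powRr1 nn0).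
  by apply: powE.
(* The shift by one discards momentum 0, for which no gauge condition is given and which has the
   same phases as momentum [2 * pi]. *)
pose f (i : 'I_(P ^ kk)) : 'I_n.+1 := inord i.+1.
have fE i : val (f i) = i.+1 by rewrite /f /= inordK // ltnS (leq_trans _ Mn).
have f_inj : injective f.
  by move=> i j /(congr1 val); rewrite !fE => -[] /val_inj.
pose K : {set 'I_n.+1} := [set f i | i in [set: 'I_(P ^ kk)]%SET]%SET.
have cK : #|K| = (P ^ kk)%N by rewrite card_imset // cardsT card_ord.
exists K.
apply: (@excitation_code R P D A B L r m q c e z hA gau Bnz i0 n k d kk K x g).
- by move=> a /imsetP[i _ ->]; rewrite fE /= (leq_trans _ Mn).
- exact: cK.
- exact: n0.
- exact: d0.
- by rewrite muln_gt0 k0.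
- exact: Den.
- exact: x1.
- by rewrite g0.
- exact: hDe.
- exact: hd.
- exact: le_trans nq Cqx.
- exact: hvac.
- by rewrite cK.
- by rewrite powR_gt0 // ltr0n.
- rewrite cK -[leRHS]mulrA powR_mul //.
  rewrite E7 -powR_mul // -/cf.
  rewrite factor -/C1 exprMn; apply: ler_pM; rewrite ?sqr_ge0 ?lerDl //.
  have p0 := mulr_ge0 (ler0n R (P ^ kk)) g0.
  by rewrite expr2; exact: (ler_pM p0 p0 MG MG).
Qed.
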